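(* There exist absolute constants $\varepsilon_0\in(0,1)$ and $C\ge 1$ such that the following holds. Let $N_1,N_2,L_1,L_2>0$, let $\pm_1,\pm_2\in\{+,-\}$ be arbitrary signs, let $\omega\in\mathbb S^2$, let $I\subset\mathbb R$ be a compact interval of length $|I|$, and let $0<\alpha\le\varepsilon_0$. Let $u_1,u_2\in L^2(\mathbb R^{1+3})$ satisfy $\operatorname{supp}\widehat{u_j}\subset K^{\pm_j}_{N_j,L_j}$ for $j=1,2$, and assume in addition that $$\operatorname{supp}\widehat{u_1}\subset\{(\tau,\xi)\in\mathbb R^{1+3}:\ \theta(\xi,\omega^\perp)\ge\alpha\}.$$ Then $$\bigl\|\mathbf P_{\xi_0\cdot\omega\in I}(u_1u_2)\bigr\|\le C\left(\frac{|I|\,\min(N_1,N_2)\,L_1L_2}{\alpha}\right)^{1/2}\|u_1\|\,\|u_2\|.$$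
   Context: Points of $\mathbb R^{1+3}$ are written $(\tau,\xi)$ with $\tau\in\mathbb R$, $\xi\in\mathbb R^3$ (Fourier variables of $(t,x)$); $\|\cdot\|$ is the norm of $L^2(\mathbb R^{1+3})$; $\widehat u$ is the space-time Fourier transform. For $N,L>0$ and a sign $\pm$, $$K^{\pm}_{N,L}=\Bigl\{(\tau,\xi)\in\mathbb R^{1+3}:\ \tfrac N2<|\xi|\le N,\ \bigl|-\tau\pm|\xi|\bigr|\le L\Bigr\}.$$ The statement $\operatorname{supp}\widehat u\subset A$ means that $\widehat u$ vanishes almost everywhere outside $A$. For a measurable $A\subset\mathbb R^{1+3}$, $\mathbf P_A$ is the Fourier multiplier with symbol the characteristic function $\chi_A$, i.e. $\widehat{\mathbf P_Af}=\chi_A\widehat f$; $\mathbf P_{\xi_0\cdot\omega\in I}$ denotes $\mathbf P_A$ with $A=\{(\tau,\xi):\xi\cdot\omega\in I\}$. For $\xi\neq0$, $\theta(\xi,\omega^\perp)\in[0,\pi/2]$ is the angle between $\xi$ and the plane $\omega^\perp\subset\mathbb R^3$ orthogonal to $\omega$ (the minimum of the angles between $\xi$ and nonzero vectors of $\omega^\perp$). *)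

(* Defs.v *)
From HB Require Import structures.
From mathcomp Require Export all_boot all_order all_algebra.
From mathcomp Require Export complex.
From mathcomp Require Export all_classical all_reals all_analysis.
From mathcomp Require Export measurable_realfun lebesgue_integral_fubini.

Set Implicit Arguments.
Unset Strict Implicit.
Unset Printing Implicit Defensive.

Import Order.TTheory GRing.Theory Num.Theory.
Import numFieldNormedType.Exports.

Local Open Scope classical_set_scope.
Local Open Scope ring_scope.
Local Open Scope complex_scope.

(* [measurableTypeR R] is [R] with its Borel sigma-algebra. *)
Notation vec3 R :=
  (measurableTypeR R * measurableTypeR R * measurableTypeR R)%type.

Notation spacetime R := (measurableTypeR R * vec3 R)%type.

Definition dot3 (R : realType) (x y : vec3 R) : R :=
  x.1.1 * y.1.1 + x.1.2 * y.1.2 + x.2 * y.2.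

Definition norm3 (R : realType) (x : vec3 R) : R := Num.sqrt (dot3 x x).

Definition dot4 (R : realType) (z w : spacetime R) : R :=
  z.1 * w.1 + dot3 z.2 w.2.

Definition norm4 (R : realType) (z : spacetime R) : R := Num.sqrt (dot4 z z).

Definition angle3 (R : realType) (x y : vec3 R) : R :=
  acos (dot3 x y / (norm3 x * norm3 y)).

(* For x and omega nonzero the infimum is a minimum. *)
Definition angle_perp (R : realType) (x omega : vec3 R) : R :=
  inf [set angle3 x y | y in [set y : vec3 R | y <> 0 /\ dot3 y omega = 0]].

(* The library's sigma-finite instance on products is not found by
   inference, hence this lemma and the instances on [mu2], [mu3], [mu4]. *)
Lemma sigma_finite_product d1 d2 (T1 : measurableType d1)
    (T2 : measurableType d2) (R : realType)
    (m1 : {sigma_finite_measure set T1 -> \bar R})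
    (m2 : {sigma_finite_measure set T2 -> \bar R}) :
  sigma_finite setT (m1 \x m2)%E.
Proof.
have /sigma_finiteP[F [TF ndF Foo]] := sigma_finiteT m1.
have /sigma_finiteP[G [TG ndG Goo]] := sigma_finiteT m2.
exists (fun n => F n `*` G n).
  rewrite -setXTT TF TG predeqE => -[x y]; split.
    move=> [/= [n _ Fnx] [k _ Gky]]; exists (maxn n k) => //; split.
    - by move: x Fnx; exact/subsetPset/ndF/leq_maxl.
    - by move: y Gky; exact/subsetPset/ndG/leq_maxr.
  by move=> [n _ []/= ? ?]; split; exists n.
move=> k; have [? ?] := Foo k; have [? ?] := Goo k.
split; first exact: measurableX.
by rewrite product_measure1E// lte_mul_pinfty// ge0_fin_numE.
Qed.

Definition mu2 (R : realType) :
    set (measurableTypeR R * measurableTypeR R)%type -> \bar R :=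
  (@lebesgue_measure R \x @lebesgue_measure R)%E.

HB.instance Definition _ (R : realType) := Measure.on (@mu2 R).
HB.instance Definition _ (R : realType) :=
  Measure_isSigmaFinite.Build _ _ _ (@mu2 R) (sigma_finite_product _ _).

Definition mu3 (R : realType) : set (vec3 R) -> \bar R :=
  (@mu2 R \x @lebesgue_measure R)%E.

HB.instance Definition _ (R : realType) := Measure.on (@mu3 R).
HB.instance Definition _ (R : realType) :=
  Measure_isSigmaFinite.Build _ _ _ (@mu3 R) (sigma_finite_product _ _).

Definition mu4 (R : realType) : set (spacetime R) -> \bar R :=
  (@lebesgue_measure R \x @mu3 R)%E.

HB.instance Definition _ (R : realType) := Measure.on (@mu4 R).
HB.instance Definition _ (R : realType) :=
  Measure_isSigmaFinite.Build _ _ _ (@mu4 R) (sigma_finite_product _ _).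

Definition in_L2 (R : realType) (u : spacetime R -> R[i]) : Prop :=
  ((fun z => complex.Re (u z)) \in Lfun (@mu4 R) 2%:E) /\
  ((fun z => complex.Im (u z)) \in Lfun (@mu4 R) 2%:E).

Definition L2norm (R : realType) (u : spacetime R -> R[i]) : \bar R :=
  Lnorm (@mu4 R) 2%:E (fun z => (Normc.normc (u z))%:E).

Definition cintegral (R : realType) (f : spacetime R -> R[i]) : R[i] :=
  (\int[@mu4 R]_z complex.Re (f z)) +i* (\int[@mu4 R]_z complex.Im (f z)).

Definition expNi (R : realType) (a : R) : R[i] := cos a -i* sin a.

(* Meaningful for integrable f only. *)
Definition fourierL1 (R : realType) (f : spacetime R -> R[i])
    (zeta : spacetime R) : R[i] :=
  cintegral (fun z => expNi (dot4 z zeta) * f z).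

Definition trunc_ball (R : realType) (n : nat) (u : spacetime R -> R[i])
    (z : spacetime R) : R[i] :=
  if norm4 z <= n%:R then u z else 0.

(* [v] is a representative of the Fourier-Plancherel transform of [u]: the
   limit in L2 of the Fourier integrals of [u] over balls of radius [n]. *)
Definition is_fourierL2 (R : realType) (u v : spacetime R -> R[i]) : Prop :=
  [/\ in_L2 u, in_L2 v &
      L2norm (fun zeta => fourierL1 (trunc_ball n u) zeta - v zeta)
        @[n --> \oo] --> 0%E].

(* By Plancherel such a [v] always exists and is unique almost everywhere. *)
Definition fourier_supp (R : realType) (u : spacetime R -> R[i])
    (A : set (spacetime R)) : Prop :=
  exists2 v, is_fourierL2 u v &
    {ae @mu4 R, forall zeta, ~ A zeta -> v zeta = 0}.

(* [w] is in L2 and represents [P_A f] for an integrable [f]. *)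
Definition is_multiplier (R : realType) (A : set (spacetime R))
    (f w : spacetime R -> R[i]) : Prop :=
  is_fourierL2 w (fun zeta => (\1_A zeta : R)%:C * fourierL1 f zeta).

(* [s = false] is the sign +, [s = true] the sign -. *)
Definition Kset (R : realType) (s : bool) (N L : R) : set (spacetime R) :=
  [set zeta | N / 2 < norm3 zeta.2 <= N /\
              `| - zeta.1 + (-1) ^+ s * norm3 zeta.2 | <= L].

Definition angular_region (R : realType) (omega : vec3 R) (alpha : R) :
    set (spacetime R) :=
  [set zeta | zeta.2 <> 0 /\ alpha <= angle_perp zeta.2 omega].

(* Symbol region of [P_(xi . omega \in [a, b])]. *)
Definition slab (R : realType) (omega : vec3 R) (a b : R) :
    set (spacetime R) :=
  [set zeta | a <= dot3 zeta.2 omega <= b].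

(* Main.v *)
(** By Plancherel it suffices to bound, in L^2 of the slab [a <= xi . omega <= b],
    the convolution [|v1| * |v2|] of the Fourier transforms of [u1] and [u2].
    Cut [v1] into tiles [t <= xi . omega < t + l] with [l = b - a] (any larger
    [l] works, which settles [a = b]).  Over the slab a tile of [v1] only meets
    the part of [v2] in a strip of width [2 l], so Minkowski and Cauchy-Schwarz
    reduce the estimate to a single tile.  There Cauchy-Schwarz reduces it to
    the measure of [{eta in K1 : zeta - eta in K2, eta in the tile}], uniformly
    in [zeta].  Replacing [v2] by its reflection does not change the L^2 norm
    of the convolution, so both signs may be taken equal.

    Integrating in [tau] first gains [min L1 L2] and leaves an ellipsoidal
    shell [T0 <= |xi| + |xi0 - xi| <= T1] with [T1 - T0 = 2 (L1 + L2)].  Rotate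
    [omega] to the third axis and fix [s = xi . omega].  In the plane, with
    [r1 = |xi|], [r2 = |xi0 - xi|], [T = r1 + r2] and [xi0] above the first axis,
    [dy/dT = r1 r2 / (T y) <= min N1 N2 / y] at fixed [x], while for fixed [T]
    the integral of [1 / y] in [x] is elementary and at most [32 / sig] as soon
    as [|s| >= sig r1]; the angular condition gives [sig = alpha / 2].

    The constant [(2 pi) ^ 4] of Plancherel's theorem is never identified: it
    enters as the total mass [fourier_mass] of the squared transform of the
    unit box. *)
Require Import Defs.
From HB Require Import structures.
From mathcomp Require Import all_boot all_order all_algebra.
From mathcomp Require Import complex.
From mathcomp Require Import all_classical all_reals all_analysis.
From mathcomp Require Import measurable_realfun lebesgue_integral_fubini.
From mathcomp Require Import ring lra.
Import Order.TTheory GRing.Theory Num.Theory.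
Import numFieldNormedType.Exports.
Set Implicit Arguments.
Unset Strict Implicit.
Unset Printing Implicit Defensive.
Local Open Scope classical_set_scope.
Local Open Scope ring_scope.
Local Open Scope complex_scope.

(** * Measure-preserving maps and square-integrable functions *)

(** Plancherel's theorem is obtained by positivity. Averaging over large cubes gives one inequality;
    on boxes it is an equality, by one-dimensional scaling; and the functions with equality form a
    linear space closed under dominated limits. Equal signs matter because adding the two cone
    conditions then eliminates [tau] and controls the sum of two distances, with ellipsoids as level
    sets; opposite signs would control only a difference, with hyperboloids. The obstacle is the
    integral of [1 / y]. At fixed [T], [r1] is affine in [x] with slope [b = d / T], [d] being the
    distance of the foci along the first axis, and the natural primitive carries the factor
    [(1 - b ^ 2) ^ (- 1 / 2)], unbounded as the ellipse degenerates. When [b] is near 1, the angular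
    condition instead makes [y] increase in [x], fast enough for comparison with an arctangent of
    [y]. A multiplier output must also be exhibited. The two cone pieces are bounded, so the symbol
    is in L^1 as well as in L^2, and there the inversion integral can be checked through Parseval
    alone. *)

Definition mpres d1 d2 (T1 : measurableType d1) (T2 : measurableType d2)
    (R : realType) (m1 : set T1 -> \bar R) (m2 : set T2 -> \bar R)
    (phi : T1 -> T2) :=
  measurable_fun setT phi /\
  forall A, measurable A -> m1 (phi @^-1` A) = m2 A.

Section mpres.
Context d1 d2 (T1 : measurableType d1) (T2 : measurableType d2) (R : realType).
Variables (m1 : {measure set T1 -> \bar R}) (m2 : {measure set T2 -> \bar R}).
Variable phi : T1 -> T2.
Hypothesis phiP : mpres m1 m2 phi.

Lemma ge0_integral_mpres (f : T2 -> \bar R) :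
  measurable_fun setT f -> (forall x, (0 <= f x)%E) ->
  (\int[m1]_x f (phi x) = \int[m2]_x f x)%E.
Proof.
move=> mf f0; have [mphi phiE] := phiP.
rewrite -[in LHS](setTI setT) -(preimage_setT phi) setTI.
rewrite -(@ge0_integral_pushforward _ _ _ _ _ _ mphi m1 setT f)//; last first.
by apply: eq_measure_integral => A mA _; exact: phiE.
Qed.

(** Positive and negative parts are transported separately, so the two sides are the same difference
    even when an integral diverges. *)
Lemma integral_mpres (f : T2 -> \bar R) : measurable_fun setT f ->
  (\int[m1]_x f (phi x) = \int[m2]_x f x)%E.
Proof.
move=> mf; rewrite integralE [RHS]integralE; congr (_ - _)%E.
  rewrite -(ge0_integral_mpres (f := f^\+%E)); last 2 first.
  - exact: measurable_funepos.
  - by move=> x; rewrite funepos_ge0.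
  by apply: eq_integral => x _; rewrite !funeposE.
rewrite -(ge0_integral_mpres (f := f^\-%E)); last 2 first.
- exact: measurable_funeneg.
- by move=> x; rewrite funeneg_ge0.
by apply: eq_integral => x _; rewrite !funenegE.
Qed.

Lemma Rintegral_mpres (f : T2 -> R) : measurable_fun setT f ->
  \int[m1]_x f (phi x) = \int[m2]_x f x.
Proof.
move=> mf; congr fine; rewrite (integral_mpres (f := EFin \o f))//.
exact/measurable_EFinP.
Qed.

Lemma integrable_mpres (f : T2 -> \bar R) :
  m2.-integrable setT f -> m1.-integrable setT (f \o phi).
Proof.
move=> /integrableP[mf fi]; have [mphi _] := phiP; apply/integrableP; split.
  exact: measurableT_comp.
rewrite (ge0_integral_mpres (f := fun x => `|f x|%E))//.
exact: measurableT_comp.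
Qed.

End mpres.

Section mpres_prod.
Context d1 d2 (T1 : measurableType d1) (T2 : measurableType d2) (R : realType).
Variables (m1 : {sigma_finite_measure set T1 -> \bar R})
  (m2 : {sigma_finite_measure set T2 -> \bar R}).

(** Cavalieri's principle: the sections of the preimage are preimages of sections. Translations,
    reflections and the shears behind rotations are all built from this. *)
Lemma mpres_skew_snd (S : T1 -> T2 -> T2) :
  measurable_fun setT (fun p : T1 * T2 => S p.1 p.2) ->
  (forall x, mpres m2 m2 (S x)) ->
  mpres (m1 \x m2)%E (m1 \x m2)%E (fun p => (p.1, S p.1 p.2)).
Proof.
move=> mS Sm; split; first by apply/measurable_fun_pair => //; exact: measurable_fst.
move=> A mA; rewrite /= /product_measure1; apply: eq_integral => x _ /=.
have [mSx SxE] := Sm x.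
rewrite -(SxE (xsection A x)); last exact: measurable_xsection.
by congr (m2 _); apply/seteqP; split=> y; rewrite /xsection/= !inE.
Qed.

(** The product measure integrates over the first factor; uniqueness identifies it with the one
    integrating over the second, whose sections are those moved by [S]. *)
Lemma mpres_skew_fst (S : T2 -> T1 -> T1) :
  measurable_fun setT (fun p : T1 * T2 => S p.2 p.1) ->
  (forall y, mpres m1 m1 (S y)) ->
  mpres (m1 \x m2)%E (m1 \x m2)%E (fun p => (S p.2 p.1, p.2)).
Proof.
move=> mS Sm.
have mP : measurable_fun setT (fun p : T1 * T2 => (S p.2 p.1, p.2)).
  by apply/measurable_fun_pair => //; exact: measurable_snd.
have E (B : set (T1 * T2)) : measurable B -> (m1 \x m2)%E B = (m1 \x^ m2)%E B.
  move=> mB; apply: product_measure_unique => // C D mC mD.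
  exact: product_measure2E.
split=> // A mA; rewrite !E//; last by rewrite -[X in measurable X]setTI; exact: mP.
rewrite /= /product_measure2; apply: eq_integral => y _ /=.
have [mSy SyE] := Sm y.
rewrite -(SyE (ysection A y)); last exact: measurable_ysection.
by congr (m1 _); apply/seteqP; split=> x; rewrite /ysection/= !inE.
Qed.

End mpres_prod.

Lemma mpres_comp d1 d2 d3 (T1 : measurableType d1) (T2 : measurableType d2)
    (T3 : measurableType d3) (R : realType) (m1 : set T1 -> \bar R)
    (m2 : set T2 -> \bar R) (m3 : set T3 -> \bar R) f g :
  mpres m1 m2 f -> mpres m2 m3 g -> mpres m1 m3 (g \o f).
Proof.
move=> [mf fE] [mg gE]; split; first exact: measurableT_comp.
move=> A mA; rewrite comp_preimage fE ?gE//.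
by rewrite -[X in measurable X]setTI; exact: mg.
Qed.

Lemma mpres_prod d1 d2 (T1 : measurableType d1) (T2 : measurableType d2)
    (R : realType) (m1 : {sigma_finite_measure set T1 -> \bar R})
    (m2 : {sigma_finite_measure set T2 -> \bar R}) f g :
  mpres m1 m1 f -> mpres m2 m2 g ->
  mpres (m1 \x m2)%E (m1 \x m2)%E (fun p => (f p.1, g p.2)).
Proof.
move=> fm gm; apply: (@mpres_comp _ _ _ _ _ _ _ _ _ _
    (fun p => (f p.1, p.2)) (fun p => (p.1, g p.2))).
  apply: (@mpres_skew_fst _ _ _ _ _ _ _ (fun _ => f)) => //.
  exact: measurableT_comp fm.1 measurable_fst.
apply: (@mpres_skew_snd _ _ _ _ _ _ _ (fun _ => g)) => //.
exact: measurableT_comp gm.1 measurable_snd.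
Qed.

Section lebesgue_invariance.
Context (R : realType).
Local Notation lam := (@lebesgue_measure R).

Lemma mpres_lebesgueN : mpres lam lam (fun x : measurableTypeR R => - x).
Proof.
split; first exact: measurable_funN.
by move=> A mA; exact (@lebesgue_measureN R A mA).
Qed.

(** The pushforward under a translation agrees with Lebesgue measure on half-open intervals, which
    determine it. *)
Lemma mpres_lebesgueD (c : R) :
  mpres lam lam (fun x : measurableTypeR R => (x + c : measurableTypeR R)).
Proof.
have mD : measurable_fun setT (fun x : measurableTypeR R => (x + c : measurableTypeR R)).
  exact: measurable_funD.
split=> // A mA; apply/esym.
pose mD' := isMeasurableFun.Build _ _ _ _ _ mD.
pose f : {mfun measurableTypeR R >-> measurableTypeR R} := HB.pack (fun x : measurableTypeR R => (x + c : measurableTypeR R)) mD'.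
apply: (@lebesgue_measure_unique R (pushforward lam f)) => // _ [[a b]] _ <-; rewrite /=.
have fE : (fun x : R => x + c) @^-1` `]a, b] = `]a - c, b - c]%classic.
  by apply/seteqP; split=> x; rewrite /= !in_itv/= ltrBlDr lerBrDr.
rewrite [RHS](_ : _ = lam `]a - c, b - c]%classic); last by rewrite -fE.
rewrite !lebesgue_measure_itv/= !lte_fin ltrD2r.
by case: ifP => // _; rewrite -!EFinB; congr EFin; lra.
Qed.

End lebesgue_invariance.

Section spacetime_invariance.
Context (R : realType).
Local Notation X := (spacetime R).

Lemma mpres_mu4N : mpres (@mu4 R) (@mu4 R) (fun x : X => - x).
Proof.
have := @mpres_lebesgueN R.
move=> h; apply: (mpres_prod h); apply: mpres_prod; last exact: h.
by apply: mpres_prod; exact: h.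
Qed.

Lemma mpres_mu4D (c : X) : mpres (@mu4 R) (@mu4 R) (fun x : X => x + c).
Proof.
have h := @mpres_lebesgueD R.
apply: (mpres_prod (g := fun q : vec3 R => (q + c.2 : vec3 R)) (h c.1)).
have h2 : mpres (@mu2 R) (@mu2 R)
    (fun q => (q + c.2.1)%R : (measurableTypeR R * measurableTypeR R)%type).
  exact: (mpres_prod (h c.2.1.1) (h c.2.1.2)).
exact: (mpres_prod h2 (h c.2.2)).
Qed.

Lemma mpres_mu4B (c : X) : mpres (@mu4 R) (@mu4 R) (fun x : X => x - c).
Proof. exact: mpres_mu4D. Qed.

Lemma mpres_mu4rB (c : X) : mpres (@mu4 R) (@mu4 R) (fun x : X => c - x).
Proof.
have := mpres_comp mpres_mu4N (mpres_mu4D c).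
by under eq_fun do rewrite /= addrC.
Qed.

End spacetime_invariance.

(** * Square-integrable real functions *)

Section L2.
Context d (T : measurableType d) (R : realType).
Variable mu : {measure set T -> \bar R}.
Implicit Types f g h : T -> R.

Definition L1 f := mu.-integrable setT (EFin \o f).

(** Phrased by integrability of the square, so that the Hilbert space calculus takes place in [R];
    the link with [Lfun] and [Lnorm] is made once, by [Lfun2_L2], [L2_Lfun2] and [Lnorm2_sqr]. *)
Definition L2 f := measurable_fun setT f /\ L1 (fun x => f x ^+ 2).

Definition ip f g := \int[mu]_x (f x * g x).

Lemma L1_measurable f : L1 f -> measurable_fun setT f.
Proof. by move=> /integrableP[/measurable_EFinP]. Qed.

Lemma L1_EFin f : L1 f -> (\int[mu]_x (f x)%:E)%E = (\int[mu]_x f x)%:E.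
Proof. by move=> /(integrable_fin_num measurableT) fi; rewrite /Rintegral fineK. Qed.

Lemma L1_le f g : measurable_fun setT f -> (forall x, `|f x| <= `|g x|) ->
  L1 g -> L1 f.
Proof.
move=> mf fg; apply: le_integrable => //; first exact/measurable_EFinP.
by move=> x _; rewrite lee_fin.
Qed.

Lemma L1D f g : L1 f -> L1 g -> L1 (fun x => f x + g x).
Proof. by move=> fi gi; exact: (integrableD measurableT fi gi). Qed.

Lemma L1Z k f : L1 f -> L1 (fun x => k * f x).
Proof. by move=> fi; exact: (integrableZl measurableT k fi). Qed.

Lemma L1N f : L1 f -> L1 (fun x => - f x).
Proof. by move=> /(L1Z (-1)); under eq_fun do rewrite mulN1r. Qed.

Lemma L1B f g : L1 f -> L1 g -> L1 (fun x => f x - g x).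
Proof. by move=> fi gi; exact: L1D fi (L1N gi). Qed.

Lemma L1_norm f : L1 f -> L1 (fun x => `|f x|).
Proof.
move=> fi; apply: L1_le (fi); last by move=> x; rewrite normr_id.
exact: measurableT_comp (L1_measurable fi).
Qed.

Lemma Rint_D f g : L1 f -> L1 g ->
  \int[mu]_x (f x + g x) = \int[mu]_x f x + \int[mu]_x g x.
Proof. by move=> *; exact: RintegralD. Qed.

Lemma Rint_Z k f : L1 f -> \int[mu]_x (k * f x) = k * \int[mu]_x f x.
Proof. by move=> *; exact: RintegralZl. Qed.

Lemma Rint_N f : L1 f -> \int[mu]_x (- f x) = - \int[mu]_x f x.
Proof. by move=> fi; under eq_Rintegral do rewrite -mulN1r; rewrite Rint_Z// mulN1r. Qed.

Lemma Rint_B f g : L1 f -> L1 g ->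
  \int[mu]_x (f x - g x) = \int[mu]_x f x - \int[mu]_x g x.
Proof. by move=> *; exact: RintegralB. Qed.

Lemma L2_measurable f : L2 f -> measurable_fun setT f.
Proof. by case. Qed.

Lemma L2_L1 f g : L2 f -> L2 g -> L1 (fun x => f x * g x).
Proof.
move=> [mf fi] [mg gi]; apply: L1_le (L1D fi gi); first exact: measurable_funM.
move=> x; rewrite [leRHS]ger0_norm ?addr_ge0 ?sqr_ge0// normrM.
rewrite -(real_normK (num_real (f x))) -(real_normK (num_real (g x))).
by have := normr_ge0 (f x); have := normr_ge0 (g x); nra.
Qed.

Lemma L2Z k f : L2 f -> L2 (fun x => k * f x).
Proof.
move=> [mf fi]; split; first exact: measurable_funM.
by under eq_fun do rewrite exprMn; exact: L1Z.
Qed.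

Lemma L2D f g : L2 f -> L2 g -> L2 (fun x => f x + g x).
Proof.
move=> fi gi; split; first exact: measurable_funD fi.1 gi.1.
have := L1D (L1D fi.2 gi.2) (L1Z 2 (L2_L1 fi gi)).
by apply: L1_le => [|x]; [apply: measurable_funX; exact: measurable_funD fi.1 gi.1|
  rewrite (_ : f x ^+ 2 + g x ^+ 2 + 2 * (f x * g x) = (f x + g x) ^+ 2)//; ring].
Qed.

Lemma L2N f : L2 f -> L2 (fun x => - f x).
Proof. by move=> /(L2Z (-1)); under eq_fun do rewrite mulN1r. Qed.

Lemma L2B f g : L2 f -> L2 g -> L2 (fun x => f x - g x).
Proof. by move=> fi gi; exact: L2D fi (L2N gi). Qed.

Lemma ipC f g : ip f g = ip g f.
Proof. by apply: eq_Rintegral => x _; rewrite mulrC. Qed.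

Lemma ip_ge0 f : 0 <= ip f f.
Proof. by apply: Rintegral_ge0 => x _; rewrite -expr2 sqr_ge0. Qed.

Lemma ipDl f g h : L2 f -> L2 g -> L2 h ->
  ip (fun x => f x + g x) h = ip f h + ip g h.
Proof.
move=> fi gi hi; rewrite -Rint_D; [|exact: L2_L1..].
by apply: eq_Rintegral => x _; rewrite mulrDl.
Qed.

Lemma ipZl k f h : L2 f -> L2 h -> ip (fun x => k * f x) h = k * ip f h.
Proof.
move=> fi hi; rewrite -Rint_Z; last exact: L2_L1.
by apply: eq_Rintegral => x _; rewrite mulrA.
Qed.

Lemma ipNl f h : L2 f -> L2 h -> ip (fun x => - f x) h = - ip f h.
Proof. by move=> fi hi; under eq_fun do rewrite -mulN1r; rewrite ipZl// mulN1r. Qed.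

Lemma ipBl f g h : L2 f -> L2 g -> L2 h ->
  ip (fun x => f x - g x) h = ip f h - ip g h.
Proof. by move=> fi gi hi; rewrite ipDl ?ipNl//; exact: L2N. Qed.

Lemma ipDD f g : L2 f -> L2 g ->
  ip (fun x => f x + g x) (fun x => f x + g x) = ip f f + 2 * ip f g + ip g g.
Proof.
move=> fi gi; have fgi := L2D fi gi.
by rewrite ipDl// !(ipC _ (fun x => f x + g x)) !ipDl// (ipC g f); ring.
Qed.

Lemma ipZZ k f : L2 f -> ip (fun x => k * f x) (fun x => k * f x) = k ^+ 2 * ip f f.
Proof.
move=> fi; have kfi := L2Z k fi.
by rewrite ipZl// ipC ipZl//; ring.
Qed.

Lemma ipBB f g : L2 f -> L2 g ->
  ip (fun x => f x - g x) (fun x => f x - g x) = ip f f - 2 * ip f g + ip g g.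
Proof.
move=> fi gi; have fgi := L2B fi gi.
by rewrite ipBl// !(ipC _ (fun x => f x - g x)) !ipBl// (ipC g f); ring.
Qed.

(** The discriminant of a nonnegative quadratic in [t]; stated abstractly because it serves inner
    products, finite sums and the Plancherel defect alike. *)
Lemma quadratic_ge0_sqr (A B C : R) : (forall t, 0 <= A + 2 * t * B + t ^+ 2 * C) ->
  0 <= C -> B ^+ 2 <= A * C.
Proof.
move=> h C0; have [C00|Cn0] := eqVneq C 0.
  rewrite C00 mulr0; have [-> |Bn0] := eqVneq B 0; first by rewrite expr0n.
  (* With [C = 0] the quadratic is affine in [t], and at this [t] it equals [-1]. *)
  have := h (- (A + 1) / (2 * B)).
  rewrite C00 mulr0 addr0 (_ : 2 * _ * B = - (A + 1)); last by field.
  by move=> ?; exfalso; lra.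
have Cp : 0 < C by rewrite lt_def Cn0.
have := h (- B / C).
have -> : A + 2 * (- B / C) * B + (- B / C) ^+ 2 * C = (A * C - B ^+ 2) / C by field.
by rewrite pmulr_lge0 ?invr_gt0// subr_ge0.
Qed.

Lemma ip_CS f g : L2 f -> L2 g -> ip f g ^+ 2 <= ip f f * ip g g.
Proof.
move=> fi gi; apply: quadratic_ge0_sqr; last exact: ip_ge0.
move=> t; have := ip_ge0 (fun x => f x + t * g x).
rewrite ipDD//; last exact: L2Z.
by rewrite (ipC f) ipZl// ipZZ// (ipC g) mulrA.
Qed.

(** The difference of inner products splits into three terms, each with a factor tending to 0;
    Cauchy-Schwarz bounds them by the three terms of [K]. *)
Lemma cvg_ip (f g : nat -> T -> R) f0 g0 :
  (forall n, L2 (f n)) -> (forall n, L2 (g n)) -> L2 f0 -> L2 g0 ->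
  ip (fun x => f n x - f0 x) (fun x => f n x - f0 x) @[n --> \oo] --> 0 ->
  ip (fun x => g n x - g0 x) (fun x => g n x - g0 x) @[n --> \oo] --> 0 ->
  ip (f n) (g n) @[n --> \oo] --> ip f0 g0.
Proof.
move=> fi gi f0i g0i fc gc.
pose F n := ip (fun x => f n x - f0 x) (fun x => f n x - f0 x).
pose G n := ip (fun x => g n x - g0 x) (fun x => g n x - g0 x).
have sqrt0 (u : nat -> R) : (forall n, 0 <= u n) -> u n @[n --> \oo] --> 0 ->
    Num.sqrt (u n) @[n --> \oo] --> 0.
  move=> u0 uc; rewrite -[X in _ --> X](@sqrtr0 R).
  exact: (cvg_comp _ _ uc (@sqrt_continuous R 0)).
have Fs := sqrt0 F (fun n => ip_ge0 _) fc.
have Gs := sqrt0 G (fun n => ip_ge0 _) gc.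
have bnd a b : L2 a -> L2 b -> `|ip a b| <= Num.sqrt (ip a a) * Num.sqrt (ip b b).
  move=> ai bi; rewrite -sqrtr_sqr -sqrtrM ?ip_ge0// ler_sqrt ?ip_CS//.
  by rewrite mulr_ge0 ?ip_ge0.
apply/cvgrPdist_le => e e0.
have K : Num.sqrt (F n) * Num.sqrt (G n) + Num.sqrt (F n) * Num.sqrt (ip g0 g0) +
    Num.sqrt (ip f0 f0) * Num.sqrt (G n) @[n --> \oo] --> 0.
  rewrite -[X in _ --> X](_ : 0 * 0 + 0 * Num.sqrt (ip g0 g0) +
      Num.sqrt (ip f0 f0) * 0 = 0); last by rewrite !mul0r mulr0 !addr0.
  by apply: cvgD; [apply: cvgD|]; apply: cvgM => //; exact: cvg_cst.
have /cvgrPdist_le/(_ e e0) := K; apply: filterS => n.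
rewrite sub0r normrN => h; rewrite distrC; apply: le_trans h.
rewrite [leRHS]ger0_norm ?addr_ge0 ?mulr_ge0 ?sqrtr_ge0//.
have fd := L2B (fi n) f0i; have gd := L2B (gi n) g0i.
have -> : ip (f n) (g n) - ip f0 g0 =
    ip (fun x => f n x - f0 x) (fun x => g n x - g0 x) +
    ip (fun x => f n x - f0 x) g0 + ip f0 (fun x => g n x - g0 x).
  rewrite ipBl// (ipC (f n) (fun x => g n x - g0 x)) (ipC f0 (fun x => g n x - g0 x)).
  by rewrite !ipBl// (ipC _ (f n)) (ipC _ f0) (ipC _ (f n)) (ipC g0 f0); ring.
apply: (le_trans (ler_normD _ _)); apply: lerD; last exact: bnd.
by apply: (le_trans (ler_normD _ _)); apply: lerD; exact: bnd.
Qed.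

End L2.

(** * Fubini for real-valued integrals *)

Section product_integrals.
Context d1 d2 (T1 : measurableType d1) (T2 : measurableType d2) (R : realType).
Variables (m1 : {sigma_finite_measure set T1 -> \bar R})
  (m2 : {sigma_finite_measure set T2 -> \bar R}).

(** The integral is a difference of two Tonelli integrals followed by the measurable map [fine],
    which sends infinite values to 0; so [g] may be any measurable function. *)
Lemma measurable_Rintegral_snd (g : T1 -> T2 -> R) :
  measurable_fun setT (fun p : T1 * T2 => g p.1 p.2) ->
  measurable_fun setT (fun x => \int[m2]_y g x y).
Proof.
move=> mg; apply: measurableT_comp; first exact: fine_measurable.
under eq_fun do rewrite integralE.
pose G (p : T1 * T2) : \bar R := (g p.1 p.2)%:E.
have mG : measurable_fun setT G by exact/measurable_EFinP.
apply: emeasurable_funB.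
- have := measurable_fun_fubini_tonelli_F (m2 := m2) G^\+%E
    (measurable_funepos mG) (fun p => funepos_ge0 G p).
  by apply: eq_measurable_fun => x _; apply: eq_integral => y _; rewrite !funeposE.
- have := measurable_fun_fubini_tonelli_F (m2 := m2) G^\-%E
    (measurable_funeneg mG) (fun p => funeneg_ge0 G p).
  by apply: eq_measurable_fun => x _; apply: eq_integral => y _; rewrite !funenegE.
Qed.

Section swap.
Variable F : T1 -> T2 -> R.
Hypothesis iF : L1 (m1 \x m2)%E (fun p => F p.1 p.2).
Hypothesis iF1 : forall x, L1 m2 (F x).
Hypothesis iF2 : forall y, L1 m1 (F ^~ y).

(** Integrability of every section makes the real inner integral agree with the extended one at
    every point, so no null set has to be tracked. *)
Lemma L1_inner1 : L1 m1 (fun x => \int[m2]_y F x y).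
Proof.
have := integrable_fubini_F iF.
by apply: eq_integrable => // x _; exact (L1_EFin (iF1 x)).
Qed.

Lemma L1_inner2 : L1 m2 (fun y => \int[m1]_x F x y).
Proof.
have : m2.-integrable setT (fubini_G m1 (EFin \o (fun p => F p.1 p.2))).
  have sw : L1 (m2 \x m1)%E (fun p => F p.2 p.1).
    apply/integrable12ltyP.
      apply/measurable_EFinP.
      exact: (measurableT_comp (L1_measurable iF) (@measurable_swap _ _ T2 T1)).
    by have /(integrable21ltyP _ _ (measurable_int _ iF)) := iF.
  exact: (integrable_fubini_F sw).
by apply: eq_integrable => // y _; exact (L1_EFin (iF2 y)).
Qed.

Lemma Rint_prod1 : \int[(m1 \x m2)%E]_p F p.1 p.2 = \int[m1]_x \int[m2]_y F x y.
Proof.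
congr fine; rewrite -integral12_prod_meas1//.
by apply: eq_integral => x _; exact (L1_EFin (iF1 x)).
Qed.

Lemma Rint_prod2 : \int[(m1 \x m2)%E]_p F p.1 p.2 = \int[m2]_y \int[m1]_x F x y.
Proof.
congr fine; rewrite -integral21_prod_meas1//.
by apply: eq_integral => y _; exact (L1_EFin (iF2 y)).
Qed.

Lemma Rint_swap :
  \int[m1]_x \int[m2]_y F x y = \int[m2]_y \int[m1]_x F x y.
Proof. by rewrite -Rint_prod1 Rint_prod2. Qed.

End swap.

Lemma L1_tensor (f : T1 -> R) (g : T2 -> R) : L1 m1 f -> L1 m2 g ->
  L1 (m1 \x m2)%E (fun p => f p.1 * g p.2).
Proof.
move=> fi gi; have mf := L1_measurable fi; have mg := L1_measurable gi.
apply/integrable12ltyP.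
  apply/measurable_EFinP; apply: measurable_funM.
    exact: measurableT_comp mf measurable_fst.
  exact: measurableT_comp mg measurable_snd.
under eq_integral => x _.
  under eq_integral do rewrite /= normrM EFinM.
  rewrite ge0_integralZl//; last by apply/measurable_EFinP; exact: measurableT_comp.
  over.
rewrite ge0_integralZr//; last 2 first.
- by apply/measurable_EFinP; exact: measurableT_comp.
- by apply: integral_ge0 => y _; rewrite lee_fin.
have /integrableP[_ fo] := fi; have /integrableP[_ go] := gi.
by apply: lte_mul_pinfty => //; [exact: integral_ge0|
  rewrite ge0_fin_numE//; exact: integral_ge0].
Qed.

Lemma Rint_tensor (f : T1 -> R) (g : T2 -> R) : L1 m1 f -> L1 m2 g ->
  \int[(m1 \x m2)%E]_p (f p.1 * g p.2) = (\int[m1]_x f x) * (\int[m2]_y g y).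
Proof.
move=> fi gi; rewrite (Rint_prod1 (F := fun x y => f x * g y)).
- under eq_Rintegral do rewrite Rint_Z//.
  by rewrite RintegralZr.
- exact: L1_tensor.
- by move=> x; exact: L1Z.
Qed.

End product_integrals.

(** * Oscillatory integrals in real form *)

Section trig_integrals.
Context (R : realType).

Lemma L1_cos d (T : measurableType d) (m : {measure set T -> \bar R})
    (f ph : T -> R) : L1 m f -> measurable_fun setT ph ->
  L1 m (fun x => f x * cos (ph x)).
Proof.
move=> fi mph; apply: L1_le (fi).
  apply: measurable_funM; first exact: L1_measurable fi.
  by apply: measurableT_comp => //; apply: continuous_measurable_fun; exact: continuous_cos.
by move=> x; rewrite normrM ler_piMr// cos_max.
Qed.

Lemma L1_sin d (T : measurableType d) (m : {measure set T -> \bar R})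
    (f ph : T -> R) : L1 m f -> measurable_fun setT ph ->
  L1 m (fun x => f x * sin (ph x)).
Proof.
move=> fi mph; apply: L1_le (fi).
  apply: measurable_funM; first exact: L1_measurable fi.
  by apply: measurableT_comp => //; apply: continuous_measurable_fun; exact: continuous_sin.
by move=> x; rewrite normrM ler_piMr// sin_max.
Qed.

Definition cosI d (T : measurableType d) (m : set T -> \bar R) (f ph : T -> R) : R :=
  fine (\int[m]_x (f x * cos (ph x))%:E)%E.

Definition sinI d (T : measurableType d) (m : set T -> \bar R) (f ph : T -> R) : R :=
  fine (\int[m]_x (f x * sin (ph x))%:E)%E.

(** The squared modulus of the integral of [f e^(i ph)], whose real and imaginary parts are [cosI]
    and [sinI]. For real [f] the sign of the phase does not affect it. *)
Definition powI d (T : measurableType d) (m : set T -> \bar R) (f ph : T -> R) : R :=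
  cosI m f ph ^+ 2 + sinI m f ph ^+ 2.

Lemma powI_ge0 d (T : measurableType d) (m : set T -> \bar R) f ph :
  0 <= @powI d T m f ph.
Proof. by rewrite addr_ge0 ?sqr_ge0. Qed.

(** Multiplicativity of the modulus of complex numbers, expressed through the addition formulas. *)
Lemma powI_tensor d1 d2 (T1 : measurableType d1) (T2 : measurableType d2)
    (m1 : {sigma_finite_measure set T1 -> \bar R})
    (m2 : {sigma_finite_measure set T2 -> \bar R}) (f : T1 -> R) (g : T2 -> R)
    (ph : T1 -> R) (ps : T2 -> R) :
  L1 m1 f -> L1 m2 g -> measurable_fun setT ph -> measurable_fun setT ps ->
  powI (m1 \x m2)%E (fun p => f p.1 * g p.2) (fun p => ph p.1 + ps p.2) =
  powI m1 f ph * powI m2 g ps.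
Proof.
move=> fi gi mph mps.
have fc := L1_cos fi mph; have fs := L1_sin fi mph.
have gc := L1_cos gi mps; have gs := L1_sin gi mps.
have Ec : cosI (m1 \x m2)%E (fun p => f p.1 * g p.2) (fun p => ph p.1 + ps p.2) =
    cosI m1 f ph * cosI m2 g ps - sinI m1 f ph * sinI m2 g ps.
  rewrite -[X in _ = X - _]Rint_tensor// -[X in _ = _ - X]Rint_tensor//.
  rewrite -Rint_B; [|exact: (L1_tensor fc gc)|exact: (L1_tensor fs gs)].
  by apply: eq_Rintegral => p _; rewrite cosD; ring.
have Es : sinI (m1 \x m2)%E (fun p => f p.1 * g p.2) (fun p => ph p.1 + ps p.2) =
    sinI m1 f ph * cosI m2 g ps + cosI m1 f ph * sinI m2 g ps.
  rewrite -[X in _ = X + _]Rint_tensor// -[X in _ = _ + X]Rint_tensor//.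
  rewrite -Rint_D; [|exact: (L1_tensor fs gc)|exact: (L1_tensor fc gs)].
  by apply: eq_Rintegral => p _; rewrite sinD; ring.
by rewrite /powI Ec Es; ring.
Qed.

End trig_integrals.

(** * The Fourier transform and Plancherel's theorem *)

Section lebesgue_1d.
Context (R : realType).
Local Notation lam := (@lebesgue_measure R).
Implicit Types a b x l xi : R.

Lemma integral_indicM d (T : measurableType d) (m : {measure set T -> \bar R})
    (A : set T) (f : T -> R) :
  (\int[m]_x (\1_A x * f x)%:E = \int[m]_(x in A) (f x)%:E)%E.
Proof.
rewrite [RHS]integral_mkcond; apply: eq_integral => x _.
by rewrite patchE indicE; case: ifPn => _; rewrite ?mul1r ?mul0r.
Qed.

Lemma FTC_is_derive (f F : R -> R) a b : a <= b ->
  (forall x, a <= x <= b -> is_derive x 1 F (f x)) ->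
  (forall x, a <= x <= b -> {for x, continuous f}) ->
  (\int[lam]_(x in `[a, b]) (f x)%:E = (F b - F a)%:E)%E.
Proof.
rewrite le_eqVlt => /predU1P[<-|ab] dF cf.
  by rewrite set_itv1 integral_set1 subrr.
have cF x : a <= x <= b -> {for x, continuous F}.
  move=> xab; have := dF _ xab => ?.
  by apply/differentiable_continuous/derivable1_diffP.
rewrite (@continuous_FTC2 _ f F) ?EFinB//.
- apply: continuous_in_subspaceT => x; rewrite inE/= in_itv/=; exact: cf.
- split.
  + by move=> x; rewrite in_itv/= => /andP[ax xb]; have := dF x; rewrite !ltW// => /(_ isT) [].
  + by apply: cvg_at_right_filter; apply: cF; rewrite lexx ltW.
  + by apply: cvg_at_left_filter; apply: cF; rewrite lexx ltW.
- move=> x; rewrite in_itv/= => /andP[ax xb]; rewrite derive1E.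
  by have := dF x; rewrite !ltW// => /(_ isT) [].
Qed.

Lemma ge0_integral_scale l (f : R -> \bar R) : 0 < l ->
  measurable_fun setT f -> (forall x, (0 <= f x)%E) ->
  (\int[lam]_x f (l * x)%R = (l^-1)%:E * \int[lam]_x f x)%E.
Proof.
move=> l0 mf f0.
have mM : measurable_fun setT (fun x : measurableTypeR R => (l * x : measurableTypeR R)).
  exact: measurable_funM.
pose mM' := isMeasurableFun.Build _ _ _ _ _ mM.
pose g : {mfun measurableTypeR R >-> measurableTypeR R} :=
  HB.pack (fun x : measurableTypeR R => (l * x : measurableTypeR R)) mM'.
have E A : measurable A -> lam A = mscale (NngNum (ltW l0)) (pushforward lam g) A.
  apply: lebesgue_measure_unique => // _ [[a b]] _ <-.
  rewrite /mscale /pushforward /=.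
  have fE : (fun x : R => l * x) @^-1` `]a, b] = `]l^-1 * a, l^-1 * b]%classic.
    apply/seteqP; split=> x; rewrite /= !in_itv/= => /andP[ax xb]; apply/andP; split.
    - by rewrite ltr_pdivrMl.
    - by rewrite ler_pdivlMl.
    - by rewrite -ltr_pdivrMl.
    - by rewrite -ler_pdivlMl.
  transitivity (l%:E * lam `](l^-1 * a)%R, (l^-1 * b)%R]%classic)%E; last by rewrite -fE.
  rewrite !lebesgue_measure_itv/= !lte_fin ltr_pM2l ?invr_gt0//.
  case: ifPn => _; last by rewrite mule0.
  rewrite -!EFinB -EFinM; congr EFin.
  by field; rewrite gt_eqF.
rewrite [in RHS](eq_measure_integral (mscale (NngNum (ltW l0)) (pushforward lam g))); last first.
  by move=> A mA _; exact: E.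
rewrite ge0_integral_mscale//= ge0_integral_pushforward//=.
rewrite preimage_setT muleA -EFinM mulVf ?mul1e//.
by rewrite gt_eqF.
Qed.


Lemma cosI_itv a b xi : a <= b -> xi != 0 ->
  cosI lam (\1_(`[a, b] : set R)) (fun x => x * xi) = (sin (b * xi) - sin (a * xi)) / xi.
Proof.
move=> ab xi0; rewrite /cosI integral_indicM.
pose F (x : R) := xi^-1 * sin (x * xi).
have dF x : a <= x <= b -> is_derive x 1 F (cos (x * xi)).
  move=> _; apply: trigger_derive.
  by rewrite /GRing.scale/=; field.
rewrite (FTC_is_derive ab dF)/=; first by rewrite /F; field.
move=> x _; apply: continuous_comp; last exact: continuous_cos.
by apply: cvgM; [exact: cvg_id|exact: cvg_cst].
Qed.

Lemma sinI_itv a b xi : a <= b -> xi != 0 ->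
  sinI lam (\1_(`[a, b] : set R)) (fun x => x * xi) = (cos (a * xi) - cos (b * xi)) / xi.
Proof.
move=> ab xi0; rewrite /sinI integral_indicM.
pose F (x : R) := - xi^-1 * cos (x * xi).
have dF x : a <= x <= b -> is_derive x 1 F (sin (x * xi)).
  move=> _; apply: trigger_derive.
  by rewrite /GRing.scale/=; field.
rewrite (FTC_is_derive ab dF)/=; first by rewrite /F; field.
move=> x _; apply: continuous_comp; last exact: continuous_sin.
by apply: cvgM; [exact: cvg_id|exact: cvg_cst].
Qed.

Lemma powI_itv a b xi : a <= b -> xi != 0 ->
  powI lam (\1_(`[a, b] : set R)) (fun x => x * xi) =
  (2 - 2 * cos ((b - a) * xi)) / xi ^+ 2.
Proof.
move=> ab xi0; rewrite /powI cosI_itv// sinI_itv// (mulrBl xi b a) cosB.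
have := cos2Dsin2 (b * xi); have := cos2Dsin2 (a * xi).
move=> /(canRL (addrK _)) Ea /(canRL (addrK _)) Eb.
by rewrite !expr_div_n -mulrDl; congr (_ / _); rewrite !sqrrB; rewrite Ea Eb; ring.
Qed.

(** The squared sinc [(sin (x / 2) / (x / 2)) ^ 2]. The integral form gives the right value 1 at
    [x = 0], where the quotient of [sincsqE] breaks down. *)
Definition sincsq x : R := powI lam (\1_(`[0, 1] : set R)) (fun y => y * x).

Lemma sincsq_ge0 x : 0 <= sincsq x.
Proof. exact: powI_ge0. Qed.

Lemma sincsqE x : x != 0 -> sincsq x = (2 - 2 * cos x) / x ^+ 2.
Proof. by move=> x0; rewrite /sincsq powI_itv// subr0 mul1r. Qed.

Lemma measurable_powI_itv a b : measurable_fun setT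
  (fun xi => powI lam (\1_(`[a, b] : set R)) (fun y => y * xi)).
Proof.
have mi : measurable_fun setT (fun p : measurableTypeR R * measurableTypeR R =>
    (\1_(`[a, b] : set R) p.2 : R)).
  have mI : measurable_fun setT
      (\1_(`[a, b] : set (measurableTypeR R)) : measurableTypeR R -> R).
    exact: measurable_indic.
  exact: (measurableT_comp mI measurable_snd).
have mm : measurable_fun setT (fun p : measurableTypeR R * measurableTypeR R => p.2 * p.1).
  by apply: measurable_funM; [exact: measurable_snd|exact: measurable_fst].
apply: measurable_funD; apply: measurable_funX.
- apply: (@measurable_Rintegral_snd _ _ _ _ _ lam (fun x y => \1_(`[a, b] : set R) y * cos (y * x))).
  apply: measurable_funM => //.
  by apply: measurableT_comp => //; apply: continuous_measurable_fun; exact: continuous_cos.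
- apply: (@measurable_Rintegral_snd _ _ _ _ _ lam (fun x y => \1_(`[a, b] : set R) y * sin (y * x))).
  apply: measurable_funM => //.
  by apply: measurableT_comp => //; apply: continuous_measurable_fun; exact: continuous_sin.
Qed.

(** For [|x| <= 1] the crude bound 2 suffices; beyond, [sincsq x <= 4 / x ^ 2], and
    [1 + x ^ 2 <= 2 * x ^ 2] produces the 8. *)
Lemma sincsq_le x : sincsq x <= 8 / (1 + x ^+ 2).
Proof.
have i1 : L1 lam (\1_(`[0, 1] : set R)).
  exact: (integrable_indic_itv 0 1 true false).
have E1 : \int[lam]_y `|\1_(`[0, 1] : set R) y : R| = 1.
  under eq_Rintegral do rewrite ger0_norm//.
  transitivity (fine (lam (`[0, 1]%classic : set R))).
    by rewrite /Rintegral integral_indic// setIT.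
  by rewrite lebesgue_measure_itv/= lte_fin ltr01 sube0.
have le2 : sincsq x <= 2.
  have mx : measurable_fun setT (fun y : measurableTypeR R => y * x).
    exact: measurable_funM.
  have c1 : `|cosI lam (\1_(`[0, 1] : set R)) (fun y => y * x)| <= 1.
    rewrite -[leRHS]E1; apply: (le_trans (le_normr_Rintegral measurableT (L1_cos i1 mx))).
    apply: le_Rintegral => //.
    - exact: L1_norm (L1_cos i1 mx).
    - exact: L1_norm i1.
    - by move=> y _; rewrite normrM ler_piMr// cos_max.
  have s1 : `|sinI lam (\1_(`[0, 1] : set R)) (fun y => y * x)| <= 1.
    rewrite -[leRHS]E1; apply: (le_trans (le_normr_Rintegral measurableT (L1_sin i1 mx))).
    apply: le_Rintegral => //.
    - exact: L1_norm (L1_sin i1 mx).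
    - exact: L1_norm i1.
    - by move=> y _; rewrite normrM ler_piMr// sin_max.
  by rewrite /sincsq /powI (_ : 2 = 1 + 1 :> R)// lerD// -(real_normK (num_real _)) expr_le1.
rewrite ler_pdivlMr; last by rewrite ltr_wpDr ?sqr_ge0.
have [x1|x1] := leP (x ^+ 2) 1.
  by have := sincsq_ge0 x; have := sqr_ge0 x; nra.
have x0 : x != 0 by apply: contraTneq x1 => ->; rewrite expr0n/= ltr10.
rewrite sincsqE// mulrAC ler_pdivrMr; last by rewrite exprn_even_gt0.
by have := cos_geN1 x; have := cos_le1 x; nra.
Qed.

Lemma integrable_oneDsqrV : L1 lam (fun x => (1 + x ^+ 2)^-1).
Proof.
apply/integrableP; split.
  apply/measurable_EFinP; apply: continuous_measurable_fun; exact: continuous_oneDsqrV.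
under eq_integral do rewrite /= ger0_norm ?invr_ge0 ?addr_ge0 ?sqr_ge0//.
rewrite (@ge0_symfun_integralT _ (fun x : R => (1 + x ^+ 2)^-1)); last 3 first.
- by move=> x; rewrite invr_ge0 addr_ge0 ?sqr_ge0.
- exact: continuous_oneDsqrV.
- by move=> x; rewrite /= sqrrN.
rewrite -set_itvcy.
by have := integral0y_oneDsqr R; rewrite /oneDsqr => ->; rewrite -EFinM ltry.
Qed.

Lemma L1_sincsq : L1 lam sincsq.
Proof.
apply: L1_le (L1Z 8 integrable_oneDsqrV); first exact: measurable_powI_itv.
move=> x; rewrite !ger0_norm ?sincsq_ge0 ?sincsq_le//.
by rewrite divr_ge0 ?addr_ge0 ?sqr_ge0.
Qed.

Definition sincsq_mass : R := \int[lam]_x sincsq x.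

(** A zero integral would make [sincsq] vanish almost everywhere, but it is positive on []0, 1]],
    where [cos x < 1]. *)
Lemma sincsq_mass_gt0 : 0 < sincsq_mass.
Proof.
rewrite lt_def Rintegral_ge0 ?andbT; last by move=> x _; exact: sincsq_ge0.
apply/eqP => m0.
have : (\int[lam]_x `|(sincsq x)%:E|)%E = 0%E.
  under eq_integral do rewrite gee0_abs ?lee_fin ?sincsq_ge0//.
  by rewrite (L1_EFin L1_sincsq) -/sincsq_mass m0.
have ms : measurable_fun setT (fun x => (sincsq x)%:E).
  by apply/measurable_EFinP; exact: measurable_powI_itv.
move=> /(ae_eq_integral_abs lam measurableT ms) [N [mN N0 sN]].
have : (lam (`]0%R, 1%R]%classic : set R) <= lam N)%E.
  apply: le_measure; rewrite ?inE//= => x; rewrite /= in_itv/= => /andP[x0 x1].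
  apply: sN => /= /(_ I)/eqP; rewrite eqe sincsqE ?gt_eqF//.
  rewrite divr_gt0 ?exprn_gt0//.
  rewrite subr_gt0 -[X in _ < X]mulr1 ltr_pM2l//.
  rewrite -[ltRHS](@cos0 R) ltr_cos// in_itv/= ?lexx ?pi_ge0 ?(ltW x0)//=.
  by rewrite (le_trans x1)// (le_trans _ (pi_ge2 _))// ler1n.
by rewrite N0 lebesgue_measure_itv/= lte_fin ltr01 sube0 lee_fin leNgt ltr01.
Qed.

(** Translating an interval only changes a phase, so the integrand is
    [(b - a) ^ 2 * sincsq ((b - a) * xi)], and rescaling [xi] removes one factor [b - a]. The closed
    form fails only at [xi = 0], a null set. *)
Lemma integral_powI_itv a b : a <= b ->
  (\int[lam]_xi (powI lam (\1_(`[a, b] : set R)) (fun x => x * xi)%R)%:E =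
    (sincsq_mass * (b - a))%:E)%E.
Proof.
rewrite le_eqVlt => /predU1P[<-|ab].
  rewrite subrr mulr0; apply: integral0_eq => xi _.
  rewrite /powI /cosI /sinI !integral_indicM.
  by rewrite set_itv1 !integral_set1/= expr0n/= addr0.
have ba : 0 < b - a by rewrite subr_gt0.
transitivity (\int[lam]_xi (((b - a) ^+ 2)%:E * (sincsq ((b - a) * xi))%:E))%E.
  apply: ge0_ae_eq_integral => //.
  - by apply/measurable_EFinP; exact: measurable_powI_itv.
  - apply/measurable_EFinP; apply: measurable_funM => //.
    apply: (@measurableT_comp _ _ _ _ _ _ sincsq); first exact: measurable_powI_itv.
    exact: measurable_funM.
  - by move=> x _; rewrite lee_fin powI_ge0.
  - by move=> x _; rewrite lee_fin mulr_ge0 ?sqr_ge0 ?sincsq_ge0.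
  - exists [set 0]; split=> //; first exact: lebesgue_measure_set1.
    move=> x /= h; apply: contrapT => /eqP x0; apply: h => _.
    rewrite powI_itv ?ltW// sincsqE ?mulf_neq0 ?(gt_eqF ba)// -EFinM; congr EFin.
    by field; rewrite x0 gt_eqF.
rewrite ge0_integralZl//; last 3 first.
- apply/measurable_EFinP.
  apply: (@measurableT_comp _ _ _ _ _ _ sincsq); first exact: measurable_powI_itv.
  exact: measurable_funM.
- by move=> x _; rewrite lee_fin sincsq_ge0.
- by rewrite lee_fin sqr_ge0.
rewrite (ge0_integral_scale (f := fun x => (sincsq x)%:E) ba)//; last 2 first.
- by apply/measurable_EFinP; exact: measurable_powI_itv.
- by move=> x; rewrite lee_fin sincsq_ge0.
rewrite (L1_EFin L1_sincsq) -!EFinM; congr EFin.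
by rewrite /sincsq_mass; field; rewrite gt_eqF.
Qed.

End lebesgue_1d.

Lemma ge0_integralZ_EFin d (T : measurableType d) (R : realType)
    (m : {measure set T -> \bar R}) (k : R) (f : T -> R) :
  measurable_fun setT f -> (forall x, 0 <= f x) -> 0 <= k ->
  (\int[m]_x (k * f x)%:E = k%:E * \int[m]_x (f x)%:E)%E.
Proof.
move=> mf f0 k0; under eq_integral do rewrite EFinM.
rewrite ge0_integralZl//; first exact/measurable_EFinP.
by move=> x _; rewrite lee_fin.
Qed.

Lemma mulr_le_half_sqr (R : realType) (x y : R) : x * y <= 2^-1 * (x ^+ 2 + y ^+ 2).
Proof. by have := sqr_ge0 (x - y); rewrite sqrrB => ?; lra. Qed.

Lemma half_double (R : realType) (x : R) : 2^-1 * (x + x) = x.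
Proof. by lra. Qed.

Section mu44.
Context (R : realType).

Definition mu44 : set (spacetime R * spacetime R) -> \bar R :=
  (@mu4 R \x @mu4 R)%E.

HB.instance Definition _ := Measure.on mu44.
HB.instance Definition _ :=
  Measure_isSigmaFinite.Build _ _ _ mu44 (sigma_finite_product _ _).

End mu44.
Arguments mu44 {R}.

Section measurability.
Context (R : realType).
Local Notation X := (spacetime R).

Lemma measurable_cosR : measurable_fun setT (@cos R).
Proof. by apply: continuous_measurable_fun; exact: continuous_cos. Qed.

Lemma measurable_sinR : measurable_fun setT (@sin R).
Proof. by apply: continuous_measurable_fun; exact: continuous_sin. Qed.

Context d (T : measurableType d).
Implicit Types f g : T -> X.

Lemma measurable_coord f : measurable_fun setT f ->
  [/\ measurable_fun setT (fun x => (f x).1),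
      measurable_fun setT (fun x => (f x).2.1.1),
      measurable_fun setT (fun x => (f x).2.1.2) &
      measurable_fun setT (fun x => (f x).2.2)].
Proof.
move=> mf; have m2 := measurableT_comp measurable_snd mf.
have m21 := measurableT_comp measurable_fst m2.
split.
- exact: (measurableT_comp measurable_fst mf).
- exact: (measurableT_comp measurable_fst m21).
- exact: (measurableT_comp measurable_snd m21).
- exact: (measurableT_comp measurable_snd m2).
Qed.

Lemma measurable_dot4 f g : measurable_fun setT f -> measurable_fun setT g ->
  measurable_fun setT (fun x => dot4 (f x) (g x)).
Proof.
move=> /measurable_coord[f0 f1 f2 f3] /measurable_coord[g0 g1 g2 g3].
apply: measurable_funD; first exact: measurable_funM.
apply: measurable_funD; last exact: measurable_funM.
by apply: measurable_funD; exact: measurable_funM.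
Qed.

Lemma measurable_X f : 
  measurable_fun setT (fun x => (f x).1 : measurableTypeR R) ->
  measurable_fun setT (fun x => (f x).2.1.1 : measurableTypeR R) ->
  measurable_fun setT (fun x => (f x).2.1.2 : measurableTypeR R) ->
  measurable_fun setT (fun x => (f x).2.2 : measurableTypeR R) ->
  measurable_fun setT f.
Proof.
move=> m0 m1 m2 m3.
have := measurable_fun_pair m0 (measurable_fun_pair (measurable_fun_pair m1 m2) m3).
by apply: eq_measurable_fun => x _ /=; case: (f x) => ? [[? ?] ?].
Qed.

Lemma measurable_XB f g : measurable_fun setT f -> measurable_fun setT g ->
  measurable_fun setT (fun x => f x - g x : X).
Proof.
move=> /measurable_coord[f0 f1 f2 f3] /measurable_coord[g0 g1 g2 g3].
by apply: measurable_X; exact: measurable_funB.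
Qed.

End measurability.

Section boxes.
Context (R : realType).
Local Notation X := (spacetime R).
Local Notation lam := (@lebesgue_measure R).

Definition box (a b : X) : set X :=
  `[a.1, b.1]%classic `*` ((`[a.2.1.1, b.2.1.1]%classic `*`
    `[a.2.1.2, b.2.1.2]%classic) `*` `[a.2.2, b.2.2]%classic).

Definition box_volume (a b : X) : R :=
  (b.1 - a.1) * ((b.2.1.1 - a.2.1.1) * (b.2.1.2 - a.2.1.2) * (b.2.2 - a.2.2)).

Definition box_le (a b : X) := [/\ a.1 <= b.1, a.2.1.1 <= b.2.1.1,
  a.2.1.2 <= b.2.1.2 & a.2.2 <= b.2.2].

Lemma measurable_box a b : measurable (box a b).
Proof.
have h (x y : R) : measurable (`[x, y]%classic : set (measurableTypeR R)).
  exact: measurable_itv.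
exact: (measurableX (h _ _) (measurableX (measurableX (h _ _) (h _ _)) (h _ _))).
Qed.

Lemma indic_setX d1 d2 (T1 : measurableType d1) (T2 : measurableType d2)
    (A : set T1) (B : set T2) (p : T1 * T2) :
  \1_(A `*` B) p = \1_A p.1 * \1_B p.2 :> R.
Proof. by rewrite !indicE in_setX; case: (_ \in A); case: (_ \in B); rewrite ?mul1r ?mul0r. Qed.

Lemma L1_itv (a b : R) : L1 lam (\1_(`[a, b] : set R)).
Proof. exact: (integrable_indic_itv a b true false). Qed.

Lemma mu4_box a b : box_le a b -> @mu4 R (box a b) = (box_volume a b)%:E.
Proof.
move=> [h0 h1 h2 h3].
have m (x y : R) : measurable (`[x, y]%classic : set (measurableTypeR R)).
  exact: measurable_itv.
have l (x y : R) : x <= y -> lam (`[x, y]%classic : set R) = (y - x)%:E.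
  rewrite le_eqVlt => /predU1P[<-|xy].
    by rewrite set_itv1 lebesgue_measure_set1 subrr.
  by rewrite lebesgue_measure_itv/= lte_fin xy.
have E2 A B : measurable A -> measurable B -> @mu2 R (A `*` B) = (lam A * lam B)%E.
  by move=> mA mB; exact: product_measure1E.
have E3 A B : measurable A -> measurable B -> @mu3 R (A `*` B) = (@mu2 R A * lam B)%E.
  by move=> mA mB; exact: product_measure1E.
have E4 A B : measurable A -> measurable B -> @mu4 R (A `*` B) = (lam A * @mu3 R B)%E.
  by move=> mA mB; exact: product_measure1E.
have M2 := measurableX (m a.2.1.1 b.2.1.1) (m a.2.1.2 b.2.1.2).
have M3 := measurableX M2 (m a.2.2 b.2.2).
by rewrite /box E4// E3// E2// !l.
Qed.

Lemma L1_box a b : box_le a b -> L1 (@mu4 R) (\1_(box a b)).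
Proof.
move=> ab; apply/integrableP; split.
  by apply/measurable_EFinP; apply: measurable_indic; exact: measurable_box.
under eq_integral do rewrite /= ger0_norm//.
rewrite integral_indic//; last exact: measurable_box.
by rewrite setIT [X in (X < _)%E](mu4_box ab) ltry.
Qed.

Definition fourier_mass : R := sincsq_mass R ^+ 4.

Lemma fourier_mass_gt0 : 0 < fourier_mass.
Proof. by rewrite exprn_gt0// sincsq_mass_gt0. Qed.

Local Notation p1 := (fun a b xi : R => powI lam (\1_(`[a, b] : set R)) (fun y => y * xi)).

Lemma powI_box a b zeta :
  powI (@mu4 R) (\1_(box a b)) (fun z => dot4 z zeta) =
  p1 a.1 b.1 zeta.1 * (p1 a.2.1.1 b.2.1.1 zeta.2.1.1 *
    p1 a.2.1.2 b.2.1.2 zeta.2.1.2 * p1 a.2.2 b.2.2 zeta.2.2).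
Proof.
have i := L1_itv.
have m (c : R) : measurable_fun setT (fun y : measurableTypeR R => y * c).
  exact: measurable_funM.
have mD d1 d2 (T1 : measurableType d1) (T2 : measurableType d2) (f : T1 -> R) (g : T2 -> R) :
    measurable_fun setT f -> measurable_fun setT g ->
    measurable_fun setT (fun p : T1 * T2 => f p.1 + g p.2).
  move=> mf mg; apply: measurable_funD.
    exact: measurableT_comp mf measurable_fst.
  exact: measurableT_comp mg measurable_snd.
have i2 := L1_tensor (i a.2.1.1 b.2.1.1) (i a.2.1.2 b.2.1.2).
have i3 := L1_tensor (m1 := @mu2 R) i2 (i a.2.2 b.2.2).
have m2 := mD _ _ _ _ _ _ (m zeta.2.1.1) (m zeta.2.1.2).
have m3 := mD _ _ _ _ _ _ m2 (m zeta.2.2).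
have e2 := powI_tensor (i a.2.1.1 b.2.1.1) (i a.2.1.2 b.2.1.2) (m zeta.2.1.1) (m zeta.2.1.2).
have e3 := powI_tensor (m1 := @mu2 R) i2 (i a.2.2 b.2.2) m2 (m zeta.2.2).
have e4 := powI_tensor (m2 := @mu3 R) (i a.1 b.1) i3 (m zeta.1) m3.
have eB : (\1_(box a b) : X -> R) = fun p => \1_`[a.1, b.1] p.1 *
    (\1_`[a.2.1.1, b.2.1.1] p.2.1.1 * \1_`[a.2.1.2, b.2.1.2] p.2.1.2 * \1_`[a.2.2, b.2.2] p.2.2).
  apply/funext => p.
  by rewrite /box (indic_setX _ _ p) (indic_setX _ _ p.2) (indic_setX _ _ p.2.1).
rewrite eB -e2 -e3 -e4; reflexivity.
Qed.

Lemma L1_powI_itv (a b : R) : a <= b -> L1 lam (p1 a b).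
Proof.
move=> ab; apply/integrableP; split.
  by apply/measurable_EFinP; exact: measurable_powI_itv.
under eq_integral do rewrite /= ger0_norm ?powI_ge0//.
by rewrite integral_powI_itv// ltry.
Qed.

Lemma L1_powI_box a b : box_le a b ->
  L1 (@mu4 R) (fun zeta => powI (@mu4 R) (\1_(box a b)) (fun z => dot4 z zeta)).
Proof.
move=> [h0 h1 h2 h3].
have i2 := L1_tensor (L1_powI_itv h1) (L1_powI_itv h2).
have i3 := L1_tensor (m1 := @mu2 R) i2 (L1_powI_itv h3).
have := L1_tensor (m2 := @mu3 R) (L1_powI_itv h0) i3.
by apply: eq_integrable => // p _; rewrite /= powI_box.
Qed.

(** Plancherel's identity for a box, as a product of four one-dimensional ones. All explicit
    knowledge of the transform enters through this identity and [L1_powI_box]. *)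
Lemma Rint_powI_box a b : box_le a b ->
  \int[@mu4 R]_zeta powI (@mu4 R) (\1_(box a b)) (fun z => dot4 z zeta) =
  fourier_mass * box_volume a b.
Proof.
move=> [h0 h1 h2 h3].
have i2 := L1_tensor (L1_powI_itv h1) (L1_powI_itv h2).
have i3 := L1_tensor (m1 := @mu2 R) i2 (L1_powI_itv h3).
under eq_Rintegral do rewrite powI_box.
rewrite (Rint_tensor (m2 := @mu3 R) (L1_powI_itv h0) i3).
rewrite (Rint_tensor (m1 := @mu2 R) i2 (L1_powI_itv h3)).
rewrite (Rint_tensor (L1_powI_itv h1) (L1_powI_itv h2)).
by rewrite /Rintegral !integral_powI_itv//= /fourier_mass /box_volume; move: (sincsq_mass R) => c; ring.
Qed.

End boxes.

(** * The inequality half of Plancherel's theorem *)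

Section contraction.
Context (R : realType).
Local Notation X := (spacetime R).
Implicit Types (a : X -> R) (zeta h : X).

(** Cosine transform; together with [FS] and [FP] it is the real form in which Plancherel is proved
    before complex functions are assembled. *)
Definition FC a zeta := cosI (@mu4 R) a (fun z => dot4 z zeta).
Definition FS a zeta := sinI (@mu4 R) a (fun z => dot4 z zeta).
Definition FP a zeta := powI (@mu4 R) a (fun z => dot4 z zeta).

Lemma measurable_FC a : L1 (@mu4 R) a -> measurable_fun setT (FC a).
Proof.
move=> /L1_measurable ma.
apply: (@measurable_Rintegral_snd _ _ _ _ _ (@mu4 R) (fun x y => a y * cos (dot4 y x))).
apply: measurable_funM; first exact: measurableT_comp ma measurable_snd.
apply: measurableT_comp; first exact: measurable_cosR.
by apply: measurable_dot4; [exact: measurable_snd|exact: measurable_fst].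
Qed.

Lemma measurable_FS a : L1 (@mu4 R) a -> measurable_fun setT (FS a).
Proof.
move=> /L1_measurable ma.
apply: (@measurable_Rintegral_snd _ _ _ _ _ (@mu4 R) (fun x y => a y * sin (dot4 y x))).
apply: measurable_funM; first exact: measurableT_comp ma measurable_snd.
apply: measurableT_comp; first exact: measurable_sinR.
by apply: measurable_dot4; [exact: measurable_snd|exact: measurable_fst].
Qed.

Lemma measurable_FP a : L1 (@mu4 R) a -> measurable_fun setT (FP a).
Proof.
move=> ai; apply: measurable_funD; apply: measurable_funX.
  exact: measurable_FC.
exact: measurable_FS.
Qed.

(** A number times its conjugate, written as a double integral: the phases subtract. *)
Lemma powI_double d (T : measurableType d) (m : {sigma_finite_measure set T -> \bar R})
    (f ph : T -> R) : L1 m f -> measurable_fun setT ph ->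
  powI m f ph = \int[(m \x m)%E]_p (f p.1 * f p.2 * cos (ph p.1 - ph p.2)).
Proof.
move=> fi mph; have fc := L1_cos fi mph; have fs := L1_sin fi mph.
rewrite /powI !expr2.
rewrite -[X in X + _ = _](Rint_tensor fc fc) -[X in _ + X = _](Rint_tensor fs fs).
rewrite -Rint_D; [|exact: (L1_tensor fc fc)|exact: (L1_tensor fs fs)].
by apply: eq_Rintegral => p _; rewrite cosB; ring.
Qed.


Lemma measurable_dot4l zeta : measurable_fun setT (fun z : X => dot4 z zeta).
Proof. by apply: measurable_dot4 => //; exact: measurable_cst. Qed.

Lemma dot4C (x y : X) : dot4 x y = dot4 y x.
Proof. by rewrite /dot4 /dot3; ring. Qed.

Lemma dot4Br (x y z : X) : dot4 x (y - z) = dot4 x y - dot4 x z.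
Proof. by rewrite /dot4 /dot3 /=; ring. Qed.

Lemma dot4Bl (x y z : X) : dot4 (y - z) x = dot4 y x - dot4 z x.
Proof. by rewrite /dot4 /dot3 /=; ring. Qed.

(** Both sides are the same four-fold integral of [\1_Q x * \1_Q y * a s * a t * cos ((s - t) . (x -
    y))]: integrating in [s, t] first leaves [J], integrating in [x, y] first leaves [K]. *)
Lemma FP_pairing a (Q : set X) : L1 (@mu4 R) a -> L1 (@mu4 R) (\1_Q) ->
  let J := fun p : X * X => \1_Q p.1 * \1_Q p.2 * FP a (p.1 - p.2) in
  let K := fun p : X * X => a p.1 * a p.2 * FP (\1_Q) (p.1 - p.2) in
  [/\ L1 mu44 J, L1 mu44 K & \int[mu44]_p J p = \int[mu44]_p K p].
Proof.
move=> ai Qi J K.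
have aai := L1_tensor ai ai; have QQi := L1_tensor Qi Qi.
pose ph (P : (X * X) * (X * X)) := dot4 (P.2.1 - P.2.2) (P.1.1 - P.1.2).
have mph : measurable_fun setT ph.
  apply: measurable_dot4; apply: measurable_XB.
  - exact: measurableT_comp measurable_fst measurable_snd.
  - exact: measurableT_comp measurable_snd measurable_snd.
  - exact: measurableT_comp measurable_fst measurable_fst.
  - exact: measurableT_comp measurable_snd measurable_fst.
pose F (p q : X * X) := \1_Q p.1 * \1_Q p.2 * (a q.1 * a q.2) * cos (ph (p, q)).
have iF : L1 (mu44 \x mu44)%E (fun P => F P.1 P.2).
  have := L1_cos (L1_tensor (m1 := mu44) (m2 := mu44) QQi aai) mph.
  by apply: eq_integrable => // -[p q].
have F1 p : L1 mu44 (F p).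
  apply: (L1_cos (m := mu44) (f := fun q => \1_Q p.1 * \1_Q p.2 * (a q.1 * a q.2))).
    exact: L1Z.
  exact: measurableT_comp mph (measurable_pair1 p).
have F2 q : L1 mu44 (F ^~ q).
  have := L1_cos (m := mu44) (f := fun p => (a q.1 * a q.2) * (\1_Q p.1 * \1_Q p.2)) (L1Z _ QQi)
    (measurableT_comp mph (measurable_pair2 q)).
  by apply: eq_integrable => // p _; rewrite /F /=; congr EFin; ring.
have JE p : \int[mu44]_q F p q = J p.
  rewrite /J /FP powI_double//; last exact: measurable_dot4l.
  rewrite -Rint_Z; last first.
    apply: (L1_cos (m := mu44) aai).
    by apply: measurable_funB; apply: measurable_dot4 => //; exact: measurable_cst.
  by apply: eq_Rintegral => q _; rewrite /F /ph /= dot4Bl; ring.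
have KE q : \int[mu44]_p F p q = K q.
  rewrite /K /FP powI_double//; last exact: measurable_dot4l.
  rewrite -Rint_Z; last first.
    apply: (L1_cos (m := mu44) QQi).
    by apply: measurable_funB; apply: measurable_dot4 => //; exact: measurable_cst.
  by apply: eq_Rintegral => p _; rewrite /F /ph /= dot4Br !(dot4C (q.1 - q.2)); ring.
split.
- have := L1_inner1 iF F1; by apply: eq_integrable => // p _; rewrite /= JE.
- have := L1_inner2 iF F2; by apply: eq_integrable => // p _; rewrite /= KE.
- have := Rint_swap iF F1 F2.
  under eq_Rintegral do rewrite JE.
  by under [in X in _ = X -> _]eq_Rintegral do rewrite KE.
Qed.

(** Schur's test: the kernel [W] is nonnegative and depends only on a difference, so after
    symmetrizing the product of the two values of [a], the free variable integrates out by
    translation or reflection invariance. *)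
Lemma FP_pairing_le a (Q : set X) : L1 (@mu4 R) a -> L2 (@mu4 R) a ->
  L1 (@mu4 R) (\1_Q) -> L1 (@mu4 R) (FP (\1_Q)) ->
  \int[mu44]_p (\1_Q p.1 * \1_Q p.2 * FP a (p.1 - p.2)) <=
  ip (@mu4 R) a a * \int[@mu4 R]_z FP (\1_Q) z.
Proof.
move=> ai a2 Qi Wi; have [_ iK ->] := FP_pairing ai Qi.
set W := FP (\1_Q).
have mW := L1_measurable Wi.
have mWB : measurable_fun setT (fun p : X * X => W (p.1 - p.2)).
  by apply: (measurableT_comp mW); apply: measurable_XB.
have W0 z : 0 <= W z by exact: powI_ge0.
have a2i : L1 (@mu4 R) (fun x => a x ^+ 2) := a2.2.
have ma := L1_measurable ai.
pose G1 (x y : X) := a x ^+ 2 * W (x - y).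
pose G2 (x y : X) := a y ^+ 2 * W (x - y).
have G10 x y : 0 <= G1 x y by rewrite mulr_ge0 ?sqr_ge0.
have G20 x y : 0 <= G2 x y by rewrite mulr_ge0 ?sqr_ge0.
have mG1 : measurable_fun setT (fun p : X * X => G1 p.1 p.2).
  apply: measurable_funM => //; apply: measurable_funX.
  exact: measurableT_comp ma measurable_fst.
have mG2 : measurable_fun setT (fun p : X * X => G2 p.1 p.2).
  apply: measurable_funM => //; apply: measurable_funX.
  exact: measurableT_comp ma measurable_snd.
have WE : (\int[@mu4 R]_z (W z)%:E = (\int[@mu4 R]_z W z)%:E)%E by rewrite L1_EFin.
have aE : (\int[@mu4 R]_z (a z ^+ 2)%:E = (ip (@mu4 R) a a)%:E)%E by rewrite L1_EFin.
have mWE : measurable_fun setT (EFin \o W) by exact/measurable_EFinP.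
have E1 : (\int[mu44]_p (G1 p.1 p.2)%:E = (ip (@mu4 R) a a * \int[@mu4 R]_z W z)%:E)%E.
  rewrite (@fubini_tonelli1 _ _ _ _ _ (@mu4 R) (@mu4 R) (fun p => (G1 p.1 p.2)%:E)); last 2 first.
  - exact/measurable_EFinP.
  - by move=> p; rewrite lee_fin mulr_ge0 ?sqr_ge0.
  have inner x : (\int[@mu4 R]_y (G1 x y)%:E =
      (\int[@mu4 R]_z W z)%:E * (a x ^+ 2)%:E)%E.
    have mWx : measurable_fun setT (fun y : X => W (x - y)).
      by apply: (measurableT_comp mW); apply: measurable_XB => //; exact: measurable_cst.
    rewrite /G1 ge0_integralZ_EFin ?sqr_ge0//.
    by rewrite (integral_mpres (mpres_mu4rB x) mWE) WE muleC.
  rewrite /fubini_F; under eq_integral do rewrite /= inner.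
  rewrite ge0_integralZl//; last 3 first.
  - by apply/measurable_EFinP; exact: measurable_funX.
  - by move=> y _; rewrite lee_fin sqr_ge0.
  - by rewrite lee_fin; exact: Rintegral_ge0.
  by rewrite aE -EFinM mulrC.
have E2 : (\int[mu44]_p (G2 p.1 p.2)%:E = (ip (@mu4 R) a a * \int[@mu4 R]_z W z)%:E)%E.
  rewrite (@fubini_tonelli2 _ _ _ _ _ (@mu4 R) (@mu4 R) (fun p => (G2 p.1 p.2)%:E)); last 2 first.
  - exact/measurable_EFinP.
  - by move=> p; rewrite lee_fin mulr_ge0 ?sqr_ge0.
  have inner y : (\int[@mu4 R]_x (G2 x y)%:E =
      (\int[@mu4 R]_z W z)%:E * (a y ^+ 2)%:E)%E.
    have mWx : measurable_fun setT (fun x : X => W (x - y)).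
      by apply: (measurableT_comp mW); apply: measurable_XB => //; exact: measurable_cst.
    rewrite /G2 ge0_integralZ_EFin ?sqr_ge0//.
    by rewrite (integral_mpres (mpres_mu4B y) mWE) WE muleC.
  rewrite /fubini_G; under eq_integral do rewrite /= inner.
  rewrite ge0_integralZl//; last 3 first.
  - by apply/measurable_EFinP; exact: measurable_funX.
  - by move=> y _; rewrite lee_fin sqr_ge0.
  - by rewrite lee_fin; exact: Rintegral_ge0.
  by rewrite aE -EFinM mulrC.
have i1 : L1 mu44 (fun p => G1 p.1 p.2).
  apply/integrableP; split; first exact/measurable_EFinP.
  under eq_integral do rewrite /= ger0_norm ?G10//.
  by rewrite E1 ltry.
have i2 : L1 mu44 (fun p => G2 p.1 p.2).
  apply/integrableP; split; first exact/measurable_EFinP.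
  under eq_integral do rewrite /= ger0_norm ?G20//.
  by rewrite E2 ltry.
apply: (@le_trans _ _ (\int[mu44]_p (2^-1 * (G1 p.1 p.2 + G2 p.1 p.2)))).
  apply: le_Rintegral => //; first exact: (L1Z (2^-1) (L1D i1 i2)).
  move=> p _; rewrite /G1 /G2 -mulrDl mulrA ler_wpM2r//.
  exact: mulr_le_half_sqr.
have r1 : \int[mu44]_p G1 p.1 p.2 = ip (@mu4 R) a a * \int[@mu4 R]_z W z.
  by rewrite /Rintegral E1.
have r2 : \int[mu44]_p G2 p.1 p.2 = ip (@mu4 R) a a * \int[@mu4 R]_z W z.
  by rewrite /Rintegral E2.
by rewrite (Rint_Z _ (L1D i1 i2)) (Rint_D i1 i2) r1 r2 half_double.
Qed.

End contraction.

(** Divide by [r ^ 4] and let [r] tend to infinity. *)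
Lemma limit_scale4 (R : realType) (s x M : R) : 0 < s -> 0 <= M ->
  (forall r, s < r -> (r - s) ^+ 4 * x <= r ^+ 4 * M) -> x <= M.
Proof.
move=> s0 M0 h; rewrite leNgt; apply/negP => Mx.
have x0 : 0 < x by exact: le_lt_trans Mx.
(* At [r = s / d] the ratio [(r - s) / r] is [1 - d]. As [(1 - d) ^ 4 >= 1 - 4 * d], the loss is at
   most [4 * d * x], which this choice makes half of the gap [x - M]. *)
pose d := (x - M) / (8 * x).
have d0 : 0 < d by rewrite divr_gt0 ?subr_gt0// mulr_gt0.
have d1 : d <= 8^-1.
  by rewrite ler_pdivrMr ?mulr_gt0// mulrA mulVf// mul1r gerBl.
have dx : 8 * (d * x) = x - M by rewrite /d; field; rewrite gt_eqF.
have sd : s < s / d by rewrite ltr_pdivlMr// gtr_pMr//; lra.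
have := h _ sd.
have -> : s / d - s = s / d * (1 - d) by field; rewrite gt_eqF.
have q0 : 0 < (s / d) ^+ 4 by rewrite exprn_gt0// divr_gt0.
rewrite exprMn -mulrA ler_pM2l//.
have b4 : 1 - 4 * d <= (1 - d) ^+ 4.
  have -> : (1 - d) ^+ 4 = 1 - 4 * d + d ^+ 2 * (6 - 4 * d + d ^+ 2) by ring.
  by rewrite lerDl mulr_ge0 ?sqr_ge0// addr_ge0 ?sqr_ge0//; lra.
have : (1 - 4 * d) * x <= (1 - d) ^+ 4 * x by rewrite ler_wpM2r// ltW.
by nra.
Qed.

Section contraction2.
Context (R : realType).
Local Notation X := (spacetime R).
Local Notation mu := (@mu4 R).
Implicit Types (a : X -> R) (zeta h : X).

Definition diag4 (r : R) : X := (r, ((r, r), r)).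

Definition cube (r : R) : set X := box (- diag4 r) (diag4 r).

Lemma cubeP r (x : X) : cube r x <->
  [/\ `|x.1| <= r, `|x.2.1.1| <= r, `|x.2.1.2| <= r & `|x.2.2| <= r].
Proof.
rewrite /cube /box /= !in_itv/= !ler_norml; split=> [[h0 [[h1 h2] h3]]|[h0 h1 h2 h3]].
  by split.
by split=> //; split.
Qed.

Lemma measurable_cube r : measurable (cube r).
Proof. exact: measurable_box. Qed.

Lemma cube_le r : 0 <= r -> box_le (- diag4 r) (diag4 r).
Proof. by move=> r0; split; rewrite /= ge0_cp. Qed.

Lemma mu4_cube r : 0 <= r -> mu (cube r) = ((2 * r) ^+ 4)%:E.
Proof.
move=> r0; rewrite mu4_box; last exact: cube_le.
by congr EFin; rewrite /box_volume /=; ring.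
Qed.

(* Integrate [FP a (p - q)] over [p, q] in the cube of radius [r]: expanding the
   square gives a quadratic form in [a] with the nonnegative kernel
   [FP (\1_cube)], which AM-GM bounds by [ip a a]. *)
Lemma contraction_cube a (s r : R) : 0 < s -> s < r -> L1 mu a -> L2 mu a ->
  (((2 * (r - s)) ^+ 4)%:E * \int[mu]_z (\1_(cube s) z * FP a z)%:E <=
   (fourier_mass R * (2 * r) ^+ 4 * ip mu a a)%:E)%E.
Proof.
move=> s0 sr ai a2.
have r0 : 0 < r by exact: lt_trans sr.
have Qi : L1 mu (\1_(cube r)) by apply: L1_box; apply: cube_le; exact: ltW.
have Wi : L1 mu (FP (\1_(cube r))) by apply: L1_powI_box; apply: cube_le; exact: ltW.
have [Ji _ _] := FP_pairing ai Qi.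
have := FP_pairing_le ai a2 Qi Wi.
rewrite Rint_powI_box; last by apply: cube_le; exact: ltW.
rewrite (_ : box_volume _ _ = (2 * r) ^+ 4); last by rewrite /box_volume /=; ring.
rewrite mulrC -lee_fin -L1_EFin// => h; apply: le_trans h.
have mF : measurable_fun setT (fun z => \1_(cube s) z * FP a z).
  apply: measurable_funM; last exact: measurable_FP.
  by apply: measurable_indic; exact: measurable_cube.
have F0 z : 0 <= \1_(cube s) z * FP a z by rewrite mulr_ge0 ?powI_ge0.
pose F z := (\1_(cube s) z * FP a z)%:E.
have mFE : measurable_fun setT F by exact/measurable_EFinP.
rewrite (@fubini_tonelli2 _ _ _ _ _ mu mu); last 2 first.
- by apply/measurable_EFinP; exact: (L1_measurable Ji).
- by move=> p; rewrite lee_fin !mulr_ge0 ?powI_ge0.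
have shift (y : X) : (\int[mu]_x F (x - y)%R = \int[mu]_x F x)%E.
  exact: (integral_mpres (mpres_mu4B y) mFE).
(* Each [y] in [cube (r - s)] contributes a translate of the mass over [cube s]; if moreover [x - y]
   is in [cube s], then [x] and [y] both lie in [cube r]. *)
have -> : (((2 * (r - s)) ^+ 4)%:E * \int[mu]_z F z =
    \int[mu]_y ((\int[mu]_x F (x - y)%R) * (\1_(cube (r - s)) y)%:E))%E.
  transitivity (\int[mu]_y ((\int[mu]_x F x) * (\1_(cube (r - s)) y)%:E))%E; last first.
    by apply: eq_integral => y _; rewrite (shift y).
  rewrite ge0_integralZl//; last 2 first.
  - by apply/measurable_EFinP; apply: measurable_indic; exact: measurable_cube.
  - by apply: integral_ge0 => z _; rewrite lee_fin.
  rewrite integral_indic ?setIT//; last exact: measurable_cube.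
  rewrite muleC; congr (_ * _)%E.
  by apply/esym/mu4_cube; rewrite subr_ge0 ltW.
have mFB (y : X) : measurable_fun setT (fun x : X => F (x - y)).
  by apply: (measurableT_comp mFE); apply: measurable_XB => //; exact: measurable_cst.
apply: ge0_le_integral; first exact: measurableT.
- move=> y _; apply: mule_ge0; last by rewrite lee_fin.
  by apply: integral_ge0 => x _; rewrite lee_fin.
- apply: emeasurable_funM; last first.
    by apply/measurable_EFinP; apply: measurable_indic; exact: measurable_cube.
  apply: (eq_measurable_fun (cst (\int[mu]_x F x)%E)); last exact: measurable_cst.
  by move=> y _; rewrite -(shift y).
- apply: measurable_fun_fubini_tonelli_G => //.
    by apply/measurable_EFinP; exact: (L1_measurable Ji).
  by move=> p; rewrite lee_fin !mulr_ge0 ?powI_ge0.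
move=> y _; rewrite -ge0_integralZr//; last by move=> x _; rewrite lee_fin.
apply: ge0_le_integral; first exact: measurableT.
- by move=> x _; rewrite mule_ge0// lee_fin.
- by apply: emeasurable_funM; [exact: mFB|exact: measurable_cst].
- apply/measurable_EFinP; apply: (measurableT_comp (L1_measurable Ji)).
  exact: measurable_pair2.
move=> x _; rewrite /F -EFinM lee_fin /= mulrAC ler_wpM2r ?powI_ge0//.
rewrite !indicE.
have [ys|] := boolP (y \in cube (r - s)); last by rewrite mulr0 mulr_ge0.
have [xs|] := boolP (x - y \in cube s); last by rewrite mul0r mulr_ge0.
move: ys xs; rewrite !inE => /cubeP[y0 y1 y2 y3] /cubeP[x0 x1 x2 x3].
have tri (u v : R) : `|v| <= r - s -> `|u - v| <= s -> `|u| <= r.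
  move=> hv huv; rewrite -(subrK v u); apply: (le_trans (ler_normD _ _)).
  by rewrite -(subrK s r) addrC lerD.
have yr (v : R) : `|v| <= r - s -> `|v| <= r.
  by move/le_trans; apply; rewrite gerBl ltW.
rewrite !mem_set ?mulr1//; apply/cubeP; split; try exact: yr.
- exact: tri x0.
- exact: tri x1.
- exact: tri x2.
- exact: tri x3.
Qed.

(** The ratio [((r - s) / r) ^ 4] tends to 1, which removes the loss in [contraction_cube].
    Finiteness of the integral must come first; [r = s + s] already gives it. *)
Lemma indic_cube_FP_le a s : 0 < s -> L1 mu a -> L2 mu a ->
  (\int[mu]_z (\1_(cube s) z * FP a z)%:E <= (fourier_mass R * ip mu a a)%:E)%E.
Proof.
move=> s0 ai a2; set I := (\int[mu]_z _)%E.
have I0 : (0 <= I)%E.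
  by apply: integral_ge0 => z _; rewrite lee_fin mulr_ge0 ?powI_ge0.
have Ifin : I \is a fin_num.
  rewrite ge0_fin_numE//.
  have := @contraction_cube a s (s + s) s0.
  rewrite ltrDl => /(_ s0 ai a2) h.
  have k0 : 0 < (2 * (s + s - s)) ^+ 4 by rewrite addrK exprn_gt0// mulr_gt0.
  rewrite ltNge leye_eq; apply/negP => /eqP II.
  by move: h; rewrite -/I II gt0_muley ?lte_fin// leye_eq.
rewrite -(fineK Ifin) lee_fin.
apply: (limit_scale4 s0); first by rewrite mulr_ge0 ?ip_ge0 ?ltW ?fourier_mass_gt0.
move=> r sr; have := contraction_cube s0 sr ai a2.
rewrite -/I -(fineK Ifin) -EFinM lee_fin !exprMn => h.
by rewrite -(@ler_pM2l _ (2 ^+ 4)) ?exprn_gt0//; apply: (le_trans _ (le_trans h _)); rewrite le_eqVlt; apply/orP; left; apply/eqP; ring.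
Qed.

Lemma cubeT (z : X) : exists n : nat, forall m, (n <= m)%N -> cube m%:R z.
Proof.
pose M := `|z.1| + `|z.2.1.1| + `|z.2.1.2| + `|z.2.2|.
have := truncnS_gt M; set n := (Num.truncn M).+1 => hn.
exists n => m nm; apply/cubeP.
have : M <= m%:R by apply: (le_trans (ltW hn)); rewrite ler_nat.
by rewrite /M => hM; split; apply: le_trans hM;
  have := normr_ge0 z.1; have := normr_ge0 z.2.1.1; have := normr_ge0 z.2.1.2; 
  have := normr_ge0 z.2.2; move: `|z.1| `|z.2.1.1| `|z.2.1.2| `|z.2.2|; clear; move=> *; lra.
Qed.

Lemma cubeS (r s : R) : r <= s -> cube r `<=` cube s.
Proof.
by move=> rs z /cubeP[h0 h1 h2 h3]; apply/cubeP; split; exact: le_trans rs.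
Qed.

Lemma cvg_indic_cube (f : X -> R) :  measurable_fun setT f -> (forall z, 0 <= f z) ->
  (\int[mu]_z (\1_(cube n%:R) z * f z)%:E @[n --> \oo] --> \int[mu]_z (f z)%:E)%E.
Proof.
move=> mf f0.
have cv (z : X) : (\1_(cube n%:R) z * f z)%:E @[n --> \oo] --> (f z)%:E.
  have [n hn] := cubeT z.
  apply: cvg_near_cst; exists n => // m /= nm.
  by rewrite indicE mem_set ?mul1r//; exact: hn.
have -> : (\int[mu]_z (f z)%:E = \int[mu]_z (limn (fun n => (\1_(cube n%:R) z * f z)%:E)))%E.
  by apply: eq_integral => z _; rewrite (cvg_lim _ (cv z)).
apply: cvg_monotone_convergence => //.
- move=> n; apply/measurable_EFinP; apply: measurable_funM => //.
  by apply: measurable_indic; exact: measurable_cube.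
- by move=> n z _; rewrite lee_fin mulr_ge0.
- move=> z _ m n mn; rewrite lee_fin ler_wpM2r// !indicE.
  case: (boolP (z \in cube m%:R)) => //; rewrite inE => zm.
  rewrite mem_set//; apply: (cubeS _ zm).
  by rewrite ler_nat.
Qed.

Lemma FP_le a : L1 mu a -> L2 mu a ->
  (\int[mu]_z (FP a z)%:E <= (fourier_mass R * ip mu a a)%:E)%E.
Proof.
move=> ai a2.
have h := cvg_indic_cube (measurable_FP ai) (fun z => powI_ge0 _ _ _).
rewrite -(cvg_lim _ h)//; apply: lime_le; first by apply/cvg_ex; eexists; exact: h.
exists 1%N => // n /= n1; apply: indic_cube_FP_le => //.
by rewrite ltr0n.
Qed.

Lemma L1_FP a : L1 mu a -> L2 mu a -> L1 mu (FP a).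
Proof.
move=> ai a2; apply/integrableP; split; first by apply/measurable_EFinP; exact: measurable_FP.
under eq_integral do rewrite /= ger0_norm ?powI_ge0//.
by apply: le_lt_trans (FP_le ai a2) _; rewrite ltry.
Qed.

Lemma L2_FC a : L1 mu a -> L2 mu a -> L2 mu (FC a).
Proof.
move=> ai a2; split; first exact: measurable_FC.
apply: L1_le (L1_FP ai a2); first by apply: measurable_funX; exact: measurable_FC.
move=> z; rewrite !ger0_norm ?powI_ge0 ?sqr_ge0//.
by rewrite /FP /powI lerDl sqr_ge0.
Qed.

Lemma L2_FS a : L1 mu a -> L2 mu a -> L2 mu (FS a).
Proof.
move=> ai a2; split; first exact: measurable_FS.
apply: L1_le (L1_FP ai a2); first by apply: measurable_funX; exact: measurable_FS.
move=> z; rewrite !ger0_norm ?powI_ge0 ?sqr_ge0//.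
by rewrite /FP /powI lerDr sqr_ge0.
Qed.

Lemma Rint_FP a : L1 mu a -> L2 mu a ->
  \int[mu]_z FP a z = ip mu (FC a) (FC a) + ip mu (FS a) (FS a).
Proof.
move=> ai a2; have fc := L2_FC ai a2; have fs := L2_FS ai a2.
rewrite -Rint_D; [|exact: L2_L1..].
by apply: eq_Rintegral => z _; rewrite -!expr2.
Qed.

(* The defect is a nonnegative quadratic form, so by Cauchy-Schwarz its zeros form
   a linear space; as this space contains the indicators of boxes and is closed
   under dominated limits, it is everything. *)
Definition defect a : R :=
  fourier_mass R * ip mu a a - (ip mu (FC a) (FC a) + ip mu (FS a) (FS a)).

Lemma defect_ge0 a : L1 mu a -> L2 mu a -> 0 <= defect a.
Proof.
move=> ai a2; rewrite subr_ge0 -Rint_FP// -lee_fin -L1_EFin; last exact: L1_FP.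
exact: FP_le.
Qed.

End contraction2.

Lemma sqr_indic (R : realType) T (A : set T) :
  (fun x => (\1_A x : R) ^+ 2) = \1_A.
Proof.
apply/funext => x; rewrite indicE -natrX.
by case: (x \in A).
Qed.

(** * Equality in Plancherel's theorem *)

Section isometry.
Context (R : realType).
Local Notation X := (spacetime R).
Local Notation mu := (@mu4 R).
Implicit Types (a b u g : X -> R) (zeta h : X).

Definition L12 a := L1 mu a /\ L2 mu a.

Lemma L12_L1 a : L12 a -> L1 mu a. Proof. by case. Qed.
Lemma L12_L2 a : L12 a -> L2 mu a. Proof. by case. Qed.

Lemma L12D a b : L12 a -> L12 b -> L12 (fun x => a x + b x).
Proof. by move=> [a1 a2] [b1 b2]; split; [exact: L1D|exact: L2D]. Qed.

Lemma L12Z k a : L12 a -> L12 (fun x => k * a x).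
Proof. by move=> [a1 a2]; split; [exact: L1Z|exact: L2Z]. Qed.

Lemma FCD a b : L1 mu a -> L1 mu b -> FC (fun x => a x + b x) = (fun z => FC a z + FC b z).
Proof.
move=> ai bi; apply/funext => z; rewrite -[RHS]Rint_D.
- by apply: eq_Rintegral => x _; rewrite mulrDl.
- exact: L1_cos (measurable_dot4l z).
- exact: L1_cos (measurable_dot4l z).
Qed.

Lemma FSD a b : L1 mu a -> L1 mu b -> FS (fun x => a x + b x) = (fun z => FS a z + FS b z).
Proof.
move=> ai bi; apply/funext => z; rewrite -[RHS]Rint_D.
- by apply: eq_Rintegral => x _; rewrite mulrDl.
- exact: L1_sin (measurable_dot4l z).
- exact: L1_sin (measurable_dot4l z).
Qed.

Lemma FCZ k a : L1 mu a -> FC (fun x => k * a x) = (fun z => k * FC a z).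
Proof.
move=> ai; apply/funext => z; rewrite -[RHS]Rint_Z.
  by apply: eq_Rintegral => x _; rewrite mulrA.
exact: L1_cos (measurable_dot4l z).
Qed.

Lemma FSZ k a : L1 mu a -> FS (fun x => k * a x) = (fun z => k * FS a z).
Proof.
move=> ai; apply/funext => z; rewrite -[RHS]Rint_Z.
  by apply: eq_Rintegral => x _; rewrite mulrA.
exact: L1_sin (measurable_dot4l z).
Qed.

Opaque FC FS.

Lemma L12_FC a : L12 a -> L2 mu (FC a). Proof. by case; exact: L2_FC. Qed.
Lemma L12_FS a : L12 a -> L2 mu (FS a). Proof. by case; exact: L2_FS. Qed.

(** Polar form of the quadratic form [defect]. *)
Definition defect2 a b : R :=
  fourier_mass R * ip mu a b - (ip mu (FC a) (FC b) + ip mu (FS a) (FS b)).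

Lemma defectD a b : L12 a -> L12 b ->
  defect (fun x => a x + b x) = defect a + 2 * defect2 a b + defect b.
Proof.
move=> ai bi; rewrite /defect /defect2 FCD ?FSD; [|exact: L12_L1..].
move: (FC a) (FS a) (FC b) (FS b) (L12_FC ai) (L12_FS ai) (L12_FC bi) (L12_FS bi).
move=> A B C D iA iB iC iD.
by rewrite (ipDD (L12_L2 ai) (L12_L2 bi)) (ipDD iA iC) (ipDD iB iD); ring.
Qed.

Lemma defectZ k a : L12 a -> defect (fun x => k * a x) = k ^+ 2 * defect a.
Proof.
move=> ai; rewrite /defect FCZ ?FSZ; [|exact: L12_L1..].
move: (FC a) (FS a) (L12_FC ai) (L12_FS ai) => A B iA iB.
by rewrite (ipZZ _ (L12_L2 ai)) (ipZZ _ iA) (ipZZ _ iB); ring.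
Qed.

Lemma defect2Zr k a b : L12 a -> L12 b -> defect2 a (fun x => k * b x) = k * defect2 a b.
Proof.
move=> ai bi; rewrite /defect2 FCZ ?FSZ; [|exact: L12_L1..].
move: (FC a) (FS a) (FC b) (FS b) (L12_FC ai) (L12_FS ai) (L12_FC bi) (L12_FS bi).
move=> A B C D iA iB iC iD.
rewrite (ipC _ a) (ipC _ A) (ipC _ B).
rewrite (ipZl _ (L12_L2 bi) (L12_L2 ai)) (ipZl _ iC iA) (ipZl _ iD iB).
by rewrite (ipC _ _ a) (ipC _ _ A) (ipC _ _ B); ring.
Qed.

Definition nulldefect a := L12 a /\ defect a = 0.

Lemma defect2_null a b : L12 a -> nulldefect b -> defect2 a b = 0.
Proof.
move=> ai [bi b0].
have := @quadratic_ge0_sqr R (defect a) (defect2 a b) (defect b).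
rewrite b0 mulr0 => /(_ _ (lexx 0)) h.
have /h : forall t, 0 <= defect a + 2 * t * defect2 a b + t ^+ 2 * 0.
  move=> t; have tbi := L12Z t bi.
  have := defect_ge0 (L12_L1 (L12D ai tbi)) (L12_L2 (L12D ai tbi)).
  by rewrite defectD// defectZ// b0 defect2Zr// mulrA.
by move=> h0; apply/eqP; rewrite -sqrf_eq0 eq_le h0 sqr_ge0.
Qed.

Lemma nulldefectD a b : nulldefect a -> nulldefect b -> nulldefect (fun x => a x + b x).
Proof.
move=> za zb; split; first exact: L12D za.1 zb.1.
by rewrite (defectD za.1 zb.1) (defect2_null za.1 zb) za.2 zb.2 mulr0 !addr0.
Qed.

Lemma nulldefectZ k a : nulldefect a -> nulldefect (fun x => k * a x).
Proof. by move=> [ai a0]; split; [exact: L12Z|rewrite defectZ// a0 mulr0]. Qed.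

Lemma nulldefectB a b : nulldefect a -> nulldefect b -> nulldefect (fun x => a x - b x).
Proof.
move=> za zb; have := nulldefectD za (nulldefectZ (-1) zb).
by under eq_fun do rewrite mulN1r.
Qed.

Lemma nulldefect0 : nulldefect (fun=> 0).
Proof.
have i0 : L12 (fun=> 0).
  split; first exact: integrable0.
  split; first exact: measurable_cst.
  rewrite expr0n /=; exact: integrable0.
split=> //; have := defectZ 0 i0.
rewrite (_ : (fun=> 0 * 0) = (fun=> 0 : R)); last by apply/funext => x; rewrite mulr0.
by rewrite expr0n mul0r.
Qed.

Lemma nulldefect_sum I (s : seq I) (f : I -> X -> R) :
  (forall i, nulldefect (f i)) -> nulldefect (fun x => \sum_(i <- s) f i x).
Proof.
move=> zf; elim: s => [|i s ih].
  rewrite (_ : (fun x => _) = fun=> 0); first exact: nulldefect0.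
  by apply/funext => x; rewrite big_nil.
have := nulldefectD (zf i) ih; congr nulldefect.
by apply/funext => x; rewrite big_cons.
Qed.

(** Subtracting a null function leaves the defect unchanged, so [defect a] is the defect of
    [a - f n], at most [fourier_mass] times a squared distance that tends to 0. *)
Lemma nulldefect_cvg (f : nat -> X -> R) a : (forall n, nulldefect (f n)) -> L12 a ->
  ip mu (fun x => a x - f n x) (fun x => a x - f n x) @[n --> \oo] --> 0 ->
  nulldefect a.
Proof.
move=> zf ai fc; split=> //.
apply/eqP; rewrite eq_le (defect_ge0 (L12_L1 ai) (L12_L2 ai)) andbT.
have K : fourier_mass R * ip mu (fun x => a x - f n x) (fun x => a x - f n x)
    @[n --> \oo] --> 0.
  by rewrite -[X in _ --> X](mulr0 (fourier_mass R)); apply: cvgM => //; exact: cvg_cst.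
rewrite -(cvg_lim _ K)//; apply: limr_ge; first by apply/cvg_ex; eexists; exact: K.
apply: nearW => n.
have d_L12 : L12 (fun x => a x - f n x).
  have := L12D ai (L12Z (-1) (zf n).1).
  by under eq_fun do rewrite mulN1r.
have -> : defect a = defect (fun x => a x - f n x).
  have := defectD d_L12 (zf n).1; under eq_fun do rewrite subrK.
  by rewrite (defect2_null d_L12 (zf n)) (zf n).2 mulr0 !addr0.
rewrite /defect gerBl addr_ge0//; exact: ip_ge0.
Qed.

Lemma boxP (a b z : X) : box a b z <-> [/\ a.1 <= z.1 <= b.1,
  a.2.1.1 <= z.2.1.1 <= b.2.1.1, a.2.1.2 <= z.2.1.2 <= b.2.1.2 & a.2.2 <= z.2.2 <= b.2.2].
Proof.
by rewrite /box /= !in_itv/=; split=> [[h0 [[h1 h2] h3]]|[h0 h1 h2 h3]]; split.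
Qed.

Lemma box_empty (a b : X) : ~ box_le a b -> box a b = set0.
Proof.
move=> h; apply/seteqP; split=> // z /boxP[/andP[h0 h0'] /andP[h1 h1'] /andP[h2 h2'] /andP[h3 h3']].
apply: h; split; [exact: le_trans h0'|exact: le_trans h1'|exact: le_trans h2'|exact: le_trans h3'].
Qed.

Lemma L12_indic (A : set X) : measurable A -> (mu A < +oo)%E -> L12 (\1_A).
Proof.
move=> mA Aoo.
have i1 : L1 mu (\1_A).
  apply/integrableP; split; first by apply/measurable_EFinP; exact: measurable_indic.
  under eq_integral do rewrite /= ger0_norm//.
  rewrite (integral_indic mu measurableT mA).
  rewrite setIT.
  exact: Aoo.
split; first exact: i1.
split; first exact: (L1_measurable i1).
by rewrite sqr_indic.
Qed.

Lemma ip_indic (A : set X) : measurable A -> ip mu (\1_A) (\1_A) = fine (mu A).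
Proof.
move=> mA; rewrite /ip /Rintegral; congr fine.
rewrite -[A in RHS]setIT -integral_indic//; apply: eq_integral => x _.
by have /(congr1 (@^~ x)) /= := @sqr_indic R _ A; rewrite expr2 => ->.
Qed.

Lemma nulldefect_box (a b : X) : nulldefect (\1_(box a b)).
Proof.
have [ab|/box_empty ->] := pselect (box_le a b); last by rewrite indic0; exact: nulldefect0.
have i : L12 (\1_(box a b)).
  apply: L12_indic; first exact: measurable_box.
  by rewrite [X in (X < _)%E]mu4_box// ltry.
split=> //; rewrite /defect -Rint_FP; [|exact: L12_L1|exact: L12_L2].
rewrite Rint_powI_box// ip_indic; last exact: measurable_box.
by have /(congr1 fine) /= -> := mu4_box ab; rewrite subrr.
Qed.

Definition boxes : set (set X) := [set B | exists a b : X, B = box a b].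

Lemma boxes_setI : setI_closed boxes.
Proof.
move=> _ _ [a [b ->]] [a' [b' ->]].
exists (Num.max a.1 a'.1, ((Num.max a.2.1.1 a'.2.1.1, Num.max a.2.1.2 a'.2.1.2), Num.max a.2.2 a'.2.2)).
exists (Num.min b.1 b'.1, ((Num.min b.2.1.1 b'.2.1.1, Num.min b.2.1.2 b'.2.1.2), Num.min b.2.2 b'.2.2)).
have mm (x y z t u : R) : (Num.max x y <= z <= Num.min t u) = (x <= z <= t) && (y <= z <= u).
  by rewrite ge_max le_min; do 4 case: (_ <= _).
apply/seteqP; split=> z /=.
  move=> [/boxP[h0 h1 h2 h3] /boxP[k0 k1 k2 k3]]; apply/boxP.
  by split; rewrite mm; apply/andP.
move=> /boxP[]; rewrite !mm => /andP[? ?] /andP[? ?] /andP[? ?] /andP[? ?].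
by split; apply/boxP.
Qed.

(** A closed half-space in one coordinate is a countable union of boxes cut off at [n]; [lo x n] is
    the lower corner having [x] in the coordinate selected by [c]. *)
Lemma measurable_coord_boxes (c : X -> R) (lo : R -> nat -> X) :
  (forall x n z, box (lo x n) (diag4 n%:R) z -> x <= c z) ->
  (forall x n z, cube n%:R z -> x <= c z -> box (lo x n) (diag4 n%:R) z) ->
  measurable_fun setT (c : g_sigma_algebraType boxes -> R).
Proof.
move=> h1 h2.
apply: (measurability _ (RGenCInfty.measurableE R)) => _ [_ [x ->] <-].
rewrite setTI (_ : _ @^-1` _ = \bigcup_n box (lo x n) (diag4 n%:R)).
  apply: bigcupT_measurable => n; apply: sub_sigma_algebra.
  by exists (lo x n), (diag4 n%:R).
apply/seteqP; split=> z /=; rewrite in_itv/= andbT.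
  move=> xz; have [n /(_ n (leqnn n)) zn] := cubeT z.
  by exists n => //; exact: h2.
by move=> [n _ /h1].
Qed.

(** For the sigma-algebra generated by boxes all coordinates are measurable, hence so is the
    identity into the product; the other inclusion only needs boxes to be measurable. *)
Lemma measurable_boxesE : @measurable _ X = <<s boxes >>.
Proof.
apply/seteqP; split; last first.
  apply: smallest_sub; first exact: sigma_algebra_measurable.
  by move=> _ [a [b ->]]; exact: measurable_box.
pose T := g_sigma_algebraType boxes.
have m0 : measurable_fun setT (fun z : T => z.1 : R).
  apply: (@measurable_coord_boxes _ (fun x n => (x, ((- n%:R, - n%:R), - n%:R)))).
    by move=> x n z /boxP[/andP[]].
  by move=> x n z /boxP[/andP[_ h0] h1 h2 h3] xz; apply/boxP; split=> //; apply/andP.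
have m1 : measurable_fun setT (fun z : T => z.2.1.1 : R).
  apply: (@measurable_coord_boxes _ (fun x n => (- n%:R, ((x, - n%:R), - n%:R)))).
    by move=> x n z /boxP[_ /andP[]].
  by move=> x n z /boxP[h0 /andP[_ h1] h2 h3] xz; apply/boxP; split=> //; apply/andP.
have m2 : measurable_fun setT (fun z : T => z.2.1.2 : R).
  apply: (@measurable_coord_boxes _ (fun x n => (- n%:R, ((- n%:R, x), - n%:R)))).
    by move=> x n z /boxP[_ _ /andP[]].
  by move=> x n z /boxP[h0 h1 /andP[_ h2] h3] xz; apply/boxP; split=> //; apply/andP.
have m3 : measurable_fun setT (fun z : T => z.2.2 : R).
  apply: (@measurable_coord_boxes _ (fun x n => (- n%:R, ((- n%:R, - n%:R), x)))).
    by move=> x n z /boxP[_ _ _ /andP[]].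
  by move=> x n z /boxP[h0 h1 h2 /andP[_ h3]] xz; apply/boxP; split=> //; apply/andP.
have mid : measurable_fun setT (id : T -> X).
  exact: (measurable_X (f := id : T -> X)).
by move=> A mA; have := mid measurableT A mA; rewrite setTI preimage_id.
Qed.

End isometry.

Section dominated_ip.
Context d (T : measurableType d) (R : realType).
Variable mu : {measure set T -> \bar R}.

(** [|a - f n| <= 2 * |a|] supplies the integrable majorant [4 * a ^ 2]. *)
Lemma cvg_ip_dominated (f : nat -> T -> R) (a : T -> R) :
  (forall n, measurable_fun setT (f n)) -> L2 mu a ->
  (forall x, f n x @[n --> \oo] --> a x) -> (forall n x, `|f n x| <= `|a x|) ->
  ip mu (fun x => a x - f n x) (fun x => a x - f n x) @[n --> \oo] --> 0.
Proof.
move=> mf [ma ai] fa fle.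
have := @dominated_cvg _ T R mu setT measurableT
  (fun n x => ((a x - f n x) * (a x - f n x))%:E) (cst 0%E) (fun x => (4 * a x ^+ 2)%:E).
have m1 n : measurable_fun setT (fun x => ((a x - f n x) * (a x - f n x))%:E).
  apply/measurable_EFinP; apply: measurable_funM; exact: measurable_funB.
move=> /(_ m1) h.
have c0 x : setT x -> ((a x - f n x) * (a x - f n x))%:E @[n --> \oo] --> cst 0%E x.
  move=> _; apply: cvg_EFin; first exact: nearW.
  rewrite /= -[X in _ --> X](mulr0 0).
  have z : a x - f n x @[n --> \oo] --> 0.
    by rewrite -(subrr (a x)); apply: cvgB; [exact: cvg_cst|exact: fa].
  by apply: cvgM; exact: z.
have fn x : setT x -> (4 * a x ^+ 2)%:E \is a fin_num by [].
have {}h := h c0 fn (L1Z 4 ai).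
have {}h : (forall n x, setT x -> (`|((a x - f n x) * (a x - f n x))%:E| <= (4 * a x ^+ 2)%:E)%E) ->
  (\int[mu]_x ((a x - f n x) * (a x - f n x))%:E)%E @[n --> \oo] --> 0%E.
  by move=> k; have := h k; rewrite integral0.
have {}h := h _.
rewrite -[X in _ --> X]/(fine 0%E); apply: fine_cvg; apply: h => n x _.
rewrite abse_EFin lee_fin normrM -expr2 -(real_normK (num_real (a x))).
have : `|a x - f n x| <= 2 * `|a x|.
  by apply: (le_trans (ler_normB _ _)); rewrite mulr_natl mulr2n lerD.
have -> : 4 * `|a x| ^+ 2 = (2 * `|a x|) ^+ 2 by ring.
by move=> k; rewrite lerXn2r// nnegrE.
Qed.

End dominated_ip.

Lemma max0B (R : realType) (x : R) : Num.max x 0 - Num.max (- x) 0 = x.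
Proof. by case: (leP x 0); case: (leP (- x) 0); lra. Qed.

Section plancherel.
Context (R : realType).
Local Notation X := (spacetime R).
Local Notation mu := (@mu4 R).
Implicit Types (a b u g : X -> R).

Lemma L12_le a b : measurable_fun setT a -> (forall x, `|a x| <= `|b x|) -> L12 b -> L12 a.
Proof.
move=> ma ab [b1 [mb b2]]; split; first exact: (L1_le ma ab b1).
split=> //; apply: (L1_le _ _ b2); first exact: measurable_funX.
by move=> x; rewrite !normrX lerXn2r// nnegrE.
Qed.

Lemma nulldefect_dominated (f : nat -> X -> R) a : (forall n, nulldefect (f n)) ->
  L12 a -> (forall x, f n x @[n --> \oo] --> a x) -> (forall n x, `|f n x| <= `|a x|) ->
  nulldefect a.
Proof.
move=> zf ai fa fle; apply: (nulldefect_cvg zf ai).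
apply: (cvg_ip_dominated _ (L12_L2 ai) fa fle) => n.
exact: (L2_measurable (L12_L2 (zf n).1)).
Qed.

Lemma nulldefect_box_cube (a b : X) r : nulldefect (\1_(box a b `&` cube r)).
Proof.
have [a' [b' ->]] : boxes (box a b `&` cube r).
  by apply: boxes_setI; [exists a, b|exists (- diag4 r), (diag4 r)].
exact: nulldefect_box.
Qed.

Lemma nulldefect_cube (r : R) : nulldefect (\1_(cube r : set X)).
Proof. exact: nulldefect_box. Qed.

Lemma L12_setI_cube (A : set X) (r : R) : measurable A -> L12 (\1_(A `&` cube r)).
Proof.
move=> mA; have mC : measurable (cube r : set X) by exact: measurable_cube.
apply: (L12_le _ _ (nulldefect_cube r).1).
  by apply: measurable_indic; exact: measurableI.
move=> x; rewrite !ger0_norm// !indicE ler_nat.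
case: (boolP (x \in A `&` cube r)) => //; rewrite inE => -[_ xr].
by rewrite mem_set.
Qed.

Lemma cvg_indic_bigcup (T : Type) (F : nat -> set T) (x : T) : trivIset setT F ->
  \sum_(0 <= k < n) (\1_(F k) x : R) @[n --> \oo] --> (\1_(\bigcup_k F k) x : R).
Proof.
move=> tF; apply: cvg_near_cst.
have [[k _ Fk]|nF] := pselect ((\bigcup_k F k) x); last first.
  apply: nearW => n; rewrite [RHS]indicE memNset// big1// => i _.
  by rewrite indicE memNset// => Fi; apply: nF; exists i.
exists k.+1 => // n /= kn.
rewrite [RHS]indicE mem_set; last by exists k.
rewrite (bigD1_seq k) ?mem_index_iota ?iota_uniq//= indicE mem_set//.
rewrite big1 ?addr0// => i ik; rewrite indicE memNset// => Fi.
by move/trivIsetP : tF => /(_ i k I I ik) /seteqP[/(_ x (conj Fi Fk))].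
Qed.

Lemma sum_indic_le (T : Type) (F : nat -> set T) (x : T) n : trivIset setT F ->
  \sum_(0 <= k < n) (\1_(F k) x : R) <= (\1_(\bigcup_k F k) x : R).
Proof.
move=> tF; have c := cvg_indic_bigcup (x := x) tF.
rewrite -(cvg_lim _ c)//; apply: limr_ge; first by apply/cvg_ex; eexists; exact: c.
exists n => // m /= nm; rewrite [leRHS](big_cat_nat (leq0n n) nm)//= lerDl.
by apply: sumr_ge0.
Qed.

(** Dynkin's theorem for the pi-system of boxes. Intersecting with a cube keeps all indicators
    integrable and turns a complement into a difference of two null functions. *)
Lemma nulldefect_setI_cube (A : set X) (r : R) : measurable A -> nulldefect (\1_(A `&` cube r)).
Proof.
move=> mA; have mC : measurable (cube r : set X) by exact: measurable_cube.
pose P (A : set X) := nulldefect (\1_(A `&` cube r)).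
suff K : forall S : set X, <<s @boxes R >> S -> P S.
  by apply: K; rewrite -measurable_boxesE.
apply: (@dynkin_induction _ X); rewrite /P.
- exact: measurable_boxesE.
- exact: boxes_setI.
- by rewrite setTI; exact: nulldefect_cube.
- by move=> _ [a [b ->]]; exact: nulldefect_box_cube.
- move=> S mS zS; have := nulldefectB (nulldefect_cube r) zS; congr nulldefect.
  apply/funext => x; rewrite !indicE !in_setI in_setC.
  by case: (x \in S); case: (x \in cube r); rewrite /= ?subrr ?subr0.
- move=> F mF tF zF.
  have tG : trivIset setT (fun k => F k `&` cube r).
    by apply/trivIsetP => i j _ _ ij; move/trivIsetP : tF => /(_ i j I I ij);
      rewrite setIACA => ->; rewrite set0I.
  rewrite setI_bigcupl.
  apply: (@nulldefect_dominated (fun n x => \sum_(0 <= k < n) \1_(F k `&` cube r) x)).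
  + by move=> n; apply: nulldefect_sum => k; exact: zF.
  + by rewrite -setI_bigcupl; apply: L12_setI_cube; exact: bigcupT_measurable.
  + by move=> x; exact: cvg_indic_bigcup.
  + move=> n x; rewrite !ger0_norm//; first exact: sum_indic_le.
    exact: sumr_ge0.
Qed.

Import HBNNSimple.

Lemma nulldefect_sfun_cube (f : {nnsfun X >-> R}) (r : R) :
  nulldefect (fun x => f x * \1_(cube r) x).
Proof.
pose s := fset_set (range f).
have := @nulldefect_sum R _ (finmap.enum_fset s) (fun y x => y * \1_((f @^-1` [set y]) `&` cube r) x).
have z y : nulldefect (fun x => y * \1_((f @^-1` [set y]) `&` cube r) x).
  apply: nulldefectZ; apply: nulldefect_setI_cube.
  have mf : measurable_fun setT (f : X -> R) by [].
  by rewrite -[X in measurable X]setTI; exact: (mf measurableT _ (measurable_set1 y)).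
move=> /(_ z); congr nulldefect; apply/funext => x.
rewrite (fimfunE f x) fsbig_finite//= mulr_suml; apply: eq_bigr => y _.
rewrite -mulrA; congr (_ * _); rewrite !indicE in_setI.
by case: (_ \in _); case: (_ \in _); rewrite /= ?mulr1 ?mulr0 ?mul0r.
Qed.

(** The simple approximations are cut off by growing cubes, since indicators are known to be null
    only inside a cube; domination by [a] survives the cut. *)
Lemma nulldefect_ge0 a : L12 a -> (forall x, 0 <= a x) -> nulldefect a.
Proof.
move=> ai a0.
have ma : measurable_fun setT (EFin \o a) by apply/measurable_EFinP; exact: (L1_measurable (L12_L1 ai)).
pose g := nnsfun_approx measurableT ma.
have a0E x : setT x -> (0 <= (EFin \o a) x)%E by move=> _; rewrite lee_fin.
have ga x : (g n x : R) @[n --> \oo] --> a x.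
  have := cvg_nnsfun_approx measurableT ma a0E (x := x) I.
  by move=> /fine_cvg h; exact: h.
have gle n x : (g n x : R) <= a x.
  rewrite -(cvg_lim _ (ga x))//; apply: limr_ge; first by apply/cvg_ex; eexists; exact: ga.
  exists n => // m /= nm.
  by have /lefP := nd_nnsfun_approx measurableT ma nm; apply.
apply: (@nulldefect_dominated (fun n x => g n x * \1_(cube n%:R) x)).
- by move=> n; exact: nulldefect_sfun_cube.
- exact: ai.
- move=> x; have [n hn] := cubeT x.
  rewrite -[X in _ --> X]mulr1; apply: cvgM; first exact: ga.
  apply: cvg_near_cst; exists n => // m /= nm.
  by rewrite indicE mem_set//; exact: hn.
- move=> n x; rewrite !ger0_norm ?mulr_ge0//.
  apply: (@le_trans _ _ (g n x)); last exact: gle.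
  by rewrite ler_piMr// indicE lern1; case: (_ \in _).
Qed.

Lemma nulldefectT a : L12 a -> nulldefect a.
Proof.
move=> ai; have ma := L1_measurable (L12_L1 ai).
have p1 : nulldefect (fun x => Num.max (a x) 0).
  apply: nulldefect_ge0 => [|x]; last by rewrite le_max lexx orbT.
  apply: (L12_le _ _ ai); first exact: measurable_maxr.
  by move=> x; case: (leP (a x) 0) => ax0 //; rewrite normr0.
have p2 : nulldefect (fun x => Num.max (- a x) 0).
  apply: nulldefect_ge0 => [|x]; last by rewrite le_max lexx orbT.
  apply: (L12_le _ _ ai).
    by apply: measurable_maxr => //; exact: measurable_funN.
  by move=> x; case: (leP (- a x) 0) => ax0; rewrite ?normr0 ?normrN.
have := nulldefectB p1 p2; congr nulldefect; apply/funext => x.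
exact: max0B.
Qed.

Lemma parseval_real a b : L12 a -> L12 b ->
  ip mu (FC a) (FC b) + ip mu (FS a) (FS b) = fourier_mass R * ip mu a b.
Proof.
move=> ai bi; have /eqP := defect2_null ai (nulldefectT bi).
by rewrite subr_eq0 => /eqP.
Qed.

End plancherel.

Section L2_Lfun.
Context d (T : measurableType d) (R : realType).
Variable mu : {measure set T -> \bar R}.

Lemma Lfun2_L2 (f : T -> R) : f \in Lfun mu 2%:E -> L2 mu f.
Proof.
move=> fL; split; last exact: Lfun2_integrable_sqr.
by move: fL; rewrite inE => /andP[]; rewrite inE.
Qed.

Lemma Lnorm2_sqr (f : T -> R) : L2 mu f ->
  Lnorm mu 2%:E (EFin \o f) = (Num.sqrt (ip mu f f))%:E.
Proof.
move=> [mf fi]; rewrite unlock /Lnorm.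
have -> : (\int[mu]_x ((`|(EFin \o f) x| `^ 2)%E) = (ip mu f f)%:E)%E.
  rewrite -L1_EFin; last by move: fi; under eq_fun do rewrite expr2.
  apply: eq_integral => x _; rewrite /= powR_mulrn ?normr_ge0//.
  by rewrite -expr2 real_normK// num_real.
by rewrite poweR_EFin powR12_sqrt// ip_ge0.
Qed.

Lemma L2_Lfun2 (f : T -> R) : L2 mu f -> f \in Lfun mu 2%:E.
Proof.
move=> f2; rewrite inE; apply/andP; split; rewrite inE/=; first exact: f2.1.
by rewrite /finite_norm Lnorm2_sqr// ltry.
Qed.

End L2_Lfun.

(** * Complex functions and the L^2 transform *)

Section complex_functions.
Context (R : realType).
Local Notation X := (spacetime R).
Local Notation mu := (@mu4 R).
Implicit Types (u v w : X -> R[i]).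

Definition re u : X -> R := fun z => complex.Re (u z).
Definition im u : X -> R := fun z => complex.Im (u z).

(** The real part of the Hermitian inner product; imaginary parts are reached by multiplying one
    argument by [-i], see [mulNi]. *)
Definition cip u v : R := ip mu (re u) (re v) + ip mu (im u) (im v).

Definition cL2 u := L2 mu (re u) /\ L2 mu (im u).
Definition cL12 u := L12 (re u) /\ L12 (im u).

Lemma in_L2P u : in_L2 u <-> cL2 u.
Proof.
split=> -[h1 h2]; split.
- exact: Lfun2_L2.
- exact: Lfun2_L2.
- exact: L2_Lfun2.
- exact: L2_Lfun2.
Qed.

Lemma cL12_cL2 u : cL12 u -> cL2 u.
Proof. by move=> [[_ h1] [_ h2]]; split. Qed.

Lemma normcE (x : R[i]) : Normc.normc x = Num.sqrt (complex.Re x ^+ 2 + complex.Im x ^+ 2).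
Proof. by case: x. Qed.

Lemma cip_ge0 u : 0 <= cip u u.
Proof. by rewrite addr_ge0 ?ip_ge0. Qed.

Lemma measurable_normc u : measurable_fun setT (re u) -> measurable_fun setT (im u) ->
  measurable_fun setT (fun z => Normc.normc (u z)).
Proof.
move=> m1 m2; apply: (eq_measurable_fun (fun z => Num.sqrt (re u z ^+ 2 + im u z ^+ 2))).
  by move=> z _; rewrite normcE.
apply: measurableT_comp; last by apply: measurable_funD; exact: measurable_funX.
by apply: continuous_measurable_fun; exact: sqrt_continuous.
Qed.

Lemma normc_sqr u z : Normc.normc (u z) ^+ 2 = re u z ^+ 2 + im u z ^+ 2.
Proof. by rewrite normcE sqr_sqrtr// addr_ge0 ?sqr_ge0. Qed.

Lemma L2_normc u : cL2 u -> L2 mu (fun z => Normc.normc (u z)).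
Proof.
move=> [[m1 i1] [m2 i2]]; split; first exact: measurable_normc.
by under eq_fun do rewrite normc_sqr; exact: L1D.
Qed.

Lemma ip_normc u : cL2 u ->
  ip mu (fun z => Normc.normc (u z)) (fun z => Normc.normc (u z)) = cip u u.
Proof.
move=> [[m1 i1] [m2 i2]]; rewrite /cip /ip.
under eq_Rintegral do rewrite -expr2 normc_sqr.
rewrite (Rint_D i1 i2).
by under eq_Rintegral do rewrite expr2; under [X in _ + X]eq_Rintegral do rewrite expr2.
Qed.

Lemma L2normE u : cL2 u -> L2norm u = (Num.sqrt (cip u u))%:E.
Proof. by move=> u2; rewrite /L2norm -ip_normc// -Lnorm2_sqr//; exact: L2_normc. Qed.

Lemma re_fourierL1 u zeta : L1 mu (re u) -> L1 mu (im u) ->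
  re (fourierL1 u) zeta = FC (re u) zeta + FS (im u) zeta.
Proof.
move=> i1 i2; rewrite -[RHS]Rint_D.
- by apply: eq_Rintegral => z _; rewrite /re /im /expNi; case: (u z) => a b /=; ring.
- exact: L1_cos (measurable_dot4l zeta).
- exact: L1_sin (measurable_dot4l zeta).
Qed.

Lemma im_fourierL1 u zeta : L1 mu (re u) -> L1 mu (im u) ->
  im (fourierL1 u) zeta = FC (im u) zeta - FS (re u) zeta.
Proof.
move=> i1 i2; rewrite -[RHS]Rint_B.
- by apply: eq_Rintegral => z _; rewrite /re /im /expNi; case: (u z) => a b /=; ring.
- exact: L1_cos (measurable_dot4l zeta).
- exact: L1_sin (measurable_dot4l zeta).
Qed.

End complex_functions.

Lemma oppr_self_eq0 (R : realType) (x : R) : - x = x -> x = 0.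
Proof. by lra. Qed.

Section ip_expansion.
Context d (T : measurableType d) (R : realType).
Variable mu : {measure set T -> \bar R}.
Variables f g h k : T -> R.
Hypotheses (fi : L2 mu f) (gi : L2 mu g) (hi : L2 mu h) (ki : L2 mu k).

Lemma ipDD2 : ip mu (fun x => f x + g x) (fun x => h x + k x) =
  ip mu f h + ip mu f k + ip mu g h + ip mu g k.
Proof.
rewrite (ipDl fi gi (L2D hi ki)) !(ipC _ _ (fun x => h x + k x)).
rewrite (ipDl hi ki fi) (ipDl hi ki gi) !(ipC _ h) !(ipC _ k).
by ring.
Qed.

Lemma ipBB2 : ip mu (fun x => f x - g x) (fun x => h x - k x) =
  ip mu f h - ip mu f k - ip mu g h + ip mu g k.
Proof.
rewrite (ipBl fi gi (L2B hi ki)) !(ipC _ _ (fun x => h x - k x)).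
rewrite (ipBl hi ki fi) (ipBl hi ki gi) !(ipC _ h) !(ipC _ k).
by ring.
Qed.

End ip_expansion.

Section parseval_complex.
Context (R : realType).
Local Notation X := (spacetime R).
Local Notation mu := (@mu4 R).
Implicit Types (u v w : X -> R[i]) (a b : X -> R).

Lemma dot4Nr (x y : X) : dot4 x (- y) = - dot4 x y.
Proof. by rewrite /dot4 /dot3 /=; ring. Qed.

Lemma FCN a zeta : FC a (- zeta) = FC a zeta.
Proof. by apply: eq_Rintegral => z _; rewrite dot4Nr cosN. Qed.

Lemma FSN a zeta : L1 mu a -> FS a (- zeta) = - FS a zeta.
Proof.
move=> ai; rewrite -[RHS]Rint_N; last exact: L1_sin (measurable_dot4l zeta).
by apply: eq_Rintegral => z _; rewrite dot4Nr sinN mulrN.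
Qed.

Lemma ip_even_odd (f g : X -> R) : L2 mu f -> L2 mu g -> (forall z, f (- z) = f z) ->
  (forall z, g (- z) = - g z) -> ip mu f g = 0.
Proof.
move=> f2 g2 fe go; have fgi := L2_L1 f2 g2.
have := Rintegral_mpres (@mpres_mu4N R) (L1_measurable fgi).
under eq_Rintegral do rewrite fe go mulrN.
rewrite Rint_N// -/(ip mu f g) => h.
exact: oppr_self_eq0 h.
Qed.

(** A cosine transform is even and a sine transform is odd. This kills the cross terms when real and
    imaginary parts are combined in [parseval_pair]. *)
Lemma ip_FC_FS a b : L12 a -> L12 b -> ip mu (FC a) (FS b) = 0.
Proof.
move=> ai bi; apply: ip_even_odd.
- exact: L12_FC.
- exact: L12_FS.
- exact: FCN.
- by move=> z; apply: FSN; exact: L12_L1.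
Qed.

(* [F1 a b + i F2 a b] is the Fourier transform of [a + i b]. *)
Definition F1 a b : X -> R := fun z => FC a z + FS b z.
Definition F2 a b : X -> R := fun z => FC b z - FS a z.

Lemma L2_F1 a b : L12 a -> L12 b -> L2 mu (F1 a b).
Proof. by move=> ai bi; apply: L2D; [exact: L12_FC|exact: L12_FS]. Qed.

Lemma L2_F2 a b : L12 a -> L12 b -> L2 mu (F2 a b).
Proof. by move=> ai bi; apply: L2B; [exact: L12_FC|exact: L12_FS]. Qed.

Lemma parseval_pair a b a' b' : L12 a -> L12 b -> L12 a' -> L12 b' ->
  ip mu (F1 a b) (F1 a' b') + ip mu (F2 a b) (F2 a' b') =
  fourier_mass R * (ip mu a a' + ip mu b b').
Proof.
move=> ai bi ai' bi'.
rewrite mulrDr -parseval_real// -parseval_real//.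
have := ip_FC_FS ai bi'; have := ip_FC_FS ai' bi.
have := ip_FC_FS bi ai'; have := ip_FC_FS bi' ai.
rewrite /F1 /F2.
move: (FC a) (FS a) (FC b) (FS b) (L12_FC ai) (L12_FS ai) (L12_FC bi) (L12_FS bi).
move: (FC a') (FS a') (FC b') (FS b') (L12_FC ai') (L12_FS ai') (L12_FC bi') (L12_FS bi').
move=> A B C D iA iB iC iD A' B' C' D' iA' iB' iC' iD' e1 e2 e3 e4.
rewrite (ipDD2 iA' iD' iA iD) (ipBB2 iC' iB' iC iB).
by rewrite e2 e4 (ipC _ D' A) e3 (ipC _ B' C) e1; ring.
Qed.

Lemma F1_E u zeta : cL12 u -> re (fourierL1 u) zeta = F1 (re u) (im u) zeta.
Proof. by move=> [h1 h2]; exact: re_fourierL1 (L12_L1 h1) (L12_L1 h2). Qed.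

Lemma F2_E u zeta : cL12 u -> im (fourierL1 u) zeta = F2 (re u) (im u) zeta.
Proof. by move=> [h1 h2]; exact: im_fourierL1 (L12_L1 h1) (L12_L1 h2). Qed.

Lemma re_fourierL1_F1 u : cL12 u -> re (fourierL1 u) = F1 (re u) (im u).
Proof. by move=> h; apply/funext => z; exact: F1_E. Qed.

Lemma im_fourierL1_F2 u : cL12 u -> im (fourierL1 u) = F2 (re u) (im u).
Proof. by move=> h; apply/funext => z; exact: F2_E. Qed.

Lemma cL2_fourierL1 u : cL12 u -> cL2 (fourierL1 u).
Proof.
move=> h; have [h1 h2] := h; split.
  by rewrite re_fourierL1_F1//; exact: L2_F1.
by rewrite im_fourierL1_F2//; exact: L2_F2.
Qed.

Lemma parseval_fourierL1 u v : cL12 u -> cL12 v ->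
  cip (fourierL1 u) (fourierL1 v) = fourier_mass R * cip u v.
Proof.
move=> hu hv; rewrite /cip !re_fourierL1_F1// !im_fourierL1_F2//.
exact: parseval_pair hu.1 hu.2 hv.1 hv.2.
Qed.

Definition ball4 (n : nat) : set X := [set z | norm4 z <= n%:R].

Lemma measurable_norm4 : measurable_fun setT (@norm4 R).
Proof.
apply: measurableT_comp; last by apply: measurable_dot4; exact: measurable_id.
by apply: continuous_measurable_fun; exact: sqrt_continuous.
Qed.

Lemma measurable_ball4 n : measurable (ball4 n).
Proof.
rewrite -[X in measurable X]setTI.
rewrite (_ : ball4 n = (@norm4 R) @^-1` `]-oo, n%:R]%classic); last first.
  by apply/seteqP; split=> z /=; rewrite in_itv.
by apply: measurable_norm4 => //; exact: measurable_itv.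
Qed.

Lemma ball4_cube n : ball4 n `<=` cube n%:R.
Proof.
move=> z; rewrite /ball4 /= => zn; apply/cubeP.
have k (x : R) : x ^+ 2 <= dot4 z z -> `|x| <= n%:R.
  by move=> h; apply: le_trans zn; rewrite /norm4 -sqrtr_sqr ler_wsqrtr.
move: k; rewrite /dot4 /dot3 -!expr2.
have := sqr_ge0 z.1; have := sqr_ge0 z.2.1.1.
have := sqr_ge0 z.2.1.2; have := sqr_ge0 z.2.2.
move: (z.1) (z.2.1.1) (z.2.1.2) (z.2.2) => {zn} x y t w hw ht hy hx k.
by split; apply: k; lra.
Qed.

Lemma re_trunc_ball n u z : re (trunc_ball n u) z = \1_(ball4 n) z * re u z.
Proof.
rewrite /re /trunc_ball indicE; case: ifPn => zn.
  by rewrite mem_set ?mul1r.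
by rewrite memNset ?mul0r//; exact/negP.
Qed.

Lemma im_trunc_ball n u z : im (trunc_ball n u) z = \1_(ball4 n) z * im u z.
Proof.
rewrite /im /trunc_ball indicE; case: ifPn => zn.
  by rewrite mem_set ?mul1r.
by rewrite memNset ?mul0r//; exact/negP.
Qed.

Lemma L12_indicM (A : set X) a : measurable A -> (mu A < +oo)%E -> L2 mu a ->
  L12 (fun z => \1_A z * a z).
Proof.
move=> mA Aoo a2; have A2 := L12_indic mA Aoo.
split; first exact: L2_L1 (L12_L2 A2) a2.
have [ma ai] := a2.
have mAa : measurable_fun setT (fun z => \1_A z * a z).
  exact: (measurable_funM (L2_measurable (L12_L2 A2)) ma).
split; first exact: mAa.
apply: (L1_le _ _ ai); first exact: measurable_funX.
move=> z; rewrite !normrX lerXn2r ?nnegrE// normrM ler_piMl//.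
by rewrite ger0_norm// indicE lern1; case: (z \in A).
Qed.

Lemma mu4_ball4_lty n : (mu (ball4 n) < +oo)%E.
Proof.
have h : (mu (ball4 n) <= mu (cube n%:R))%E.
  apply: le_measure; rewrite ?inE; [exact: measurable_ball4|exact: measurable_cube|].
  exact: ball4_cube.
by apply: (le_lt_trans h); rewrite [X in (X < _)%E]mu4_cube// ltry.
Qed.

Lemma cL12_trunc_ball n u : cL2 u -> cL12 (trunc_ball n u).
Proof.
move=> [h1 h2]; have mB := measurable_ball4 n; have Boo := mu4_ball4_lty n.
split.
  by rewrite (_ : re _ = fun z => \1_(ball4 n) z * re u z);
    [exact: L12_indicM|apply/funext => z; exact: re_trunc_ball].
by rewrite (_ : im _ = fun z => \1_(ball4 n) z * im u z);
  [exact: L12_indicM|apply/funext => z; exact: im_trunc_ball].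
Qed.

Lemma ball4T (z : X) : exists n, forall m, (n <= m)%N -> ball4 m z.
Proof.
exists (Num.truncn (norm4 z)).+1 => m nm; rewrite /ball4 /=.
by apply: (le_trans (ltW (truncnS_gt _))); rewrite ler_nat.
Qed.

Lemma cvg_ip_ball4 a : L2 mu a ->
  ip mu (fun z => \1_(ball4 n) z * a z - a z) (fun z => \1_(ball4 n) z * a z - a z)
    @[n --> \oo] --> 0.
Proof.
move=> a2.
have h := @cvg_ip_dominated _ _ _ mu (fun n z => \1_(ball4 n) z * a z) a.
have {}h : ip mu (fun z => a z - \1_(ball4 n) z * a z) (fun z => a z - \1_(ball4 n) z * a z)
    @[n --> \oo] --> 0.
  apply: h => //.
  - move=> n; apply: measurable_funM; last exact: (L2_measurable a2).
    by apply: measurable_indic; exact: measurable_ball4.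
  - move=> z; apply: cvg_near_cst; have [n hn] := ball4T z; exists n => // m /= nm.
    by rewrite indicE mem_set ?mul1r//; exact: hn.
  - move=> n z; rewrite normrM ler_piMl// ger0_norm// indicE lern1 leq_b1.
rewrite (_ : (fun n => _) = (fun n => ip mu (fun z => a z - \1_(ball4 n) z * a z)
    (fun z => a z - \1_(ball4 n) z * a z)))//.
by apply/funext => n; apply: eq_Rintegral => z _; rewrite -!expr2 -sqrrN opprB.
Qed.

Lemma cvg_trunc_ball u : cL2 u ->
  ip mu (fun z => re (trunc_ball n u) z - re u z) (fun z => re (trunc_ball n u) z - re u z)
    @[n --> \oo] --> 0 /\
  ip mu (fun z => im (trunc_ball n u) z - im u z) (fun z => im (trunc_ball n u) z - im u z)
    @[n --> \oo] --> 0.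
Proof.
move=> [h1 h2]; split.
  have := cvg_ip_ball4 h1; rewrite -(eq_cvg _ _ (f := fun n => ip mu
    (fun z => re (trunc_ball n u) z - re u z) (fun z => re (trunc_ball n u) z - re u z)))// => n.
  by apply: eq_Rintegral => z _; rewrite re_trunc_ball.
have := cvg_ip_ball4 h2; rewrite -(eq_cvg _ _ (f := fun n => ip mu
  (fun z => im (trunc_ball n u) z - im u z) (fun z => im (trunc_ball n u) z - im u z)))// => n.
by apply: eq_Rintegral => z _; rewrite im_trunc_ball.
Qed.

Lemma re_sub u v z : re (fun z => u z - v z) z = re u z - re v z.
Proof. by rewrite /re; case: (u z) (v z) => ? ? [? ?]. Qed.

Lemma im_sub u v z : im (fun z => u z - v z) z = im u z - im v z.
Proof. by rewrite /im; case: (u z) (v z) => ? ? [? ?]. Qed.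

Lemma cL2B u v : cL2 u -> cL2 v -> cL2 (fun z => u z - v z).
Proof.
move=> [u1 u2] [v1 v2]; split.
  by rewrite (_ : re _ = fun z => re u z - re v z); [exact: L2B|apply/funext => z; exact: re_sub].
by rewrite (_ : im _ = fun z => im u z - im v z); [exact: L2B|apply/funext => z; exact: im_sub].
Qed.

Lemma cvg_L2normP (f : nat -> X -> R[i]) v : (forall n, cL2 (f n)) -> cL2 v ->
  (L2norm (fun z => f n z - v z) @[n --> \oo] --> 0%E) <->
  (cip (fun z => f n z - v z) (fun z => f n z - v z) @[n --> \oo] --> 0).
Proof.
move=> fi vi; have fvi n := cL2B (fi n) vi.
rewrite (_ : (fun n => L2norm _) = (fun n => (Num.sqrt
   (cip (fun z => f n z - v z) (fun z => f n z - v z)))%:E)); last first.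
  by apply/funext => n; exact: L2normE.
split=> h.
  have {}h : Num.sqrt (cip (fun z => f n z - v z) (fun z => f n z - v z)) @[n --> \oo] --> 0.
    by move: h => /fine_cvg h; exact: h.
  rewrite (_ : (fun n => _) = (fun n => Num.sqrt (cip (fun z => f n z - v z) (fun z => f n z - v z)) *
     Num.sqrt (cip (fun z => f n z - v z) (fun z => f n z - v z)))).
    by rewrite -[X in _ --> X](mulr0 0); apply: cvgM; exact: h.
  by apply/funext => n; rewrite -expr2 sqr_sqrtr// cip_ge0.
apply: cvg_EFin; first exact: nearW.
rewrite -[X in _ --> X](@sqrtr0 R).
exact: (cvg_comp _ _ h (@sqrt_continuous R 0)).
Qed.

Lemma cvg_cip0 (f : nat -> X -> R[i]) v : (forall n, cL2 (f n)) -> cL2 v ->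
  cip (fun z => f n z - v z) (fun z => f n z - v z) @[n --> \oo] --> 0 ->
  ip mu (fun z => re (f n) z - re v z) (fun z => re (f n) z - re v z) @[n --> \oo] --> 0 /\
  ip mu (fun z => im (f n) z - im v z) (fun z => im (f n) z - im v z) @[n --> \oo] --> 0.
Proof.
move=> fi vi h.
have E1 n : ip mu (fun z => re (f n) z - re v z) (fun z => re (f n) z - re v z) =
    ip mu (re (fun z => f n z - v z)) (re (fun z => f n z - v z)).
  by apply: eq_Rintegral => z _; rewrite re_sub.
have E2 n : ip mu (fun z => im (f n) z - im v z) (fun z => im (f n) z - im v z) =
    ip mu (im (fun z => f n z - v z)) (im (fun z => f n z - v z)).
  by apply: eq_Rintegral => z _; rewrite im_sub.
split; apply: (squeeze_cvgr _ (cvg_cst 0) h); apply: nearW => n.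
  by rewrite ip_ge0 E1 /cip lerDl ip_ge0.
by rewrite ip_ge0 E2 /cip lerDr ip_ge0.
Qed.

Lemma cvg_cip (f g : nat -> X -> R[i]) v w :
  (forall n, cL2 (f n)) -> (forall n, cL2 (g n)) -> cL2 v -> cL2 w ->
  cip (fun z => f n z - v z) (fun z => f n z - v z) @[n --> \oo] --> 0 ->
  cip (fun z => g n z - w z) (fun z => g n z - w z) @[n --> \oo] --> 0 ->
  cip (f n) (g n) @[n --> \oo] --> cip v w.
Proof.
move=> fi gi vi wi /(cvg_cip0 fi vi)[f1 f2] /(cvg_cip0 gi wi)[g1 g2].
apply: cvgD.
  exact: (cvg_ip (fun n => (fi n).1) (fun n => (gi n).1) vi.1 wi.1 f1 g1).
exact: (cvg_ip (fun n => (fi n).2) (fun n => (gi n).2) vi.2 wi.2 f2 g2).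
Qed.

Lemma cvg_cip_trunc_ball u : cL2 u ->
  cip (fun z => trunc_ball n u z - u z) (fun z => trunc_ball n u z - u z) @[n --> \oo] --> 0.
Proof.
move=> u2; have [h1 h2] := cvg_trunc_ball u2.
rewrite -[X in _ --> X](addr0 0); apply: cvgD.
  rewrite (eq_cvg _ _ (g := fun n => ip mu
    (fun z => re (trunc_ball n u) z - re u z) (fun z => re (trunc_ball n u) z - re u z)))// => n.
  by apply: eq_Rintegral => z _; rewrite re_sub.
rewrite (eq_cvg _ _ (g := fun n => ip mu
  (fun z => im (trunc_ball n u) z - im u z) (fun z => im (trunc_ball n u) z - im u z)))// => n.
by apply: eq_Rintegral => z _; rewrite im_sub.
Qed.

Lemma fourierL2P u v : is_fourierL2 u v <-> [/\ cL2 u, cL2 v &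
  cip (fun zeta => fourierL1 (trunc_ball n u) zeta - v zeta)
      (fun zeta => fourierL1 (trunc_ball n u) zeta - v zeta) @[n --> \oo] --> 0].
Proof.
have k : cL2 u -> forall n, cL2 (fourierL1 (trunc_ball n u)).
  by move=> u2 n; apply/cL2_fourierL1/cL12_trunc_ball.
split=> [[/in_L2P u2 /in_L2P v2 h]|[u2 v2 h]].
  by split; [exact: u2|exact: v2|exact/(cvg_L2normP (k u2) v2)].
by split; [exact/in_L2P|exact/in_L2P|exact/(cvg_L2normP (k u2) v2)].
Qed.

(** The identity holds for the truncations to balls, and both sides pass to the limit. The polarized
    form, for two functions, is what the product formula requires. *)
Lemma parseval_fourierL2 u v u' v' : is_fourierL2 u v -> is_fourierL2 u' v' ->
  cip v v' = fourier_mass R * cip u u'.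
Proof.
move=> /fourierL2P[u2 v2 h] /fourierL2P[u2' v2' h'].
have t n := cL12_trunc_ball n u2; have t' n := cL12_trunc_ball n u2'.
have c1 := cvg_cip (fun n => cL2_fourierL1 (t n)) (fun n => cL2_fourierL1 (t' n)) v2 v2' h h'.
have c2 := cvg_cip (fun n => cL12_cL2 (t n)) (fun n => cL12_cL2 (t' n)) u2 u2'
  (cvg_cip_trunc_ball u2) (cvg_cip_trunc_ball u2').
have c3 : fourier_mass R * cip (trunc_ball n u) (trunc_ball n u') @[n --> \oo] -->
    fourier_mass R * cip u u'.
  by apply: cvgM; [exact: cvg_cst|exact: c2].
have E n : cip (fourierL1 (trunc_ball n u)) (fourierL1 (trunc_ball n u')) =
    fourier_mass R * cip (trunc_ball n u) (trunc_ball n u').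
  exact: parseval_fourierL1.
rewrite (eq_cvg _ _ E) in c1.
exact: (cvg_unique _ c1 c3).
Qed.

End parseval_complex.

Lemma addr_normc_le (R : realType) (a b c d : R) :
  `|a * c + b * d| <= Num.sqrt (a ^+ 2 + b ^+ 2) * Num.sqrt (c ^+ 2 + d ^+ 2).
Proof.
rewrite -sqrtrM ?addr_ge0 ?sqr_ge0// -sqrtr_sqr ler_wsqrtr//.
rewrite -subr_ge0 (_ : _ - _ = (a * d - b * c) ^+ 2) ?sqr_ge0//; ring.
Qed.

(** * The transform of a product *)

Section product.
Context (R : realType).
Local Notation X := (spacetime R).
Local Notation mu := (@mu4 R).
Implicit Types (u v w : X -> R[i]) (a b : X -> R) (zeta : X).

Lemma L2_mpres (f : X -> R) phi : mpres mu mu phi -> L2 mu f -> L2 mu (fun z => f (phi z)).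
Proof.
move=> pm [mf fi]; split; first exact: (measurableT_comp mf pm.1).
exact: (integrable_mpres pm fi).
Qed.

Lemma ip_mpres (f g : X -> R) phi : mpres mu mu phi -> L2 mu f -> L2 mu g ->
  ip mu (fun z => f (phi z)) (fun z => g (phi z)) = ip mu f g.
Proof. by move=> pm f2 g2; exact: (Rintegral_mpres pm (L1_measurable (L2_L1 f2 g2))). Qed.

Lemma L2_cos a (ph : X -> R) : L2 mu a -> measurable_fun setT ph ->
  L2 mu (fun z => a z * cos (ph z)).
Proof.
move=> [ma ai] mph.
have m : measurable_fun setT (fun z => a z * cos (ph z)).
  by apply: measurable_funM => //; apply: measurableT_comp => //; exact: measurable_cosR.
split=> //; apply: (L1_le _ _ ai); first exact: measurable_funX.
by move=> z; rewrite !normrX lerXn2r ?nnegrE// normrM ler_piMr// cos_max.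
Qed.

Lemma L2_sin a (ph : X -> R) : L2 mu a -> measurable_fun setT ph ->
  L2 mu (fun z => a z * sin (ph z)).
Proof.
move=> [ma ai] mph.
have m : measurable_fun setT (fun z => a z * sin (ph z)).
  by apply: measurable_funM => //; apply: measurableT_comp => //; exact: measurable_sinR.
split=> //; apply: (L1_le _ _ ai); first exact: measurable_funX.
by move=> z; rewrite !normrX lerXn2r ?nnegrE// normrM ler_piMr// sin_max.
Qed.

(* Conjugate of the modulation of [u]; its transform is [conj_refl]. *)
Definition conj_mod zeta u : X -> R[i] := fun z =>
  complex.Re (expNi (dot4 z zeta) * u z) -i* complex.Im (expNi (dot4 z zeta) * u z).

Definition conj_refl zeta v : X -> R[i] := fun eta =>
  complex.Re (v (zeta - eta)) -i* complex.Im (v (zeta - eta)).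

Lemma re_conj_mod zeta u z : re (conj_mod zeta u) z =
  re u z * cos (dot4 z zeta) + im u z * sin (dot4 z zeta).
Proof. by rewrite /re /im /conj_mod /expNi; case: (u z) => a b /=; ring. Qed.

Lemma im_conj_mod zeta u z : im (conj_mod zeta u) z =
  re u z * sin (dot4 z zeta) - im u z * cos (dot4 z zeta).
Proof. by rewrite /re /im /conj_mod /expNi; case: (u z) => a b /=; ring. Qed.

Lemma cL2_conj_mod zeta u : cL2 u -> cL2 (conj_mod zeta u).
Proof.
move=> [u1 u2]; have m := measurable_dot4l zeta; split.
  rewrite (_ : re _ = fun z => re u z * cos (dot4 z zeta) + im u z * sin (dot4 z zeta)).
    by apply: L2D; [exact: L2_cos|exact: L2_sin].
  by apply/funext => z; exact: re_conj_mod.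
rewrite (_ : im _ = fun z => re u z * sin (dot4 z zeta) - im u z * cos (dot4 z zeta)).
  by apply: L2B; [exact: L2_sin|exact: L2_cos].
by apply/funext => z; exact: im_conj_mod.
Qed.

Lemma cL2_conj_refl zeta v : cL2 v -> cL2 (conj_refl zeta v).
Proof.
move=> [v1 v2]; have pm := mpres_mu4rB zeta; split.
  exact: (L2_mpres pm v1).
exact: (L2N (L2_mpres pm v2)).
Qed.

Lemma cip_conj_refl zeta v : cL2 v ->
  cip (conj_refl zeta v) (conj_refl zeta v) = cip v v.
Proof.
move=> [v1 v2]; have pm := mpres_mu4rB zeta.
congr (_ + _); first exact: (ip_mpres pm v1 v1).
rewrite -(ip_mpres pm v2 v2); apply: eq_Rintegral => z _.
by rewrite /im /conj_refl /= mulrNN.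
Qed.

Lemma trunc_conj_mod zeta u n :
  trunc_ball n (conj_mod zeta u) = conj_mod zeta (trunc_ball n u).
Proof.
apply/funext => z; rewrite /trunc_ball /conj_mod; case: ifP => // _.
by rewrite mulr0 /= oppr0.
Qed.

Lemma fourierL1_conj_mod zeta u eta : cL12 u ->
  fourierL1 (conj_mod zeta u) eta = conj_refl zeta (fourierL1 u) eta.
Proof.
move=> [[u1 _] [u2 _]]; rewrite /fourierL1 /conj_refl /cintegral /=; congr (_ +i* _).
  apply: eq_Rintegral => z _; rewrite dot4Br /expNi cosB sinB /conj_mod /expNi.
  by case: (u z) => a b /=; ring.
rewrite -Rint_N.
  apply: eq_Rintegral => z _; rewrite dot4Br /expNi cosB sinB /conj_mod /expNi.
  by case: (u z) => a b /=; ring.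
have m := measurable_dot4l (zeta - eta).
have := L1B (L1_cos u2 m) (L1_sin u1 m).
by apply: eq_integrable => // z _ /=; congr EFin; rewrite /re /im /expNi; case: (u z) => a b /=; ring.
Qed.

Lemma fourierL2_conj_mod zeta u v : is_fourierL2 u v ->
  is_fourierL2 (conj_mod zeta u) (conj_refl zeta v).
Proof.
move=> /fourierL2P[u2 v2 h]; apply/fourierL2P; split.
- exact: cL2_conj_mod.
- exact: cL2_conj_refl.
move: h; rewrite (eq_cvg _ _ (g := fun n => cip
  (fun eta => fourierL1 (trunc_ball n (conj_mod zeta u)) eta - conj_refl zeta v eta)
  (fun eta => fourierL1 (trunc_ball n (conj_mod zeta u)) eta - conj_refl zeta v eta)))// => n.
have t := cL12_trunc_ball n u2.
rewrite -(cip_conj_refl zeta (cL2B (cL2_fourierL1 t) v2)).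
suff -> : conj_refl zeta (fun eta => fourierL1 (trunc_ball n u) eta - v eta) =
  (fun eta => fourierL1 (trunc_ball n (conj_mod zeta u)) eta - conj_refl zeta v eta) by [].
apply/funext => eta; rewrite trunc_conj_mod (fourierL1_conj_mod _ _ t) /conj_refl.
by case: (fourierL1 _ _) (v _) => a b [c d] /=; congr (_ +i* _); ring.
Qed.

(** Multiplication by [-i]. Since [Im x = Re (- i x)], it lets the real form [cip] capture imaginary
    parts as well. *)
Definition mulNi u : X -> R[i] := fun z => complex.Im (u z) -i* complex.Re (u z).

Lemma cL2_mulNi u : cL2 u -> cL2 (mulNi u).
Proof. by move=> [u1 u2]; split; [exact: u2|exact: (L2N u1)]. Qed.

Lemma cip_mulNi u : cL2 u -> cip (mulNi u) (mulNi u) = cip u u.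
Proof.
move=> [u1 u2]; rewrite /cip addrC; congr (_ + _).
by apply: eq_Rintegral => z _; rewrite /im /mulNi /= mulrNN.
Qed.

Lemma trunc_mulNi u n : trunc_ball n (mulNi u) = mulNi (trunc_ball n u).
Proof.
by apply/funext => z; rewrite /trunc_ball /mulNi; case: ifP => // _ /=; rewrite oppr0.
Qed.

Lemma fourierL1_mulNi u eta : cL12 u -> fourierL1 (mulNi u) eta = mulNi (fourierL1 u) eta.
Proof.
move=> [[u1 _] [u2 _]]; have m := measurable_dot4l eta.
rewrite /fourierL1 /mulNi /cintegral /=; congr (_ +i* _).
  by apply: eq_Rintegral => z _; rewrite /expNi; case: (u z) => a b /=; ring.
rewrite -Rint_N.
  by apply: eq_Rintegral => z _; rewrite /expNi; case: (u z) => a b /=; ring.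
have := L1D (L1_cos u1 m) (L1_sin u2 m).
by apply: eq_integrable => // z _ /=; congr EFin; rewrite /re /im /expNi; case: (u z) => a b /=; ring.
Qed.

Lemma fourierL2_mulNi u v : is_fourierL2 u v -> is_fourierL2 (mulNi u) (mulNi v).
Proof.
move=> /fourierL2P[u2 v2 h]; apply/fourierL2P; split.
- exact: cL2_mulNi.
- exact: cL2_mulNi.
move: h; rewrite (eq_cvg _ _ (g := fun n => cip
  (fun eta => fourierL1 (trunc_ball n (mulNi u)) eta - mulNi v eta)
  (fun eta => fourierL1 (trunc_ball n (mulNi u)) eta - mulNi v eta)))// => n.
have t := cL12_trunc_ball n u2.
rewrite -(cip_mulNi (cL2B (cL2_fourierL1 t) v2)).
suff -> : mulNi (fun eta => fourierL1 (trunc_ball n u) eta - v eta) =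
  (fun eta => fourierL1 (trunc_ball n (mulNi u)) eta - mulNi v eta) by [].
apply/funext => eta; rewrite trunc_mulNi (fourierL1_mulNi _ t) /mulNi.
by case: (fourierL1 _ _) (v _) => a b [c d] /=; congr (_ +i* _); ring.
Qed.

(** At a fixed frequency the transform of a product is an inner product of [u] with a modulated
    conjugate of [v], so Parseval applies pointwise in [zeta]. *)
Lemma re_fourierL1_mul u v zeta : cL2 u -> cL2 v ->
  re (fourierL1 (fun z => u z * v z)) zeta = cip u (conj_mod zeta v).
Proof.
move=> u2 v2; have [w1 w2] := cL2_conj_mod zeta v2.
rewrite -[RHS](Rint_D (L2_L1 u2.1 w1) (L2_L1 u2.2 w2)).
apply: eq_Rintegral => z _; rewrite /re /im /conj_mod /expNi.
by case: (u z) (v z) => a b [c d] /=; ring.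
Qed.

Lemma im_fourierL1_mul u v zeta : cL2 u -> cL2 v ->
  im (fourierL1 (fun z => u z * v z)) zeta = cip (mulNi u) (conj_mod zeta v).
Proof.
move=> u2 v2; have [w1 w2] := cL2_conj_mod zeta v2; have [n1 n2] := cL2_mulNi u2.
rewrite -[RHS](Rint_D (L2_L1 n1 w1) (L2_L1 n2 w2)).
apply: eq_Rintegral => z _; rewrite /re /im /conj_mod /mulNi /expNi.
by case: (u z) (v z) => a b [c d] /=; ring.
Qed.

Definition nconv u v zeta : R :=
  \int[mu]_eta (Normc.normc (u eta) * Normc.normc (v (zeta - eta))).

Lemma norm_cip_le u v : cL2 u -> cL2 v ->
  `|cip u v| <= \int[mu]_z (Normc.normc (u z) * Normc.normc (v z)).
Proof.
move=> u2 v2; have i1 := L2_L1 u2.1 v2.1; have i2 := L2_L1 u2.2 v2.2.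
rewrite /cip -(Rint_D i1 i2); apply: (le_trans (le_normr_Rintegral measurableT (L1D i1 i2))).
apply: le_Rintegral => //.
- exact: L1_norm (L1D i1 i2).
- exact: L2_L1 (L2_normc u2) (L2_normc v2).
by move=> z _; rewrite !normcE; exact: addr_normc_le.
Qed.

Lemma normc_mulNi u z : Normc.normc (mulNi u z) = Normc.normc (u z).
Proof. by rewrite !normcE /mulNi /= sqrrN addrC. Qed.

Lemma normc_conj_refl zeta v z : Normc.normc (conj_refl zeta v z) = Normc.normc (v (zeta - z)).
Proof. by rewrite !normcE /conj_refl /= sqrrN. Qed.

(* [F(u u') = c^-1 F u * F u'] with absolute values inside the convolution; the
   factor 2 comes from bounding real and imaginary parts separately. *)
Lemma normc_fourierL1_mul u v u' v' zeta : is_fourierL2 u v -> is_fourierL2 u' v' ->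
  Normc.normc (fourierL1 (fun z => u z * u' z) zeta) <= 2 / fourier_mass R * nconv v v' zeta.
Proof.
move=> F F'; have c0 := fourier_mass_gt0 R.
have /fourierL2P[u2 v2 _] := F; have /fourierL2P[u2' v2' _] := F'.
have G := fourierL2_conj_mod zeta F'; have w2 := cL2_conj_refl zeta v2'.
have E1 : `|re (fourierL1 (fun z => u z * u' z)) zeta| <= (fourier_mass R)^-1 * nconv v v' zeta.
  rewrite re_fourierL1_mul// ler_pdivlMl// -{1}(gtr0_norm c0) -normrM -(parseval_fourierL2 F G).
  apply: (le_trans (norm_cip_le v2 w2)).
  by under eq_Rintegral do rewrite normc_conj_refl.
have E2 : `|im (fourierL1 (fun z => u z * u' z)) zeta| <= (fourier_mass R)^-1 * nconv v v' zeta.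
  rewrite im_fourierL1_mul// ler_pdivlMl// -{1}(gtr0_norm c0) -normrM.
  rewrite -(parseval_fourierL2 (fourierL2_mulNi F) G).
  apply: (le_trans (norm_cip_le (cL2_mulNi v2) w2)).
  by under eq_Rintegral do rewrite normc_conj_refl normc_mulNi.
rewrite normcE -mulrA mulr_natl mulr2n.
apply: (@le_trans _ _ (`|re (fourierL1 (fun z => u z * u' z)) zeta| +
    `|im (fourierL1 (fun z => u z * u' z)) zeta|)); last exact: lerD.
rewrite -[leRHS](ger0_norm (addr_ge0 (normr_ge0 _) (normr_ge0 _))) -sqrtr_sqr ler_wsqrtr//.
rewrite sqrrD !real_normK ?num_real// addrAC lerDl mulrn_wge0// mulr_ge0//.
Qed.

Lemma cL1_mul u v : cL2 u -> cL2 v ->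
  L1 mu (re (fun z => u z * v z)) /\ L1 mu (im (fun z => u z * v z)).
Proof.
move=> [u1 u2] [v1 v2]; split.
  have := L1B (L2_L1 u1 v1) (L2_L1 u2 v2); apply: eq_integrable => // z _ /=.
  by congr EFin; rewrite /re /im; case: (u z) (v z) => a b [c d] /=.
have := L1D (L2_L1 u1 v2) (L2_L1 u2 v1); apply: eq_integrable => // z _ /=.
by congr EFin; rewrite /re /im; case: (u z) (v z) => a b [c d] /=.
Qed.

Lemma measurable_fourierL1 u : L1 mu (re u) -> L1 mu (im u) ->
  measurable_fun setT (re (fourierL1 u)) /\ measurable_fun setT (im (fourierL1 u)).
Proof.
move=> i1 i2; split.
  apply: (eq_measurable_fun (fun z => FC (re u) z + FS (im u) z)).
    by move=> z _; rewrite re_fourierL1.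
  by apply: measurable_funD; [exact: measurable_FC|exact: measurable_FS].
apply: (eq_measurable_fun (fun z => FC (im u) z - FS (re u) z)).
  by move=> z _; rewrite im_fourierL1.
by apply: measurable_funB; [exact: measurable_FC|exact: measurable_FS].
Qed.

End product.

(** * Inversion of the transform *)

Section inversion.
Context (R : realType).
Local Notation X := (spacetime R).
Local Notation mu := (@mu4 R).
Implicit Types (u v w h : X -> R[i]) (a b p q : X -> R) (zeta : X).

(** Fubini for the symmetric kernel [cos (x . z)]. *)
Lemma ip_FC_adjoint a p : L12 a -> L12 p -> ip mu (FC a) p = ip mu a (FC p).
Proof.
move=> [a1 _] [p1 _].
pose ph (P : X * X) := dot4 P.1 P.2.
have mph : measurable_fun setT ph.
  by apply: measurable_dot4; [exact: measurable_fst|exact: measurable_snd].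
pose F (x z : X) := a x * p z * cos (dot4 x z).
have iF : L1 (mu \x mu)%E (fun P => F P.1 P.2).
  exact: (L1_cos (L1_tensor a1 p1) mph).
have F1 x : L1 mu (F x).
  by apply: (L1_cos (L1Z (a x) p1)); exact: (measurableT_comp mph (measurable_pair1 x)).
have F2 z : L1 mu (F ^~ z).
  have := L1_cos (L1Z (p z) a1) (measurable_dot4l z).
  by apply: eq_integrable => // x _; rewrite /F /= (mulrC (a x)).
have := Rint_swap iF F1 F2 => /esym.
rewrite /ip; congr (_ = _).
  apply: eq_Rintegral => z _; rewrite -RintegralZr//; last exact: (L1_cos a1 (measurable_dot4l z)).
  by apply: eq_Rintegral => x _; rewrite /F; ring.
apply: eq_Rintegral => x _; rewrite -Rint_Z; last exact: (L1_cos p1 (measurable_dot4l x)).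
by apply: eq_Rintegral => z _; rewrite /F (dot4C x); ring.
Qed.

Lemma ip_FS_adjoint a p : L12 a -> L12 p -> ip mu (FS a) p = ip mu a (FS p).
Proof.
move=> [a1 _] [p1 _].
pose ph (P : X * X) := dot4 P.1 P.2.
have mph : measurable_fun setT ph.
  by apply: measurable_dot4; [exact: measurable_fst|exact: measurable_snd].
pose F (x z : X) := a x * p z * sin (dot4 x z).
have iF : L1 (mu \x mu)%E (fun P => F P.1 P.2).
  exact: (L1_sin (L1_tensor a1 p1) mph).
have F1 x : L1 mu (F x).
  by apply: (L1_sin (L1Z (a x) p1)); exact: (measurableT_comp mph (measurable_pair1 x)).
have F2 z : L1 mu (F ^~ z).
  have := L1_sin (L1Z (p z) a1) (measurable_dot4l z).
  by apply: eq_integrable => // x _; rewrite /F /= (mulrC (a x)).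
have := Rint_swap iF F1 F2 => /esym.
rewrite /ip; congr (_ = _).
  apply: eq_Rintegral => z _; rewrite -RintegralZr//; last exact: (L1_sin a1 (measurable_dot4l z)).
  by apply: eq_Rintegral => x _; rewrite /F; ring.
apply: eq_Rintegral => x _; rewrite -Rint_Z; last exact: (L1_sin p1 (measurable_dot4l x)).
by apply: eq_Rintegral => z _; rewrite /F (dot4C x); ring.
Qed.

(* Adjoint of the Fourier transform, i.e. the integral against [e^(+ i x . zeta)]. *)
Definition G1 p q : X -> R := fun x => FC p x - FS q x.
Definition G2 p q : X -> R := fun x => FC q x + FS p x.

Lemma L2_G1 p q : L12 p -> L12 q -> L2 mu (G1 p q).
Proof. by move=> pi qi; apply: L2B; [exact: L12_FC|exact: L12_FS]. Qed.

Lemma L2_G2 p q : L12 p -> L12 q -> L2 mu (G2 p q).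
Proof. by move=> pi qi; apply: L2D; [exact: L12_FC|exact: L12_FS]. Qed.

Lemma adjoint_pair a b p q : L12 a -> L12 b -> L12 p -> L12 q ->
  ip mu (F1 a b) p + ip mu (F2 a b) q = ip mu a (G1 p q) + ip mu b (G2 p q).
Proof.
move=> ai bi pi qi.
have e1 := ip_FC_adjoint ai pi; have e2 := ip_FS_adjoint bi pi.
have e3 := ip_FC_adjoint bi qi; have e4 := ip_FS_adjoint ai qi.
rewrite (ipC _ a (G1 p q)) (ipC _ b (G2 p q)) /F1 /F2 /G1 /G2.
move: (FC a) (FS a) (FC b) (FS b) (L12_FC ai) (L12_FS ai) (L12_FC bi) (L12_FS bi) e1 e2 e3 e4.
move: (FC p) (FS p) (FC q) (FS q) (L12_FC pi) (L12_FS pi) (L12_FC qi) (L12_FS qi).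
move=> A B C D iA iB iC iD A' B' C' D' iA' iB' iC' iD' e1 e2 e3 e4.
have a2 := L12_L2 ai; have b2 := L12_L2 bi; have p2 := L12_L2 pi; have q2 := L12_L2 qi.
rewrite (ipDl iA' iD' p2) (ipBl iC' iB' q2) (ipBl iA iD a2) (ipDl iC iB b2).
by rewrite e1 e2 e3 e4 (ipC _ a A) (ipC _ b B) (ipC _ b C) (ipC _ a D); ring.
Qed.

Lemma adjoint_isometry p q : L12 p -> L12 q ->
  ip mu (G1 p q) (G1 p q) + ip mu (G2 p q) (G2 p q) =
  fourier_mass R * (ip mu p p + ip mu q q).
Proof.
move=> pi qi.
rewrite mulrDr -(parseval_real pi pi) -(parseval_real qi qi).
have := ip_FC_FS pi qi; have := ip_FC_FS qi pi; rewrite /G1 /G2.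
move: (FC p) (FS p) (FC q) (FS q) (L12_FC pi) (L12_FS pi) (L12_FC qi) (L12_FS qi).
move=> A B C D iA iB iC iD e1 e2.
by rewrite (ipBB iA iD) (ipDD iC iB) e1 e2; ring.
Qed.

(** The classical inversion integral, with [fourier_mass] in place of [(2 pi) ^ 4]. *)
Definition fourier_inv h : X -> R[i] := fun x =>
  ((fourier_mass R)^-1 * G1 (re h) (im h) x) +i* ((fourier_mass R)^-1 * G2 (re h) (im h) x).

Lemma cipBB u v : cL2 u -> cL2 v ->
  cip (fun z => u z - v z) (fun z => u z - v z) = cip u u - 2 * cip u v + cip v v.
Proof.
move=> u2 v2.
have E1 : re (fun z => u z - v z) = fun z => re u z - re v z by apply/funext => z; exact: re_sub.
have E2 : im (fun z => u z - v z) = fun z => im u z - im v z by apply/funext => z; exact: im_sub.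
rewrite /cip E1 E2 (ipBB u2.1 v2.1) (ipBB u2.2 v2.2).
move: (ip mu (re u) (re u)) (ip mu (im u) (im u)) (ip mu (re u) (re v)) (ip mu (im u) (im v))
  (ip mu (re v) (re v)) (ip mu (im v) (im v)) => *; ring.
Qed.

(** Write [c] for [fourier_mass R] and [w_n] for the truncations of [w]. Adjointness gives
    [<F w_n, h> = c <w_n, w> = c |w_n|^2]; hence [|F w_n - h|^2 = |h|^2 - c |w_n|^2], which tends to
    [|h|^2 - c |w|^2 = 0] because the adjoint is isometric up to [c]. *)
Lemma fourierL2_inv h : cL12 h -> is_fourierL2 (fourier_inv h) h.
Proof.
move=> h12; have [pi qi] := h12.
have c0 := fourier_mass_gt0 R; have cn0 : fourier_mass R != 0 by rewrite gt_eqF.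
set w := fourier_inv h.
have w2 : cL2 w by split; [exact: (L2Z _ (L2_G1 pi qi))|exact: (L2Z _ (L2_G2 pi qi))].
apply/fourierL2P; split; [exact: w2|exact: cL12_cL2|].
have isow : fourier_mass R * cip w w = cip h h.
  rewrite /cip (ipZZ _ (L2_G1 pi qi)) (ipZZ _ (L2_G2 pi qi)) -mulrDr.
  by rewrite (adjoint_isometry pi qi); field.
have adj n : cip (fourierL1 (trunc_ball n w)) h = fourier_mass R * cip (trunc_ball n w) w.
  have t := cL12_trunc_ball n w2.
  rewrite /cip re_fourierL1_F1// im_fourierL1_F2// (adjoint_pair t.1 t.2 pi qi).
  rewrite (ipC _ _ (re w)) (ipC _ _ (im w)).
  rewrite (ipZl _ (L2_G1 pi qi) (L12_L2 t.1)) (ipZl _ (L2_G2 pi qi) (L12_L2 t.2)).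
  by rewrite (ipC _ (G1 _ _)) (ipC _ (G2 _ _)) -mulrDr mulrA mulfV// mul1r.
have selft n : cip (trunc_ball n w) w = cip (trunc_ball n w) (trunc_ball n w).
  have sq z : \1_(ball4 n) z * \1_(ball4 n) z = \1_(ball4 n) z :> R.
    by rewrite indicE; case: (z \in ball4 n); rewrite ?mulr1 ?mulr0.
  congr (_ + _); apply: eq_Rintegral => z _.
    by rewrite re_trunc_ball [RHS]mulrACA sq mulrA.
  by rewrite im_trunc_ball [RHS]mulrACA sq mulrA.
have E n : cip h h - fourier_mass R * cip (trunc_ball n w) (trunc_ball n w) =
    cip (fun zeta => fourierL1 (trunc_ball n w) zeta - h zeta)
        (fun zeta => fourierL1 (trunc_ball n w) zeta - h zeta).
  have t := cL12_trunc_ball n w2; have Ft := cL2_fourierL1 t; have h2 := cL12_cL2 h12.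
  have := parseval_fourierL1 t t; have := adj n; rewrite selft => a1 a2.
  rewrite (cipBB Ft h2) a1 a2.
  by move: (cip (trunc_ball n w) _) (cip h h) => x y; ring.
rewrite -(eq_cvg _ _ E).
have cn : cip (trunc_ball n w) (trunc_ball n w) @[n --> \oo] --> cip w w.
  by apply: cvg_cip; [move=> n; exact/cL12_cL2/cL12_trunc_ball|
    move=> n; exact/cL12_cL2/cL12_trunc_ball|exact: w2|exact: w2|
    exact: cvg_cip_trunc_ball|exact: cvg_cip_trunc_ball].
have := cvgB (cvg_cst (cip h h)) (cvgM (cvg_cst (fourier_mass R)) cn).
rewrite isow subrr; exact.
Qed.

Lemma cip_fourierL2 u v : is_fourierL2 u v -> cip v v = fourier_mass R * cip u u.
Proof. by move=> h; exact: parseval_fourierL2. Qed.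

End inversion.

(** * Convolutions and tiling *)

Section convolution.
Context (R : realType).
Local Notation X := (spacetime R).
Local Notation mu := (@mu4 R).
Implicit Types f g : X -> R.

Definition conv f g z := \int[mu]_y (f y * g (z - y)).

(** The set on which the integrand of [conv f g z] lives; a uniform bound on its measure is the
    constant of the L^2 estimate for the convolution. *)
Definition overlap f g z : set X := [set y | f y != 0 /\ g (z - y) != 0].

Lemma measurable_convB g : measurable_fun setT g ->
  measurable_fun setT (fun p : X * X => g (p.1 - p.2)).
Proof.
move=> mg; apply: (measurableT_comp mg); apply: measurable_XB.
  exact: measurable_fst.
exact: measurable_snd.
Qed.

Lemma measurable_overlap f g z : measurable_fun setT f -> measurable_fun setT g ->
  measurable (overlap f g z).
Proof.
move=> mf mg; have mgz := measurableT_comp mg (mpres_mu4rB z).1.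
have mh : measurable_fun setT (fun y => f y * g (z - y)) by exact: measurable_funM.
rewrite (_ : overlap f g z = ~` ((fun y => f y * g (z - y)) @^-1` [set 0])); last first.
  apply/seteqP; split=> y; rewrite /overlap /=.
    by move=> [y1 y2] /eqP; rewrite mulf_eq0 (negbTE y1) (negbTE y2).
  by move=> /eqP; rewrite mulf_eq0 negb_or => /andP[].
by apply: measurableC; rewrite -[X in measurable X]setTI; exact: mh.
Qed.

Lemma overlap_le f g (h : X -> R) z : measurable_fun setT f -> measurable_fun setT g -> measurable_fun setT h ->
  (forall x, h x != 0 -> g x != 0) -> (mu (overlap f h z) <= mu (overlap f g z))%E.
Proof.
move=> mf mg mh hg; apply: le_measure; rewrite ?inE; [exact: measurable_overlap..|].
by move=> y [? /hg].
Qed.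

Lemma measurable_conv f g : measurable_fun setT f -> measurable_fun setT g ->
  measurable_fun setT (conv f g).
Proof.
move=> mf mg; apply: (@measurable_Rintegral_snd _ _ X X R mu (fun z y => f y * g (z - y))).
apply: measurable_funM; first exact: (measurableT_comp mf measurable_snd).
exact: measurable_convB.
Qed.

Lemma L1_conv f g z : L2 mu f -> L2 mu g -> L1 mu (fun y => f y * g (z - y)).
Proof. by move=> Lf Lg; apply: L2_L1 => //; exact: L2_mpres (mpres_mu4rB z) Lg. Qed.

Lemma ip_EFin f : L2 mu f -> ((ip mu f f)%:E = \int[mu]_x (f x ^+ 2)%:E)%E.
Proof. by move=> [_ h]; rewrite -L1_EFin. Qed.

Section conv_L2.
Variables f g : X -> R.
Hypotheses (Lf : L2 mu f) (Lg : L2 mu g).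
Let mf := L2_measurable Lf.
Let mg := L2_measurable Lg.

Lemma conv_sqr_le (M : R) z : 0 < M ->
  (mu (overlap f g z) <= M%:E)%E ->
  ((conv f g z ^+ 2)%:E <= M%:E * \int[mu]_y (f y ^+ 2 * g (z - y) ^+ 2)%:E)%E.
Proof.
move=> M0 EM; set E := overlap f g z in EM.
pose h y := f y * g (z - y).
have mh : measurable_fun setT h by exact: L1_measurable (L1_conv z Lf Lg).
have -> : (fun y => (f y ^+ 2 * g (z - y) ^+ 2)%:E) = (fun y => (h y ^+ 2)%:E).
  by apply/funext => y; rewrite exprMn.
have mE : measurable E by exact: measurable_overlap.
have h2 : measurable_fun setT (fun y => (h y ^+ 2)%:E).
  by apply/measurable_EFinP; exact: measurable_funX.
have p0 : (0 <= \int[mu]_y (h y ^+ 2)%:E)%E.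
  by apply: integral_ge0 => y _; rewrite lee_fin sqr_ge0.
(* An infinite integral on the right settles the claim, because [M > 0]; a finite one makes [h]
   square integrable. *)
have [fin|] := ltP (\int[mu]_y (h y ^+ 2)%:E)%E +oo%E; last first.
  by rewrite leye_eq => /eqP ->; rewrite gt0_muley ?lte_fin// leey.
have L2h : L2 mu h.
  split=> //; apply/integrableP; split => //.
  apply: le_lt_trans fin; rewrite le_eqVlt; apply/orP; left; apply/eqP.
  by apply: eq_integral => y _; rewrite /= ger0_norm// sqr_ge0.
have ME : (mu E < +oo)%E by apply: (le_lt_trans EM); rewrite ltry.
have L2E : L2 mu (\1_E : X -> R) by exact: (L12_indic mE ME).2.
have e : conv f g z = ip mu (\1_E) h.
  rewrite /conv /ip; apply: eq_Rintegral => y _; rewrite indicE.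
  case: (boolP (y \in E)); rewrite ?mul1r// => /negP yE; rewrite mul0r.
  apply/eqP; rewrite -[_ == 0]negbK; apply/negP; rewrite mulf_eq0 negb_or => /andP[h1 h3].
  by apply: yE; rewrite inE.
rewrite e -ip_EFin// -EFinM lee_fin.
apply: (le_trans (ip_CS L2E L2h)); rewrite ler_wpM2r ?ip_ge0// ip_indic//.
by rewrite -lee_fin fineK// ge0_fin_numE.
Qed.

Lemma conv_sq_le (M : R) : 0 < M ->
  (forall z, (mu (overlap f g z) <= M%:E)%E) ->
  (\int[mu]_z (conv f g z ^+ 2)%:E <= (M * (ip mu f f * ip mu g g))%:E)%E.
Proof.
move=> M0 EM.
have m2 : measurable_fun setT (fun p : X * X => (f p.2 ^+ 2 * g (p.1 - p.2) ^+ 2)%:E).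
  apply/measurable_EFinP; apply: measurable_funM; apply: measurable_funX.
    exact: (measurableT_comp mf measurable_snd).
  exact: measurable_convB.
have pos p : (0 <= (f p.2 ^+ 2 * g ((p.1 : X) - p.2) ^+ 2)%:E)%E.
  by rewrite lee_fin mulr_ge0 ?sqr_ge0.
have mF : measurable_fun setT (fun z : X => \int[mu]_y (f y ^+ 2 * g (z - y) ^+ 2)%:E)%E.
  exact: (measurable_fun_fubini_tonelli_F (m2 := mu) (fun p : X * X => (f p.2 ^+ 2 * g (p.1 - p.2) ^+ 2)%:E) m2 pos).
have sw : (\int[mu]_z \int[mu]_y (f y ^+ 2 * g (z - y) ^+ 2)%:E =
    \int[mu]_y \int[mu]_z (f y ^+ 2 * g (z - y) ^+ 2)%:E)%E.
  exact: (fubini_tonelli (m1 := mu) (m2 := mu) (fun p : X * X => (f p.2 ^+ 2 * g (p.1 - p.2) ^+ 2)%:E) m2 pos).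
apply: (@le_trans _ _ (\int[mu]_z (M%:E * \int[mu]_y (f y ^+ 2 * g (z - y) ^+ 2)%:E))%E).
  apply: ge0_le_integral; first exact: measurableT.
  - by move=> z _; rewrite lee_fin sqr_ge0.
  - by apply/measurable_EFinP; apply: measurable_funX; exact: measurable_conv.
  - by apply: emeasurable_funM; [exact: measurable_cst|exact: mF].
  - by move=> z _; exact: (conv_sqr_le M0 (EM z)).
rewrite ge0_integralZl; first last.
- by rewrite lee_fin ltW.
- by move=> z _; apply: integral_ge0 => y _; exact: (pos (z, y)).
- exact: mF.
- exact: measurableT.
rewrite sw.
rewrite (eq_integral (fun y => (ip mu g g)%:E * (f y ^+ 2)%:E)%E); last first.
  move=> y _; rewrite (ip_EFin Lg).
  have mg2 : measurable_fun setT (fun z => (g z ^+ 2)%:E).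
    by apply/measurable_EFinP; exact: measurable_funX.
  have mgy : measurable_fun setT (fun z : X => g (z - y) ^+ 2).
    by apply: measurable_funX; exact: (measurableT_comp mg (mpres_mu4B y).1).
  rewrite -(ge0_integral_mpres (mpres_mu4B y) mg2); last by move=> z; rewrite lee_fin sqr_ge0.
  rewrite (ge0_integralZ_EFin _ mgy (fun z => sqr_ge0 _) (sqr_ge0 _)).
  by rewrite muleC.
under eq_integral do rewrite -EFinM.
rewrite (ge0_integralZ_EFin _ (measurable_funX 2 mf) (fun z => sqr_ge0 _) (ip_ge0 _ _)).
by rewrite -(ip_EFin Lf) -!EFinM [ip mu f f * _]mulrC.
Qed.

End conv_L2.

Definition refl g : X -> R := fun x => g (- x).

Lemma L2_refl g : L2 mu g -> L2 mu (refl g).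
Proof. exact: L2_mpres (@mpres_mu4N R). Qed.

Lemma ip_refl g : L2 mu g -> ip mu (refl g) (refl g) = ip mu g g.
Proof. by move=> Lg; exact: (ip_mpres (@mpres_mu4N R) Lg Lg). Qed.

(** Integrand of the expanded square: [p.1] holds the two inner variables, [p.2] the outer one. *)
Definition conv_kernel f g (p : (X * X) * X) : R :=
  f p.1.1 * g (p.2 - p.1.1) * (f p.1.2 * g (p.2 - p.1.2)).

Lemma measurable_conv_kernel f g : measurable_fun setT f -> measurable_fun setT g ->
  measurable_fun setT (conv_kernel f g).
Proof.
move=> mf mg; have m11 : measurable_fun setT (fun p : (X * X) * X => p.1.1).
  exact: (measurableT_comp measurable_fst measurable_fst).
have m12 : measurable_fun setT (fun p : (X * X) * X => p.1.2).
  exact: (measurableT_comp measurable_snd measurable_fst).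
apply: measurable_funM; apply: measurable_funM.
- exact: (measurableT_comp mf m11).
- by apply: (measurableT_comp mg); apply: measurable_XB => //; exact: measurable_snd.
- exact: (measurableT_comp mf m12).
- by apply: (measurableT_comp mg); apply: measurable_XB => //; exact: measurable_snd.
Qed.

Lemma conv_kernel_ge0 f g p : (forall x, 0 <= f x) -> (forall x, 0 <= g x) ->
  0 <= conv_kernel f g p.
Proof. by move=> f0 g0; rewrite mulr_ge0// mulr_ge0. Qed.

Lemma integral_conv_sqr f g : L2 mu f -> L2 mu g ->
  (forall x, 0 <= f x) -> (forall x, 0 <= g x) ->
  (\int[mu]_z (conv f g z ^+ 2)%:E =
   \int[@mu44 R]_p \int[mu]_z (conv_kernel f g (p, z))%:E)%E.
Proof.
move=> Lf Lg f0 g0.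
have mk : measurable_fun setT (fun p => (conv_kernel f g p)%:E).
  by apply/measurable_EFinP; apply: measurable_conv_kernel; [exact: L2_measurable Lf|exact: L2_measurable Lg].
have pos p : (0 <= (conv_kernel f g p)%:E)%E by rewrite lee_fin conv_kernel_ge0.
rewrite [RHS](fubini_tonelli (m1 := @mu44 R) (m2 := mu) (fun p => (conv_kernel f g p)%:E) mk pos).
apply: eq_integral => z _.
have Lh := L1_conv z Lf Lg.
rewrite expr2 /conv -(Rint_tensor Lh Lh) -L1_EFin//.
exact: (L1_tensor Lh Lh).
Qed.

(* Expand the square as a double integral in [x, y] and substitute [x + y - z]
   for [z]. *)
Lemma integral_conv_sqr_refl f g : L2 mu f -> L2 mu g ->
  (forall x, 0 <= f x) -> (forall x, 0 <= g x) ->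
  (\int[mu]_z (conv f (refl g) z ^+ 2)%:E = \int[mu]_z (conv f g z ^+ 2)%:E)%E.
Proof.
move=> Lf Lg f0 g0.
rewrite (integral_conv_sqr Lf (L2_refl Lg) f0 (fun x => g0 (- x))).
rewrite (integral_conv_sqr Lf Lg f0 g0); apply: eq_integral => p _.
have mk : measurable_fun setT (fun z => (conv_kernel f g (p, z))%:E).
  apply/measurable_EFinP; apply: measurableT_comp (measurable_pair1 p).
  by apply: measurable_conv_kernel; [exact: L2_measurable Lf|exact: L2_measurable Lg].
rewrite -(ge0_integral_mpres (mpres_mu4rB (p.1 + p.2)) mk); last first.
  by move=> z; rewrite lee_fin conv_kernel_ge0.
apply: eq_integral => z _; congr EFin; rewrite /conv_kernel /refl /=.
have -> : - (z - p.1) = p.1 - z by rewrite opprB.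
have -> : - (z - p.2) = p.2 - z by rewrite opprB.
have -> : p.1 + p.2 - z - p.1 = p.2 - z by rewrite addrAC [p.1 + _]addrC addrK.
have -> : p.1 + p.2 - z - p.2 = p.1 - z by rewrite addrAC addrK.
by ring.
Qed.

End convolution.

(** * Summation over tiles *)

Section finite_sums.
Context (R : realType).

Lemma sum_CS (n : nat) (p q : nat -> R) :
  (\sum_(k < n) p k * q k) ^+ 2 <= (\sum_(k < n) p k ^+ 2) * (\sum_(k < n) q k ^+ 2).
Proof.
apply: quadratic_ge0_sqr; last by apply: sumr_ge0 => k _; exact: sqr_ge0.
move=> t.
rewrite (_ : _ + _ = \sum_(k < n) (p k + t * q k) ^+ 2); last first.
  rewrite !mulr_sumr -!big_split /=; apply: eq_bigr => k _; ring.
by apply: sumr_ge0 => k _; exact: sqr_ge0.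
Qed.

Lemma sum_indicator_le1 (n : nat) (P : nat -> bool) :
  (forall i j, P i -> P j -> i = j) -> \sum_(k < n) (P k)%:R <= 1 :> R.
Proof.
move=> u; have [[k Pk]|h] := pselect (exists k : 'I_n, P k).
  rewrite (bigD1 k)//= Pk big1 ?addr0// => j jk.
  by rewrite (_ : P j = false)//; apply/negP => Pj; move: jk; rewrite -val_eqE /= (u _ _ Pj Pk) eqxx.
rewrite big1// => k _; rewrite (_ : P k = false)//; apply/negP => Pk; apply: h; by exists k.
Qed.

Lemma multiple_unique (l c : R) (i j : nat) : 0 < l ->
  c < i%:R * l <= c + l -> c < j%:R * l <= c + l -> i = j.
Proof.
move=> l0; wlog ij : i j / (i <= j)%N.
  move=> h hi hj; case/orP: (leq_total i j) => k; first exact: h.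
  by apply/esym; exact: h.
move=> /andP[i1 _] /andP[_ j2]; apply/eqP; rewrite eqn_leq ij /=.
rewrite leqNgt; apply/negP => lt_ij.
have : (i.+1)%:R * l <= j%:R * l by rewrite ler_pM2r// ler_nat.
by rewrite -natr1 mulrDl mul1r => h; lra.
Qed.

Lemma multiple_exists (l c : R) (n : nat) : 0 < l -> 0 <= c -> c < n%:R * l ->
  exists2 k : nat, (k < n)%N & c - l < k%:R * l <= c.
Proof.
move=> l0 c0 cn; exists (Num.truncn (c / l)).
  rewrite truncn_lt_nat; first by rewrite ltr_pdivrMr.
  by rewrite divr_ge0// ltW.
have h : 0 <= c / l by rewrite divr_ge0// ltW.
have /andP[h1 h2] := truncn_itv h; apply/andP; split; last by rewrite -ler_pdivlMr.
by move: h2; rewrite ltr_pdivrMr// -natr1 mulrDl mul1r; lra.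
Qed.

End finite_sums.

Section L2_sums.
Context d (T : measurableType d) (R : realType).
Variable mu : {measure set T -> \bar R}.

Lemma L1_sum (n : nat) (F : nat -> T -> R) : (forall k, L1 mu (F k)) ->
  L1 mu (fun x => \sum_(k < n) F k x) /\
  \int[mu]_x \sum_(k < n) F k x = \sum_(k < n) \int[mu]_x F k x.
Proof.
move=> iF; elim: n => [|n [IH1 IH2]].
  have -> : (fun x => \sum_(k < 0) F k x) = (fun x => 0 * F 0%N x).
    by apply/funext => x; rewrite big_ord0 mul0r.
  by split; [exact: L1Z|rewrite Rint_Z// mul0r big_ord0].
have e : (fun x => \sum_(k < n.+1) F k x) = (fun x => \sum_(k < n) F k x + F n x).
  by apply/funext => x; rewrite big_ord_recr.
rewrite e; split; first exact: L1D.
by rewrite Rint_D// IH2 big_ord_recr.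
Qed.

Lemma sum_ip_le (n : nat) (F : nat -> T -> R) f (c : R) : (forall k, L2 mu (F k)) -> L2 mu f ->
  (forall x, \sum_(k < n) F k x ^+ 2 <= c * f x ^+ 2) ->
  \sum_(k < n) ip mu (F k) (F k) <= c * ip mu f f.
Proof.
move=> LF Lf h; have i k : L1 mu (fun x => F k x ^+ 2) by exact: (LF k).2.
have [i1 i2] := @L1_sum n (fun k x => F k x ^+ 2) i.
rewrite (_ : \sum_(k < n) _ = \int[mu]_x \sum_(k < n) F k x ^+ 2); last by rewrite i2.
rewrite /ip -Rint_Z; last exact: Lf.2.
apply: le_Rintegral => //; exact: L1Z Lf.2.
Qed.

Lemma L2_triangle f g : L2 mu f -> L2 mu g ->
  Num.sqrt (ip mu (fun x => f x + g x) (fun x => f x + g x)) <=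
  Num.sqrt (ip mu f f) + Num.sqrt (ip mu g g).
Proof.
move=> Lf Lg; have f0 := ip_ge0 mu f; have g0 := ip_ge0 mu g.
rewrite -[leRHS]ger0_norm ?addr_ge0 ?sqrtr_ge0// -sqrtr_sqr ler_wsqrtr// ipDD//.
rewrite sqrrD !sqr_sqrtr// lerD2r lerD2l -[leRHS]mulr_natl ler_pM2l// -sqrtrM//.
by rewrite (le_trans (ler_norm _))// -sqrtr_sqr ler_wsqrtr// ip_CS.
Qed.

Lemma L2_sum (n : nat) (F : nat -> T -> R) : (forall k, L2 mu (F k)) ->
  L2 mu (fun x => \sum_(k < n) F k x) /\
  Num.sqrt (ip mu (fun x => \sum_(k < n) F k x) (fun x => \sum_(k < n) F k x)) <=
  \sum_(k < n) Num.sqrt (ip mu (F k) (F k)).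
Proof.
move=> LF; elim: n => [|n [IH1 IH2]].
  have -> : (fun x => \sum_(k < 0) F k x) = (fun x => 0 * F 0%N x).
    by apply/funext => x; rewrite big_ord0 mul0r.
  by split; [exact: L2Z|rewrite ipZZ// expr0n mul0r sqrtr0 big_ord0].
have e : (fun x => \sum_(k < n.+1) F k x) = (fun x => \sum_(k < n) F k x + F n x).
  by apply/funext => x; rewrite big_ord_recr.
rewrite e; split; first exact: L2D.
rewrite big_ord_recr /=; set f := (fun x => \sum_(k < n) F k x) in IH1 IH2 *.
apply: (@le_trans _ _ (Num.sqrt (ip mu f f) + Num.sqrt (ip mu (F n) (F n)))); last by rewrite lerD2r.
exact: L2_triangle.
Qed.

End L2_sums.

Section tiling.
Context (R : realType).
Local Notation X := (spacetime R).
Local Notation mu := (@mu4 R).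
Implicit Types f g : X -> R.

Lemma L2_indicM (A : set X) f : measurable A -> L2 mu f -> L2 mu (fun x => \1_A x * f x).
Proof.
move=> mA [mf fi]; have m : measurable_fun setT (fun x => \1_A x * f x).
  by apply: measurable_funM => //; exact: measurable_indic.
split=> //; apply: (L1_le _ _ fi); first exact: measurable_funX.
move=> x; rewrite !normrX lerXn2r ?nnegrE// normrM ler_piMl// indicE.
by case: (x \in A); rewrite ?normr1 ?normr0.
Qed.

(** Either overlap bound suffices, since reflecting [g] changes neither the norm of the convolution
    nor that of [g]. The alternative encodes equal versus opposite signs. *)
Lemma conv_sq_le_or f g (M : R) : L2 mu f -> L2 mu g ->
  (forall x, 0 <= f x) -> (forall x, 0 <= g x) -> 0 < M ->
  (forall z, (mu (overlap f g z) <= M%:E)%E) \/ (forall z, (mu (overlap f (refl g) z) <= M%:E)%E) ->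
  L2 mu (conv f g) /\ ip mu (conv f g) (conv f g) <= M * (ip mu f f * ip mu g g).
Proof.
move=> Lf Lg f0 g0 M0 H.
have h : (\int[mu]_z (conv f g z ^+ 2)%:E <= (M * (ip mu f f * ip mu g g))%:E)%E.
  case: H => H; first exact: conv_sq_le.
  rewrite -integral_conv_sqr_refl// -(ip_refl Lg).
  by apply: conv_sq_le => //; exact: L2_refl.
have mc : measurable_fun setT (conv f g).
  by apply: measurable_conv; [exact: L2_measurable Lf|exact: L2_measurable Lg].
have L : L2 mu (conv f g).
  split=> //; apply/integrableP; split; first by apply/measurable_EFinP; exact: measurable_funX.
  apply: le_lt_trans (ltry (M * (ip mu f f * ip mu g g))); apply: le_trans h.
  rewrite le_eqVlt; apply/orP; left; apply/eqP; apply: eq_integral => z _.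
  by rewrite /= ger0_norm// sqr_ge0.
by split=> //; rewrite -lee_fin ip_EFin.
Qed.

Lemma conv_sum (n : nat) (F G : nat -> X -> R) z : (forall k, L2 mu (F k)) -> (forall k, L2 mu (G k)) ->
  \int[mu]_y \sum_(k < n) F k y * G k (z - y) = \sum_(k < n) conv (F k) (G k) z.
Proof.
move=> LF LG; have i k : L1 mu (fun y => F k y * G k (z - y)) by exact: L1_conv.
by rewrite (@L1_sum _ _ _ mu n (fun k y => F k y * G k (z - y)) i).2.
Qed.

(** Minkowski over [k], the bound for a single [k], then Cauchy-Schwarz over [k]. The constants [c1]
    and [c2] account for how many pieces overlap at a point. *)
Lemma sum_conv_le (n : nat) (F G : nat -> X -> R) f g (M c1 c2 : R) :
  (forall k, L2 mu (F k)) -> (forall k, L2 mu (G k)) -> L2 mu f -> L2 mu g -> 0 < M -> 0 <= c1 -> 0 <= c2 ->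
  (forall k x, 0 <= F k x) -> (forall k x, 0 <= G k x) ->
  (forall x, \sum_(k < n) F k x ^+ 2 <= c1 * f x ^+ 2) ->
  (forall x, \sum_(k < n) G k x ^+ 2 <= c2 * g x ^+ 2) ->
  (forall k z, (mu (overlap (F k) (G k) z) <= M%:E)%E) \/
  (forall k z, (mu (overlap (F k) (refl (G k)) z) <= M%:E)%E) ->
  L2 mu (fun z => \sum_(k < n) conv (F k) (G k) z) /\
  ip mu (fun z => \sum_(k < n) conv (F k) (G k) z) (fun z => \sum_(k < n) conv (F k) (G k) z)
    <= c1 * c2 * M * (ip mu f f * ip mu g g).
Proof.
move=> LF LG Lf Lg M0 c10 c20 F0 G0 Ff Gg H.
have HC k : L2 mu (conv (F k) (G k)) /\ ip mu (conv (F k) (G k)) (conv (F k) (G k)) <=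
    M * (ip mu (F k) (F k) * ip mu (G k) (G k)).
  apply: conv_sq_le_or => //; case: H => H; [left|right] => z; exact: H.
have [LS tri] := @L2_sum _ _ _ mu n (fun k => conv (F k) (G k)) (fun k => (HC k).1).
split; first exact: LS.
set S := fun z => _ in LS tri *.
pose p k := Num.sqrt (ip mu (F k) (F k)); pose q k := Num.sqrt (ip mu (G k) (G k)).
have tri2 : Num.sqrt (ip mu S S) <= Num.sqrt M * \sum_(k < n) p k * q k.
  apply: (le_trans tri); rewrite mulr_sumr; apply: ler_sum => k _.
  have [_ h] := HC k; rewrite /p /q -sqrtrM ?ip_ge0// -sqrtrM ?(ltW M0)//.
  exact: ler_wsqrtr h.
have pq0 : 0 <= \sum_(k < n) p k * q k.
  by apply: sumr_ge0 => k _; rewrite mulr_ge0 ?sqrtr_ge0.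
have E : ip mu S S <= M * (\sum_(k < n) p k * q k) ^+ 2.
  rewrite -[leLHS]sqr_sqrtr ?ip_ge0// -[X in X * _](sqr_sqrtr (ltW M0)) -exprMn.
  by rewrite lerXn2r// nnegrE ?mulr_ge0 ?sqrtr_ge0.
apply: (le_trans E); rewrite [c1 * c2 * M]mulrC -mulrA ler_pM2l//.
apply: (le_trans (sum_CS n p q)); rewrite mulrACA.
have P : \sum_(k < n) p k ^+ 2 <= c1 * ip mu f f.
  rewrite (eq_bigr (fun k : 'I_n => ip mu (F k) (F k))); first exact: sum_ip_le.
  by move=> k _; rewrite sqr_sqrtr// ip_ge0.
have Q : \sum_(k < n) q k ^+ 2 <= c2 * ip mu g g.
  rewrite (eq_bigr (fun k : 'I_n => ip mu (G k) (G k))); first exact: sum_ip_le.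
  by move=> k _; rewrite sqr_sqrtr// ip_ge0.
by apply: ler_pM => //; apply: sumr_ge0 => k _; exact: sqr_ge0.
Qed.

End tiling.

Section slab_convolution.
Context (R : realType).
Local Notation X := (spacetime R).
Local Notation mu := (@mu4 R).
Variables (p : X -> R) (f g : X -> R) (B l a b M : R).
Hypotheses (mp : measurable_fun setT p) (pB : forall x y, p (x - y) = p x - p y).
Hypotheses (Lf : L2 mu f) (Lg : L2 mu g) (f0 : forall x, 0 <= f x) (g0 : forall x, 0 <= g x).
Hypotheses (fB : forall x, f x != 0 -> `|p x| <= B) (l0 : 0 < l) (abl : b - a <= l) (M0 : 0 < M).

Definition tile (t : R) : set X := [set x | t <= p x < t + l].
Definition tiled (t : R) : X -> R := fun x => \1_(tile t) x * f x.

Hypothesis H : (forall t z, (mu (overlap (tiled t) g z) <= M%:E)%E) \/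
  (forall t z, (mu (overlap (tiled t) (refl g) z) <= M%:E)%E).

(** Where [z - y] can lie when [z] is in the slab and [y] is in the tile starting at [t]. *)
Let J (t : R) : set X := [set x | a - t - l < p x <= b - t].
Let t (k : nat) : R := k%:R * l - B.
Let F (k : nat) : X -> R := tiled (t k).
Let tooth (c : R) (k : nat) : bool := c < k%:R * l <= c + l.
Let G (k : nat) : X -> R := fun x => \1_(J (t k)) x * g x.

Let measurable_tile s : measurable (tile s).
Proof.
rewrite -[tile s]setTI; apply: (_ : measurable_fun setT (fun p => _ && _)) => //.
by apply: measurable_and; [apply: measurable_fun_ler|apply: measurable_fun_ltr].
Qed.

Let measurable_J s : measurable (J s).
Proof.
rewrite -[J s]setTI; apply: (_ : measurable_fun setT (fun p => _ && _)) => //.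
by apply: measurable_and; [apply: measurable_fun_ltr|apply: measurable_fun_ler].
Qed.

Let indicM_ge0 (A : set X) (h : X -> R) x : 0 <= h x -> 0 <= \1_A x * h x.
Proof. by move=> h0; rewrite mulr_ge0// indicE. Qed.

Let sqr_ind (A : set X) x : (\1_A x : R) ^+ 2 = \1_A x.
Proof. by rewrite indicE; case: (x \in A); rewrite ?expr1n ?expr0n. Qed.

Let sumF n x : \sum_(k < n) F k x ^+ 2 <= 1 * f x ^+ 2.
Proof.
have E k : F k x ^+ 2 = (tooth (p x + B - l) k)%:R * f x ^+ 2.
  rewrite /F /tiled exprMn sqr_ind indicE (_ : (x \in tile (t k)) = tooth (p x + B - l) k)//.
  by apply/idP/idP; rewrite inE /tooth /tile /t /= => /andP[h1 h2]; apply/andP; split; lra.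
under eq_bigr do rewrite E; rewrite -mulr_suml ler_wpM2r ?sqr_ge0//.
apply: (@sum_indicator_le1 R n (fun k => tooth (p x + B - l) k)).
by move=> i j; exact: multiple_unique.
Qed.

(** A point lies in at most two of the strips: [k * l] is confined to a window of length at most
    [2 * l], which [w] cuts into two half-open teeth of length [l]. *)
Let sumG n x : \sum_(k < n) G k x ^+ 2 <= 2 * g x ^+ 2.
Proof.
pose w := a + B - p x.
have E k : G k x ^+ 2 <= ((tooth (w - l) k)%:R + (tooth w k)%:R) * g x ^+ 2.
  rewrite /G exprMn sqr_ind; apply: ler_wpM2r; first exact: sqr_ge0.
  rewrite indicE; case: (boolP (x \in J (t k))) => [|_]; last by rewrite addr_ge0.
  rewrite inE /J /t /= => /andP[h1 h2].
  have [wk|wk] := leP (k%:R * l) w.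
    rewrite (_ : tooth (w - l) k); first by rewrite lerDl.
    by apply/andP; rewrite /w in wk *; split; lra.
  rewrite (_ : tooth w k); first by rewrite lerDr.
  rewrite /tooth wk /=; move: h1 h2 wk; rewrite /w => h1 h2 _; have := abl; move: h1 h2; move: (k%:R * l) (p x) => u v; lra.
apply: (@le_trans _ _ (\sum_(k < n) ((tooth (w - l) k)%:R +
   (tooth w k)%:R) * g x ^+ 2)).
  by apply: ler_sum => k _; exact: E.
rewrite -mulr_suml ler_wpM2r ?sqr_ge0// big_split /= (_ : 2 = 1 + 1)//.
apply: lerD.
  apply: (@sum_indicator_le1 R n (fun k => tooth (w - l) k)).
  by move=> i j; exact: multiple_unique.
apply: (@sum_indicator_le1 R n (fun k => tooth w k)).
by move=> i j; exact: multiple_unique.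
Qed.

Let decomposition n z y : 2 * B < n%:R * l -> a <= p z <= b ->
  f y * g (z - y) = \sum_(k < n) F k y * G k (z - y).
Proof.
move=> nB /andP[az zb]; have [fy|fy] := eqVneq (f y) 0.
  by rewrite fy mul0r big1// => k _; rewrite /F /tiled fy mulr0 mul0r.
have := fB fy; rewrite ler_norml => /andP[yB1 yB2].
have y0 : 0 <= p y + B by lra.
have yn : p y + B < n%:R * l by lra.
have [k kn /andP[k1 k2]] := multiple_exists l0 y0 yn.
have yT : tile (t k) y by rewrite /tile /t /=; apply/andP; split; lra.
rewrite (bigD1 (Ordinal kn))//= big1 ?addr0; last first.
  move=> i ik; rewrite /F /tiled indicE memNset ?mul0r ?mul0r// => /andP[i1 i2].
  move: ik; rewrite -val_eqE /= (@multiple_unique R l (p y + B - l) i k) ?eqxx//.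
    by rewrite /t in i1 i2; apply/andP; split; lra.
  by apply/andP; split; lra.
have zJ : J (t k) (z - y).
  by rewrite /J /= pB /t; apply/andP; split; lra.
by rewrite /F /G /tiled !indicE !mem_set// !mul1r.
Qed.

(** Off the slab the sum [S] may differ from the convolution, but it is square integrable
    everywhere, so norms over the whole space can replace norms over the slab. *)
Lemma conv_slab : exists S, [/\ L2 mu S, ip mu S S <= 2 * M * (ip mu f f * ip mu g g) &
  forall z, a <= p z <= b -> conv f g z = S z].
Proof.
have LF k : L2 mu (F k) by exact: L2_indicM.
have LG k : L2 mu (G k) by exact: L2_indicM.
(* Enough tiles of width [l], starting at [- B], to cover [[- B, B]], the range of [p] on the
   support of [f]. *)
pose n := (Num.truncn (2 * B / l)).+1.
have nB : 2 * B < n%:R * l by rewrite -ltr_pdivrMr// truncnS_gt.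
have mG k : measurable_fun setT (G k) by exact: L2_measurable (LG k).
have mF k : measurable_fun setT (F k) by exact: L2_measurable (LF k).
have mg := L2_measurable Lg.
have GN k x : G k x != 0 -> g x != 0 by rewrite /G mulf_eq0 negb_or => /andP[].
have K : (forall k z, (mu (overlap (F k) (G k) z) <= M%:E)%E) \/
    (forall k z, (mu (overlap (F k) (refl (G k)) z) <= M%:E)%E).
  case: H => h; [left|right] => k z; apply: le_trans (h (t k) z).
    by apply: overlap_le => //; exact: GN.
  apply: overlap_le => //; last by move=> x; exact: GN.
    by exact: L2_measurable (L2_refl Lg).
  by exact: L2_measurable (L2_refl (LG k)).
have F0 k x : 0 <= F k x by exact: indicM_ge0.
have G0 k x : 0 <= G k x by exact: indicM_ge0.
have [LS S2] := sum_conv_le LF LG Lf Lg M0 ler01 (ler0n _ 2) F0 G0 (sumF n) (sumG n) K.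
exists (fun z => \sum_(k < n) conv (F k) (G k) z); split => //.
  by rewrite mul1r in S2.
move=> z zab; rewrite -conv_sum//.
by apply: eq_Rintegral => y _; exact: decomposition.
Qed.

End slab_convolution.

(** * The measure of the interaction set *)

Section interval_integrals.
Context (R : realType).
Local Notation lam := (@lebesgue_measure R).

Lemma measurable_invR : measurable_fun setT (fun x : R => x^-1).
Proof.
have o : open [set x : R | x != 0].
  rewrite (_ : [set x | _] = ~` [set 0]); last first.
    by apply/seteqP; split=> x /= /eqP.
  by apply: closed_openC; exact: closed_eq.
have mo : measurable [set x : R | x != 0] by exact: open_measurable.
rewrite -(setUv [set x : R | x != 0]).
apply/measurable_funU; [exact: mo|exact: measurableC|split].
  apply: (open_continuous_measurable_fun o) => x; rewrite inE /= => x0.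
  exact: inv_continuous.
have mc : measurable_fun (~` [set x : R | x != 0]) (cst (0 : R)) by exact: measurable_cst.
apply: (eq_measurable_fun _ _ mc) => x; rewrite inE /= => /negP; rewrite negbK => /eqP ->.
by rewrite /cst invr0.
Qed.

Section exhaustion.
Variables (S : set R) (M K : R).
Hypotheses (SI : is_interval S) (SM : forall x, S x -> `|x| <= M).

Lemma interval_inf_sup : S !=set0 ->
  (forall x, S x -> inf S <= x <= sup S) /\ (forall x, inf S < x < sup S -> S x).
Proof.
move=> S0.
have hs : has_sup S by split=> //; exists M => x /SM/ler_normlW.
have hi : has_inf S.
  by split=> //; exists (- M) => x /SM; rewrite ler_norml => /andP[].
split=> [x Sx|x /andP[ix xs]].
  by rewrite inf_lbound ?sup_upper_bound//; case: hi.
have [a Sa ax] := inf_lt S0 ix.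
have [b Sb xb] := sup_gt S0 xs.
by apply: (SI Sa Sb); rewrite !ltW.
Qed.

Lemma lebesgue_interval_le (r : \bar R) :
  (0 <= r)%E -> (forall a b, S a -> S b -> a < b -> ((b - a)%:E <= r)%E) -> (lam S <= r)%E.
Proof.
move=> r0 h; have [->|/set0P S0] := eqVneq S set0; first by rewrite measure0.
have [h1 h2] := interval_inf_sup S0.
have sub : S `<=` `[inf S, sup S]%classic by move=> x /h1; rewrite /= in_itv.
have mS : measurable S by exact: is_interval_measurable.
apply: (@le_trans _ _ (lam `[inf S, sup S]%classic)).
  by apply: le_measure; rewrite ?inE.
rewrite lebesgue_measure_itv/= lte_fin; case: ifPn => // is_.
case: r r0 h => [r|_ _|//]; last by rewrite leey.
rewrite lee_fin => r0 h; rewrite -EFinB lee_fin.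
apply/ler_addgt0Pl => e e0.
(* The first term controls the total loss, and a third of the length keeps the shrunken interval
   nondegenerate. *)
pose e' := Num.min (e / 2) ((sup S - inf S) / 3).
have e'0 : 0 < e' by rewrite lt_min !divr_gt0// subr_gt0.
have e'1 : e' <= e / 2 by rewrite ge_min lexx.
have e'2 : e' <= (sup S - inf S) / 3 by rewrite ge_min lexx orbT.
have := h (inf S + e') (sup S - e').
have -> : inf S + e' < sup S - e' by lra.
move=> /(_ _ _ isT); rewrite lee_fin => k.
have : sup S - e' - (inf S + e') <= r.
  by apply: k; apply: h2; apply/andP; split; lra.
lra.
Qed.

Variable g : R -> R.
Hypotheses (mg : measurable_fun setT g) (g0 : forall x, 0 <= g x) (K0 : 0 <= K).

(** The ends of [S] are approached through compact subintervals, because the integrand [1 / y] used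
    below may blow up there. *)
Lemma integral_interval_le :
  (forall a b, S a -> S b -> a < b -> (\int[lam]_(x in `[a, b]) (g x)%:E <= K%:E)%E) ->
  (\int[lam]_(x in S) (g x)%:E <= K%:E)%E.
Proof.
move=> h; have [->|/set0P S0] := eqVneq S set0.
  by rewrite integral_set0 lee_fin.
have [h1 h2] := interval_inf_sup S0.
have sub : S `<=` `[inf S, sup S]%classic by move=> x /h1; rewrite /= in_itv.
have mS : measurable S by exact: is_interval_measurable.
have mgE D : measurable_fun D (fun x => (g x)%:E).
  by apply/measurable_EFinP; exact: measurable_funS mg.
apply: (@le_trans _ _ (\int[lam]_(x in `[inf S, sup S]) (g x)%:E)%E).
  apply: ge0_subset_integral => //; first exact: mgE.
  by move=> x _; rewrite lee_fin.
rewrite integral_itv_bndoo//.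
pose F (n : nat) : set R := `[inf S + n.+1%:R^-1, sup S - n.+1%:R^-1]%classic.
have FE : `]inf S, sup S[%classic = \bigcup_n F n.
  apply/seteqP; split=> x; rewrite /= in_itv /=; last first.
    move=> [n _]; rewrite /F /= in_itv /= => /andP[x1 x2].
    have n0 : 0 < n.+1%:R^-1 :> R by rewrite invr_gt0.
    by apply/andP; split; [apply: lt_le_trans x1; rewrite ltrDl|apply: (le_lt_trans x2); rewrite gtrBl].
  move=> /andP[x1 x2].
  pose e := Num.min (x - inf S) (sup S - x).
  have e0 : 0 < e by rewrite lt_min !subr_gt0 x1.
  have [n ne] : exists n, n.+1%:R^-1 < e.
    exists (Num.truncn e^-1); rewrite -[ltRHS]invrK ltf_pV2 ?posrE ?invr_gt0 ?ltr0n//.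
    exact: truncnS_gt.
  have ea : e <= x - inf S by rewrite ge_min lexx.
  have eb : e <= sup S - x by rewrite ge_min lexx orbT.
  exists n => //; rewrite /F /= in_itv /=; apply/andP; split.
    by rewrite -lerBrDl; apply: ltW (lt_le_trans ne ea).
  by rewrite lerBrDr -lerBrDl; apply: ltW (lt_le_trans ne eb).
have ndF : nondecreasing_seq F.
  move=> m n mn; apply/subsetPset => x; rewrite /F /= !in_itv/= => /andP[x1 x2].
  have : n.+1%:R^-1 <= m.+1%:R^-1 :> R by rewrite lef_pV2 ?posrE ?ltr0n// ler_nat.
  move=> k; apply/andP; split; first by apply: le_trans x1; rewrite lerD2l.
  by apply: (le_trans x2); rewrite lerD2l lerN2.
rewrite FE.
have mF n : measurable (F n) by exact: measurable_itv.
have g0E x : (0 <= (g x)%:E)%E by rewrite lee_fin.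
have c := @ge0_nondecreasing_set_cvg_integral _ (measurableTypeR R) R F (fun x => (g x)%:E) lam
  ndF mF (fun i => mgE (F i)) (fun i x _ => g0E x).
rewrite -(cvg_lim _ c)//; apply: lime_le; first by apply/cvg_ex; eexists; exact: c.
apply: nearW => n; rewrite /F.
have n0 : 0 < n.+1%:R^-1 :> R by rewrite invr_gt0.
have [ab|] := ltP (inf S + n.+1%:R^-1) (sup S - n.+1%:R^-1).
  apply: h => //; apply: h2; apply/andP; split; first by rewrite ltrDl.
  - by apply: (lt_trans ab); rewrite gtrBl.
  - by apply: lt_trans ab; rewrite ltrDl.
  - by rewrite gtrBl.
rewrite le_eqVlt => /predU1P[->|ba].
  by rewrite set_itv1 integral_set1 lee_fin.
by rewrite set_itv_ge ?bnd_simp -?ltNge// integral_set0 lee_fin.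
Qed.

(** Only the oscillation of the primitive on [S] enters, so an arctangent can serve even where its
    derivative is singular at the ends. *)
Lemma integral_le_primitive (Phi phi : R -> R) (k : R) :
  (forall x, S x -> is_derive x 1 Phi (phi x)) ->
  (forall x, S x -> {for x, continuous phi}) ->
  (forall x, S x -> g x <= k * phi x) -> 0 <= k ->
  (forall x, S x -> 0 <= phi x) ->
  (forall x y, S x -> S y -> k * (Phi y - Phi x) <= K) ->
  (\int[lam]_(x in S) (g x)%:E <= K%:E)%E.
Proof.
move=> dPhi cphi gphi k0 phi0 osc; apply: integral_interval_le => a b Sa Sb ab.
have Sab x : a <= x <= b -> S x by exact: SI.
have E := @FTC_is_derive R phi Phi a b (ltW ab) (fun x xab => dPhi x (Sab x xab))
  (fun x xab => cphi x (Sab x xab)).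
have mphi : measurable_fun `[a, b] phi.
  apply: subspace_continuous_measurable_fun => //.
  by apply: continuous_in_subspaceT => x; rewrite inE/= in_itv/= => /Sab; exact: cphi.
apply: (@le_trans _ _ (\int[lam]_(x in `[a, b]) (k%:E * (phi x)%:E))%E).
  apply: ge0_le_integral => //.
  - by move=> x _; rewrite lee_fin.
  - by apply/measurable_EFinP; exact: measurable_funS mg.
  - by apply: emeasurable_funM; [exact: measurable_cst|exact/measurable_EFinP].
  - by move=> x; rewrite /= in_itv/= => /Sab Sx; rewrite -EFinM lee_fin; exact: gphi.
rewrite ge0_integralZl//; last 2 first.
- exact/measurable_EFinP.
- by move=> x; rewrite /= in_itv/= => /Sab Sx; rewrite lee_fin; exact: phi0.
by rewrite E -EFinM lee_fin; exact: osc.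
Qed.

End exhaustion.
End interval_integrals.

(** * The integral of 1 / y at constant focal sum *)

Section elliptic_integral.
Context (R : realType).
Local Notation lam := (@lebesgue_measure R).

Lemma is_derive_continuous (f : R -> R) (x df : R) :
  is_derive x 1 f df -> {for x, continuous f}.
Proof. by move=> ?; apply/differentiable_continuous/derivable1_diffP. Qed.

Lemma atan_sub_lt4 (x y : R) : atan y - atan x <= 4.
Proof.
have := atan_def x; have := atan_def y; have := @pihalf_lt2 R.
by move=> h [/andP[_ h1] _] [/andP[h2 _] _]; lra.
Qed.

Variables (l0 b s : R).
(** At fixed height [s] and fixed focal sum, the distance to the first focus is an affine function
    of the abscissa, here [l]. Then [Q] is the squared ordinate and [m] is half of [Q']. *)
Let l x := l0 + b * x.
Let Q x := l x * l x - s * s - x * x.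
Let m x := b * l x - x.
Let y x := Num.sqrt (Q x).

Lemma is_derive_Q (x : R) : is_derive x 1 Q (2 * m x).
Proof.
rewrite /Q /l; apply: trigger_derive; rewrite /GRing.scale/= /m /l.
by ring.
Qed.

Lemma is_derive_m (x : R) : is_derive x 1 m (b * b - 1).
Proof.
rewrite /m /l; apply: trigger_derive; rewrite /GRing.scale/=.
by ring.
Qed.

Lemma is_derive_y (x : R) : 0 < Q x -> is_derive x 1 y (m x / y x).
Proof.
move=> Q0; have dQ := is_derive_Q x; have ds := is_derive1_sqrt Q0.
have := is_derive1_comp ds dQ; move/is_derive_eq; apply.
have y0 : y x != 0 by rewrite gt_eqF// sqrtr_gt0.
by rewrite -/(y x); field.
Qed.

Lemma measurable_y : measurable_fun setT (fun x => (y x)^-1).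
Proof.
have mQ : measurable_fun setT Q.
  have ml : measurable_fun setT l by apply: measurable_funD => //; exact: measurable_funM.
  by apply: measurable_funB; [apply: measurable_funB => //|]; exact: measurable_funM.
apply: (measurableT_comp (measurable_invR (R := R))).
apply: measurableT_comp mQ; apply: continuous_measurable_fun.
exact: sqrt_continuous.
Qed.

Variables (S : set R) (N sig : R).
Hypotheses (SI : is_interval S) (N0 : 0 < N) (sig0 : 0 < sig) (b0 : 0 <= b) (b1 : b <= 1).
Hypothesis SP : forall x, S x -> [/\ 0 < Q x, N / 2 < l x, l x <= N & sig * l x <= `|s|].

Lemma l_sqr x : S x -> x ^+ 2 < N ^+ 2.
Proof.
move=> /SP[Q0 l1 l2 _]; have := sqr_ge0 s.
have : l x * l x <= N * N by apply: ler_pM => //; lra.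
by move: Q0; rewrite /Q !expr2; lra.
Qed.

Lemma S_bounded x : S x -> `|x| <= N.
Proof.
by move=> /l_sqr h; rewrite -(@ler_pXn2r _ 2) ?nnegrE// ?real_normK ?num_real// ltW.
Qed.

(* The primitive of [1 / y] is [- atan (m / (c y)) / c] with [c ^ 2 = 1 - b ^ 2]. *)
Let case1 : sig ^+ 2 / 4 < 1 - b * b ->
  (\int[lam]_(x in S) ((y x)^-1)%:E <= (32 / sig)%:E)%E.
Proof.
move=> Bs; pose c := Num.sqrt (1 - b * b).
have B0 : 0 < 1 - b * b by apply: le_lt_trans Bs; rewrite divr_ge0 ?sqr_ge0.
have c0 : 0 < c by rewrite sqrtr_gt0.
have cE : c * c = 1 - b * b by rewrite -expr2 sqr_sqrtr// ltW.
have csig : sig / 2 < c.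
  rewrite -(@ltr_pXn2r _ 2) ?nnegrE ?divr_ge0// ?ltW//.
  by rewrite [ltRHS]expr2 cE expr_div_n -natrX.
pose p x := m x * (c * y x)^-1.
pose phi x := c * (y x)^-1.
have yP x : S x -> 0 < y x /\ y x * y x = Q x.
  by move=> /SP[Q0 _ _ _]; rewrite /y sqrtr_gt0 -expr2 sqr_sqrtr// ltW.
have dcy x : S x -> is_derive x 1 (fun x => c * y x) (c * (m x / y x)).
  move=> Sx; have [Q0 _ _ _] := SP Sx; have dy := is_derive_y Q0.
  by apply: is_derive_eq; rewrite /GRing.scale/=; ring.
have dp x : S x -> is_derive x 1 p
    (m x * (- (c * y x) ^- 2 * (c * (m x / y x))) + (c * y x)^-1 * (b * b - 1)).
  move=> Sx; have [y0 _] := yP _ Sx; have dm := is_derive_m x.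
  have cy0 : c * y x != 0 by rewrite mulf_neq0 ?gt_eqF.
  have dV := @is_deriveV _ (fun x => c * y x) x _ 1 cy0 (dcy x Sx).
  exact: (is_deriveM dm dV).
have dPhi x : S x -> is_derive x 1 (fun x => - atan (p x)) (phi x).
  move=> Sx; have [y0 yE] := yP _ Sx; have dpx := dp x Sx.
  have da := is_derive1_comp (is_derive1_atan (p x)) dpx.
  apply: (is_derive_eq (is_deriveN da)).
  have nz : (c * y x) ^+ 2 + m x ^+ 2 != 0.
    by rewrite gt_eqF// ltr_pwDl ?sqr_ge0// exprn_gt0// mulr_gt0.
  rewrite /p /phi (_ : b * b - 1 = - (c * c)); last by rewrite cE; ring.
  move: (y x) (m x) y0 nz => y1 m1 y10 nz.
  by field; rewrite nz !gt_eqF.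
apply: (@integral_le_primitive R S N (32 / sig) SI S_bounded (fun x => (y x)^-1) measurable_y
  _ _ (fun x => - atan (p x)) phi c^-1) => //.
- by move=> x; rewrite invr_ge0 sqrtr_ge0.
- by rewrite divr_ge0 ?ltW.
- move=> x Sx; have [y0 _] := yP _ Sx; have [Q0 _ _ _] := SP Sx.
  have dy := is_derive_y Q0; have yn0 : y x != 0 by rewrite gt_eqF.
  have dV := is_deriveV yn0 dy.
  have dc : is_derive x 1 (fun=> c) (0 : R) by exact: is_derive_cst.
  exact: (is_derive_continuous (is_deriveM dc dV)).
- by move=> x Sx; rewrite /phi mulrA mulVf ?gt_eqF// mul1r.
- by rewrite invr_ge0 ltW.
- by move=> x Sx; rewrite /phi mulr_ge0 ?invr_ge0 ?sqrtr_ge0 ?ltW.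
- move=> x z Sx Sz.
  have h := atan_sub_lt4 (p z) (p x).
  have : c^-1 <= 2 / sig.
    by rewrite -[2 / sig]invrK lef_pV2 ?posrE ?invr_gt0 ?divr_gt0// invf_div ltW.
  have ci0 : 0 < c^-1 by rewrite invr_gt0.
  have si0 : 0 < sig^-1 by rewrite invr_gt0.
  move: (atan (p z)) (atan (p x)) h c^-1 ci0 => A B h e e0 k.
  have h' : (- A) - (- B) <= 4 by lra.
  by apply: (le_trans (ler_wpM2l (ltW e0) h')); lra.
Qed.

Let case2 : 1 - b * b <= sig ^+ 2 / 4 ->
  (\int[lam]_(x in S) ((y x)^-1)%:E <= (32 / sig)%:E)%E.
Proof.
move=> Bs; have [->|/set0P[x0 Sx0]] := eqVneq S set0.
  by rewrite integral_set0 lee_fin divr_ge0 ?ltW.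
have s0 : sig * N / 2 <= `|s|.
  have [_ h1 _ h2] := SP Sx0; apply: le_trans h2.
  by rewrite -mulrA ler_wpM2l// ltW.
(* In this regime [s ^ 2 - (1 - b ^ 2) * l ^ 2] is at least [3 / 4 * s ^ 2], which leaves room for
   [v ^ 2 = s ^ 2 / 4]. *)
pose v := `|s| / 2.
have v0 : 0 < v by rewrite divr_gt0// (lt_le_trans _ s0)// divr_gt0// mulr_gt0.
pose p x := y x * v^-1.
pose phi x := m x * v * (y x * (v * v + y x * y x))^-1.
have yP x : S x -> 0 < y x /\ y x * y x = Q x.
  by move=> /SP[Q0 _ _ _]; rewrite /y sqrtr_gt0 -expr2 sqr_sqrtr// ltW.
(* [m = Q' / 2], so [1 / y] is at most a multiple of [(atan (y / v))']. *)
have mP x : S x -> v * v + Q x <= 2 * N * m x.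
  move=> Sx; have [Q0 l1 l2 l3] := SP Sx.
  have lx0 : 0 < l x by apply: lt_trans l1; rewrite divr_gt0.
  have vE : v * v = s * s / 4.
    by rewrite /v -[s * s]expr2 -(real_normK (num_real s)); field.
  have sl : sig ^+ 2 * (l x * l x) <= s * s.
    rewrite -[s * s]expr2 -(real_normK (num_real s)) -expr2 -exprMn lerXn2r// nnegrE.
    by rewrite mulr_ge0 ?ltW.
  have Bl : (1 - b * b) * (l x * l x) <= s * s / 4.
    apply: (@le_trans _ _ (sig ^+ 2 / 4 * (l x * l x))); first exact: ler_wpM2r (mulr_ge0 (ltW lx0) (ltW lx0)) _ _ Bs.
    by rewrite mulrAC ler_pM2r ?invr_gt0.
  have e1 : (b * l x) ^+ 2 - x ^+ 2 = Q x + s * s - (1 - b * b) * (l x * l x).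
    by rewrite /Q; ring.
  have e2 : v * v + Q x <= (b * l x) ^+ 2 - x ^+ 2.
    by rewrite e1 vE; have := sqr_ge0 s; rewrite expr2; lra.
  have bl0 : 0 <= b * l x by exact: mulr_ge0 b0 (ltW lx0).
  have vq0 : 0 < v * v + Q x by exact: addr_gt0 (mulr_gt0 v0 v0) Q0.
  have xbl : `|x| <= b * l x.
    rewrite -(@ler_pXn2r _ 2) ?nnegrE// real_normK ?num_real//.
    by rewrite -subr_ge0; apply: le_trans e2; exact: ltW.
  apply: (le_trans e2); rewrite subr_sqr -/(m x) mulrC ler_wpM2r//.
    by rewrite /m subr_ge0; exact: ler_normlW.
  have : b * l x <= N by apply: le_trans l2; rewrite ler_piMl// ltW.
  by have := ler_normlW xbl; lra.
have m0 x : S x -> 0 < m x.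
  move=> Sx; have [Q0 _ _ _] := SP Sx.
  have N2 : 0 < 2 * N by exact: mulr_gt0 _ N0.
  rewrite -(pmulr_rgt0 _ N2).
  by apply: lt_le_trans (mP x Sx); exact: addr_gt0 (mulr_gt0 v0 v0) Q0.
have dPhi x : S x -> is_derive x 1 (fun x => atan (p x)) (phi x).
  move=> Sx; have [y0 yE] := yP _ Sx; have [Q0 _ _ _] := SP Sx; have dy := is_derive_y Q0.
  have dp : is_derive x 1 p (m x / y x * v^-1).
    by apply: is_derive_eq; rewrite /GRing.scale/=; ring.
  apply: (is_derive_eq (is_derive1_comp (is_derive1_atan (p x)) dp)).
  have nz : v ^+ 2 + y x ^+ 2 != 0 by rewrite gt_eqF// addr_gt0 ?exprn_gt0.
  have nz' : v * v + y x * y x != 0 by rewrite -!expr2.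
  by rewrite /p /phi; field; rewrite ?nz ?nz' !gt_eqF.
have k0 : 0 < 2 * N / v by rewrite divr_gt0// mulr_gt0.
apply: (@integral_le_primitive R S N (32 / sig) SI S_bounded (fun x => (y x)^-1) measurable_y
  _ _ (fun x => atan (p x)) phi (2 * N / v)) => //.
- by move=> x; rewrite invr_ge0 sqrtr_ge0.
- by rewrite divr_ge0 ?ltW.
- move=> x Sx; have [y0 _] := yP _ Sx; have [Q0 _ _ _] := SP Sx.
  have dy := is_derive_y Q0; have dm := is_derive_m x.
  have nz : y x * (v * v + y x * y x) != 0.
    by rewrite gt_eqF//; exact: mulr_gt0 y0 (addr_gt0 (mulr_gt0 v0 v0) (mulr_gt0 y0 y0)).
  have dd : is_derive x 1 (fun x => y x * (v * v + y x * y x))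
      (m x / y x * (v * v + 3 * (y x * y x))).
    by apply: is_derive_eq; rewrite /GRing.scale/=; ring.
  have dV := @is_deriveV _ (fun x => y x * (v * v + y x * y x)) x _ 1 nz dd.
  have dmv : is_derive x 1 (fun x => m x * v) ((b * b - 1) * v).
    by apply: is_derive_eq; rewrite /GRing.scale/=; ring.
  exact: (is_derive_continuous (is_deriveM dmv dV)).
- move=> x Sx; have [y0 yE] := yP _ Sx; have := mP x Sx; rewrite -yE => h.
  have w0 : 0 < v * v + y x * y x by exact: addr_gt0 (mulr_gt0 v0 v0) (mulr_gt0 y0 y0).
  rewrite /phi (_ : _ * (_ / _) = (y x)^-1 * (2 * N * m x / (v * v + y x * y x))); last first.
    by field; rewrite !gt_eqF.
  by apply: ler_peMr; [rewrite invr_ge0 ltW|rewrite ler_pdivlMr// mul1r].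
- exact: ltW.
- move=> x Sx; have [y0 yE] := yP _ Sx.
  by rewrite /phi ltW// mulr_gt0 ?invr_gt0//; [exact: mulr_gt0 (m0 x Sx) v0|exact: mulr_gt0 y0 (addr_gt0 (mulr_gt0 v0 v0) (mulr_gt0 y0 y0))].
- move=> x z Sx Sz; apply: (@le_trans _ _ (2 * N / v * 4)).
    by rewrite ler_wpM2l ?(ltW k0)//; exact: atan_sub_lt4.
  rewrite mulrAC ler_pdivrMr// /v.
  have -> : 32 / sig * (`|s| / 2) = 16 / sig * `|s| by field; rewrite gt_eqF.
  apply: (@le_trans _ _ (16 / sig * (sig * N / 2))); last first.
    by rewrite ler_wpM2l// divr_ge0 ?ltW.
  by rewrite (_ : 16 / sig * (sig * N / 2) = 8 * N); [lra|field; rewrite gt_eqF].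
Qed.

(** The threshold [sig ^ 2 / 4] separates two regimes, and an arctangent oscillates by less than 4.
    Above it the primitive carries [c^-1 <= 2 / sig], so [8 / sig] would do; below it the bound is
    [8 * N / v] with [v >= sig * N / 4], and this gives the 32. *)
Lemma elliptic_integral_le : (\int[lam]_(x in S) ((y x)^-1)%:E <= (32 / sig)%:E)%E.
Proof. by have [/case2|/case1] := leP (1 - b * b) (sig ^+ 2 / 4). Qed.

End elliptic_integral.

(** * Planar sections of ellipsoidal shells *)

Section ellipse_slices.
Context (R : realType).
Local Notation lam := (@lebesgue_measure R).

(* On the ellipse [r1 + r2 = T] one has [r1 = semi_focal k T], [k] being
   [r1 ^ 2 - r2 ^ 2]. *)
Definition semi_focal (k T : R) : R := (T + k / T) / 2.

Lemma semi_focal_opp (k T : R) : T - semi_focal k T = semi_focal (- k) T.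
Proof. by rewrite /semi_focal; lra. Qed.

(** The function [T + k / T] increases where [T ^ 2 >= k]. *)
Lemma semi_focal_le (k A T : R) : 0 < A -> A <= T -> k <= A * A ->
  semi_focal k A <= semi_focal k T.
Proof.
move=> A0 AT kA; have T0 : 0 < T by apply: lt_le_trans AT.
have AT0 : 0 < A * T by rewrite mulr_gt0.
have kAT : k <= A * T by apply: (le_trans kA); rewrite ler_pM2l.
rewrite -subr_ge0 /semi_focal.
have -> : (T + k / T) / 2 - (A + k / A) / 2 = (T - A) * (A * T - k) / (A * T) / 2.
  by field; rewrite !gt_eqF.
by rewrite !divr_ge0 ?mulr_ge0 ?subr_ge0// ?ltW// mulr_gt0.
Qed.

Lemma semi_focal_sqr (r1 r2 : R) : 0 < r1 + r2 ->
  semi_focal (r1 * r1 - r2 * r2) (r1 + r2) = r1.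
Proof. by move=> h; rewrite /semi_focal; field; rewrite gt_eqF. Qed.

Lemma is_derive_semi_focal (k T : R) : 0 < T ->
  is_derive T 1 (semi_focal k) ((T - semi_focal k T) / T).
Proof.
move=> T0; have Tn0 : T != 0 by rewrite gt_eqF.
have dV := @is_deriveV _ (@id R) T _ 1 Tn0 (is_derive_id T 1).
rewrite /semi_focal; apply: is_derive_eq; rewrite /GRing.scale/=.
by field.
Qed.

Lemma is_derive_ellipse (k w T : R) : 0 < T -> 0 < semi_focal k T * semi_focal k T - w ->
  is_derive T 1 (fun T => Num.sqrt (semi_focal k T * semi_focal k T - w))
   (semi_focal k T * (T - semi_focal k T) * (T * Num.sqrt (semi_focal k T * semi_focal k T - w))^-1).
Proof.
move=> T0 q0; have dl := is_derive_semi_focal k T0.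
have dq : is_derive T 1 (fun T => semi_focal k T * semi_focal k T - w)
    (2 * semi_focal k T * ((T - semi_focal k T) / T)).
  by apply: is_derive_eq; rewrite /GRing.scale/=; ring.
have ds := is_derive1_sqrt q0.
apply: (is_derive_eq (@is_derive1_comp _ _ (fun T => semi_focal k T * semi_focal k T - w) T _ _ ds dq)).
have y0 : Num.sqrt (semi_focal k T * semi_focal k T - w) != 0 by rewrite gt_eqF// sqrtr_gt0.
by field; rewrite y0 gt_eqF.
Qed.

(** The change of variable from [y] to [T] on a vertical line, in the form of the fundamental
    theorem of calculus. Monotonicity of [semi_focal] propagates the hypotheses from [A] to all
    [T >= A]. *)
Lemma ellipse_ordinate (k w A B : R) : 0 < A -> A <= B -> `|k| <= A * A ->
  0 <= semi_focal k A -> w < semi_focal k A * semi_focal k A ->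
  (\int[lam]_(T in `[A, B])
     (semi_focal k T * (T - semi_focal k T) *
      (T * Num.sqrt (semi_focal k T * semi_focal k T - w))^-1)%:E =
   (Num.sqrt (semi_focal k B * semi_focal k B - w) -
    Num.sqrt (semi_focal k A * semi_focal k A - w))%:E)%E.
Proof.
move=> A0 AB kA lA wA.
have P T : A <= T <= B -> 0 < T /\ 0 < semi_focal k T * semi_focal k T - w.
  move=> /andP[AT _]; split; first exact: lt_le_trans AT.
  rewrite subr_gt0; apply: (lt_le_trans wA).
  have h := semi_focal_le A0 AT (le_trans (ler_norm k) kA).
  exact: ler_pM.
apply: (@FTC_is_derive R _ (fun T => Num.sqrt (semi_focal k T * semi_focal k T - w)) A B AB).
  by move=> T /P[T0 q0]; exact: is_derive_ellipse.
move=> T /P[T0 q0].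
have dy := is_derive_ellipse T0 q0; have dl := is_derive_semi_focal k T0.
have nz : T * Num.sqrt (semi_focal k T * semi_focal k T - w) != 0.
  by rewrite gt_eqF// mulr_gt0// sqrtr_gt0.
have dd := is_deriveM (is_derive_id T 1) dy.
have dV := @is_deriveV _ (fun T => T * Num.sqrt (semi_focal k T * semi_focal k T - w)) T _ 1 nz dd.
have dn : is_derive T 1 (fun T => T - semi_focal k T) (1 - (T - semi_focal k T) / T).
  exact: (is_deriveB (is_derive_id T 1) dl).
exact: (is_derive_continuous (is_deriveM (is_deriveM dl dn) dV)).
Qed.

End ellipse_slices.

Lemma normr_subrMM_le (R : realType) (r1 r2 : R) : 0 <= r1 -> 0 <= r2 ->
  `|r1 * r1 - r2 * r2| <= (r1 + r2) * (r1 + r2).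
Proof.
move=> h1 h2; have := mulr_ge0 h1 h1; have := mulr_ge0 h1 h2; have := mulr_ge0 h2 h2.
by rewrite ler_norml => *; apply/andP; split; lra.
Qed.

Lemma mulr_le_minMD (R : realType) (l m N1 N2 : R) : 0 <= l -> 0 <= m -> l <= N1 -> m <= N2 ->
  l * m <= Num.min N1 N2 * (l + m).
Proof.
move=> l0 m0 lN mN; have lm : l * m <= N1 * (l + m).
  have := ler_wpM2r m0 lN; have := mulr_ge0 (le_trans l0 lN) l0; lra.
have lm' : l * m <= N2 * (l + m).
  have := ler_wpM2l l0 mN; have := mulr_ge0 (le_trans m0 mN) m0; lra.
by rewrite minEle; case: ifP.
Qed.

(** The triangle inequality for the two foci, along the first axis; it gives the slope bound
    [d / T <= 1]. *)
Lemma focal_distance_le (R : realType) (s d x l m : R) : 0 <= l -> 0 <= m ->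
  0 <= l * l - (s * s + x * x) -> (d - x) * (d - x) <= m * m -> d <= l + m.
Proof.
move=> l0 m0 q0 dm; have xl : `|x| <= l.
  rewrite -(@ler_pXn2r _ 2) ?nnegrE// real_normK ?num_real// !expr2.
  by have := sqr_ge0 s; rewrite expr2; lra.
have dx : `|d - x| <= m by rewrite -(@ler_pXn2r _ 2) ?nnegrE// real_normK ?num_real.
by have := ler_norm x; have := ler_norm (d - x); lra.
Qed.

(** The leading coefficient [b ^ 2 - 1] is nonpositive, so [q] is concave and positivity at the two
    outer points passes to the middle one. *)
Lemma quadratic_concave_gt0 (R : realType) (b a s x y z : R) : 0 <= b -> b <= 1 -> x <= y -> y <= z ->
  let q x := (a + b * x) * (a + b * x) - (s * s + x * x) in
  0 < q x -> 0 < q z -> 0 < q y.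
Proof.
move=> b0 b1 xy yz q qx qz; have [<-//|xy'] := eqVneq x y.
have {xy xy'} xy : 0 < y - x by rewrite subr_gt0 lt_neqAle xy'.
rewrite -(@pmulr_lgt0 _ (z - x)); last by lra.
have -> : q y * (z - x) = q x * (z - y) + q z * (y - x) +
    (1 - b * b) * (y - x) * (z - y) * (z - x) by rewrite /q; ring.
have bb : 0 <= 1 - b * b by rewrite subr_ge0; apply: mulr_ile1.
have zy : 0 <= z - y by lra.
have zx : 0 <= z - x by lra.
apply: ltr_pwDl; last by do 3 (apply: mulr_ge0 => //; try exact: ltW).
by rewrite ltr_wpDl ?mulr_gt0// mulr_ge0// ltW.
Qed.

Section ellipse_area.
Context (R : realType).
Local Notation lam := (@lebesgue_measure R).
Local Notation plane := (measurableTypeR R * measurableTypeR R)%type.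
Variables (s t d N1 N2 sig T0 T1 : R).
Hypotheses (N1_gt0 : 0 < N1) (N2_gt0 : 0 < N2) (sig_gt0 : 0 < sig) (d_ge0 : 0 <= d) (T01 : T0 <= T1).

(** With [r2], the distances from [p] to two foci lying at heights [s] and [t] off the plane, above
    the points [0] and [d] of the first axis. *)
Let r1 (p : plane) : R := Num.sqrt (s * s + p.1 * p.1 + p.2 * p.2).
Let r2 (p : plane) : R := Num.sqrt (t * t + (d - p.1) * (d - p.1) + p.2 * p.2).

Definition ellipse_annulus : set plane :=
  [set p | [&& N1 / 2 < r1 p, r1 p <= N1, r2 p <= N2, sig * r1 p <= `|s|,
               T0 <= r1 p + r2 p & r1 p + r2 p <= T1]].

(** This is [r1 ^ 2 - r2 ^ 2], in which the ordinate cancels; hence [el (x, T)] is [r1] as a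
    function of the abscissa and the focal sum. *)
Let kf (x : R) : R := s * s - t * t - d * d + 2 * d * x.
Let el (p : plane) : R := semi_focal (kf p.1) p.2.
Let q (p : plane) : R := el p * el p - (s * s + p.1 * p.1).
Let Nm : R := Num.min N1 N2.

(** The annulus in the coordinates [(x, T)]: [el] and [p.2 - el] stand for [r1] and [r2], and [q]
    for the squared ordinate. *)
Let G : set plane :=
  [set p | [&& T0 <= p.2 <= T1, 0 < p.2, 0 < q p, N1 / 2 < el p <= N1, sig * el p <= `|s|,
               0 <= p.2 - el p & p.2 - el p <= N2]].
(** Majorant of the density [dy / dT], from [r1 * r2 / (r1 + r2) <= Nm]. *)
Let h (p : plane) : R := \1_G p * (Nm * (Num.sqrt (q p))^-1).

Let Nm0 : 0 < Nm. Proof. by rewrite lt_min N1_gt0. Qed.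

Let measurable_el : measurable_fun setT el.
Proof.
have mk : measurable_fun setT (fun p : plane => kf p.1).
  apply: measurable_funD; first exact: measurable_cst.
  by apply: measurable_funM; [exact: measurable_cst|exact: measurable_fst].
apply: measurable_funM; last exact: measurable_cst.
apply: measurable_funD; first exact: measurable_snd.
apply: measurable_funM; first exact: mk.
exact: (measurableT_comp (measurable_invR (R := R)) measurable_snd).
Qed.

Let measurable_q : measurable_fun setT q.
Proof.
apply: measurable_funB; first exact: measurable_funM.
apply: measurable_funD; first exact: measurable_cst.
by apply: measurable_funM; exact: measurable_fst.
Qed.

Let measurable_G : measurable G.
Proof.
have c (x : R) : measurable_fun setT (fun _ : plane => x) by exact: measurable_cst.
have m1 : measurable_fun setT (fun p : plane => p.2 : R) by exact: measurable_snd.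
have m2 : measurable_fun setT (fun p => sig * el p) by exact: measurable_funM.
have m3 : measurable_fun setT (fun p : plane => (p.2 : R) - el p) by exact: measurable_funB.
rewrite -[G]setTI; apply: (_ : measurable_fun setT (fun p => [&& _, _, _, _, _, _ & _])) => //.
repeat first [assumption|exact: c|apply: measurable_and|apply: measurable_fun_ler|apply: measurable_fun_ltr].
Qed.

Let measurable_h : measurable_fun setT h.
Proof.
apply: measurable_funM; first exact: measurable_indic.
apply: measurable_funM; first exact: measurable_cst.
apply: (measurableT_comp (measurable_invR (R := R))).
apply: measurableT_comp measurable_q; apply: continuous_measurable_fun.
exact: sqrt_continuous.
Qed.

Lemma measurable_ellipse_annulus : measurable ellipse_annulus.
Proof.
have c (x : R) : measurable_fun setT (fun _ : plane => x) by exact: measurable_cst.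
have m1 : measurable_fun setT (fun p : plane => p.1 : R) by exact: measurable_fst.
have m2 : measurable_fun setT (fun p : plane => p.2 : R) by exact: measurable_snd.
have ms : measurable_fun setT (@Num.sqrt R).
  by apply: continuous_measurable_fun; exact: sqrt_continuous.
have mr1 : measurable_fun setT r1.
  apply: (measurableT_comp ms); apply: measurable_funD; last exact: measurable_funM.
  by apply: measurable_funD => //; exact: measurable_funM.
have mr2 : measurable_fun setT r2.
  apply: (measurableT_comp ms); apply: measurable_funD; last exact: measurable_funM.
  by apply: measurable_funD => //; apply: measurable_funM; exact: measurable_funB.
have m3 : measurable_fun setT (fun p => sig * r1 p) by exact: measurable_funM.
have m4 : measurable_fun setT (fun p => r1 p + r2 p) by exact: measurable_funD.
rewrite -[ellipse_annulus]setTI; apply: (_ : measurable_fun setT (fun p => [&& _, _, _, _, _ & _])) => //.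
repeat first [assumption|exact: c|apply: measurable_and|apply: measurable_fun_ler|apply: measurable_fun_ltr].
Qed.

Let S (x : R) : set R := [set y | 0 < y /\ ellipse_annulus (x, y)].

Let r1_mono (x y z : R) : 0 <= y -> y <= z -> r1 (x, y) <= r1 (x, z).
Proof.
move=> y0 yz; rewrite /r1 /= ler_wsqrtr// lerD2l; exact: ler_pM.
Qed.

Let r2_mono (x y z : R) : 0 <= y -> y <= z -> r2 (x, y) <= r2 (x, z).
Proof.
move=> y0 yz; rewrite /r2 /= ler_wsqrtr// lerD2l; exact: ler_pM.
Qed.

Let sq0 (x : R) : 0 <= x * x. Proof. by rewrite -expr2 sqr_ge0. Qed.

Let r1_sqr p : r1 p * r1 p = s * s + p.1 * p.1 + p.2 * p.2.
Proof. by rewrite -expr2 sqr_sqrtr// !addr_ge0. Qed.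

Let r2_sqr p : r2 p * r2 p = t * t + (d - p.1) * (d - p.1) + p.2 * p.2.
Proof. by rewrite -expr2 sqr_sqrtr// !addr_ge0. Qed.

Let r1_ge0 p : 0 <= r1 p. Proof. exact: sqrtr_ge0. Qed.
Let r2_ge0 p : 0 <= r2 p. Proof. exact: sqrtr_ge0. Qed.

Let S_interval x : is_interval (S x).
Proof.
move=> a b [a0 /and5P[a1 a2 a3 a4 /andP[a5 a6]]] [b0 /and5P[b1 b2 b3 b4 /andP[b5 b6]]] y /andP[ay yb].
have y0 : 0 < y by apply: lt_le_trans ay.
split=> //; have h1 := r1_mono x (ltW a0) ay; have h2 := r2_mono x (ltW a0) ay.
have k1 := r1_mono x (ltW y0) yb; have k2 := r2_mono x (ltW y0) yb.
apply/and5P; split.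
- exact: lt_le_trans h1.
- exact: le_trans k1 _.
- exact: le_trans k2 _.
- by apply: le_trans b4; rewrite ler_pM2l.
- apply/andP; split; first exact: (le_trans a5 (lerD h1 h2)).
  exact: (le_trans (lerD k1 k2) b6).
Qed.

Let S_bounded x y : S x y -> `|y| <= N1.
Proof.
move=> [y0 /and5P[_ k _ _ _]]; rewrite gtr0_norm//; apply: le_trans k.
have e : Num.sqrt (y * y) = y by rewrite -expr2 sqrtr_sqr gtr0_norm.
by rewrite -[leLHS]e ler_wsqrtr//= lerDr addr_ge0.
Qed.

Let h_ge0 p : 0 <= h p.
Proof. by rewrite mulr_ge0// mulr_ge0 ?invr_ge0 ?sqrtr_ge0// ltW. Qed.

Let kfE x y : kf x = r1 (x, y) * r1 (x, y) - r2 (x, y) * r2 (x, y).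
Proof. by rewrite r1_sqr r2_sqr /kf /=; ring. Qed.

(** Going up from [a] to [b] both distances increase, so each constraint of [G] at an intermediate
    [T] follows from the one at an endpoint; then [b - a] is the integral of [dy / dT]. *)
Let slice_len_le x a b : S x a -> S x b -> a < b ->
  ((b - a)%:E <= \int[lam]_T (h (x, T))%:E)%E.
Proof.
move=> [a0 Ea] [b0 Eb] ab.
have A1 : 0 < r1 (x, a).
  by move: Ea => /and5P[k _ _ _ _]; apply: lt_trans k; rewrite divr_gt0.
pose A := r1 (x, a) + r2 (x, a); pose B := r1 (x, b) + r2 (x, b).
have A0 : 0 < A by exact: ltr_wpDr (r2_ge0 _) A1.
have h1 := r1_mono x (ltW a0) (ltW ab); have h2 := r2_mono x (ltW a0) (ltW ab).
have AB : A <= B by exact: lerD.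
have B0 : 0 < B by exact: lt_le_trans AB.
have kA : `|kf x| <= A * A.
  by rewrite (kfE x a) normr_subrMM_le.
have lA : semi_focal (kf x) A = r1 (x, a) by rewrite (kfE x a); exact: semi_focal_sqr.
have lB : semi_focal (kf x) B = r1 (x, b) by rewrite (kfE x b); exact: semi_focal_sqr.
pose w := s * s + x * x.
have wA : w < semi_focal (kf x) A * semi_focal (kf x) A.
  by rewrite lA r1_sqr /= ltrDl mulr_gt0.
have lA0 : 0 <= semi_focal (kf x) A by rewrite lA.
have E := ellipse_ordinate A0 AB kA lA0 wA.
have Ya : Num.sqrt (semi_focal (kf x) A * semi_focal (kf x) A - w) = a.
  by rewrite lA r1_sqr /= addrAC subrr add0r -expr2 sqrtr_sqr gtr0_norm.
have Yb : Num.sqrt (semi_focal (kf x) B * semi_focal (kf x) B - w) = b.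
  by rewrite lB r1_sqr /= addrAC subrr add0r -expr2 sqrtr_sqr gtr0_norm.
rewrite Ya Yb in E; rewrite -E.
have P T : A <= T <= B -> [/\ 0 < T, w < el (x, T) * el (x, T), G (x, T),
    0 <= el (x, T) & 0 <= T - el (x, T)].
  move=> /andP[AT TB]; have T0' : 0 < T by exact: lt_le_trans AT.
  have kA1 : kf x <= A * A by exact: le_trans (ler_norm _) kA.
  have kA2 : - kf x <= A * A by apply: le_trans kA; rewrite -normrN ler_norm.
  have AAT : A * A <= T * T by exact: (ler_pM (ltW A0) (ltW A0) AT AT).
  have l1 : r1 (x, a) <= el (x, T) by rewrite -lA; exact: semi_focal_le.
  have l2 : el (x, T) <= r1 (x, b).
    by rewrite -lB; exact: semi_focal_le (le_trans kA1 AAT).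
  have eA : A - semi_focal (kf x) A = r2 (x, a) by rewrite lA /A; ring.
  have eB : B - semi_focal (kf x) B = r2 (x, b) by rewrite lB /B; ring.
  have l3 : r2 (x, a) <= T - el (x, T).
    by rewrite -eA /el/= !semi_focal_opp; exact: semi_focal_le.
  have l4 : T - el (x, T) <= r2 (x, b).
    by rewrite -eB /el/= !semi_focal_opp; exact: semi_focal_le (le_trans kA2 AAT).
  have l0 : 0 <= el (x, T) by apply: le_trans l1.
  have wT : w < el (x, T) * el (x, T).
    by apply: (lt_le_trans wA); rewrite lA; exact: ler_pM.
  have m0 : 0 <= T - el (x, T) by apply: le_trans l3.
  split=> //.
  move: Ea Eb => /and5P[a1 a2 a3 a4 /andP[a5 a6]] /and5P[b1 b2 b3 b4 /andP[b5 b6]].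
  apply/and5P; split => //=.
  - by rewrite (le_trans a5 AT) (le_trans TB b6).
  - by rewrite subr_gt0.
  - by rewrite (lt_le_trans a1 l1) (le_trans l2 b2).
  - apply/and3P; split => //; last exact: le_trans l4 b3.
    by apply: le_trans b4; rewrite ler_pM2l.
have mh : measurable_fun setT (fun T => (h (x, T))%:E).
  apply/measurable_EFinP; exact: (measurableT_comp measurable_h (measurable_pair1 x)).
apply: (@le_trans _ _ (\int[lam]_(T in `[A, B]) (h (x, T))%:E)%E); last first.
  apply: ge0_subset_integral => //.
  by move=> T _; rewrite lee_fin; exact: h_ge0.
apply: ge0_le_integral => //.
- move=> T; rewrite /= in_itv/= => /P[t0 tw _ l0 m0]; rewrite lee_fin.
  by apply: mulr_ge0; [exact: mulr_ge0|rewrite invr_ge0 mulr_ge0 ?sqrtr_ge0// ltW].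
- have mel : measurable_fun setT (semi_focal (kf x)).
    exact: (measurableT_comp measurable_el (measurable_pair1 x)).
  have ms : measurable_fun setT (@Num.sqrt R).
    by apply: continuous_measurable_fun; exact: sqrt_continuous.
  apply: (measurable_funS measurableT (@subsetT _ _)); apply/measurable_EFinP; apply: measurable_funM.
    by apply: measurable_funM => //; exact: measurable_funB.
  apply: (measurableT_comp (measurable_invR (R := R))); apply: measurable_funM => //.
  by apply: (measurableT_comp ms); apply: measurable_funB => //; exact: measurable_funM.
- exact: measurable_funS mh.
- move=> T; rewrite /= in_itv/= => /P[t0 tw GT l0 m0]; rewrite lee_fin.
  rewrite /h indicE mem_set// mul1r invfM mulrA ler_wpM2r ?invr_ge0 ?sqrtr_ge0//.
  rewrite ler_pdivrMr//; move: GT => /and5P[_ _ _ /andP[_ k1] /and3P[_ _ k2]].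
  have := mulr_le_minMD l0 m0 k1 k2; by rewrite subrKC.
Qed.

Let slice_le x : (lam (S x) <= \int[lam]_T (h (x, T))%:E)%E.
Proof.
apply: (@lebesgue_interval_le R (S x) N1).
- exact: S_interval.
- exact: S_bounded.
- by apply: integral_ge0 => T _; rewrite lee_fin.
- exact: slice_len_le.
Qed.

(** At fixed [T] the abscissas in [G] form an interval on which [r1] is affine with slope [d / T],
    the setting of [elliptic_integral_le]. *)
Let section_le (T : R) : (\int[lam]_x (h (x, T))%:E <= (\1_`[T0, T1] T * (32 / sig * Nm))%:E)%E.
Proof.
pose D : set R := [set x | G (x, T)].
pose l0 := (T + (s * s - t * t - d * d) / T) / 2.
have elE x : el (x, T) = l0 + d / T * x.
  by rewrite /el /semi_focal /kf /l0 /=; move: T^-1 => i; field.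
have [D0|/set0P[x0 Dx0]] := eqVneq D set0.
  rewrite integral0_eq ?lee_fin; last first.
    move=> x _; rewrite /h indicE memNset ?mul0r// => Gx.
    by have : D x by []; rewrite D0.
  by apply: mulr_ge0 => //; apply: mulr_ge0 (ltW Nm0); rewrite divr_ge0// ltW.
move: (Dx0) => /and5P[/= T01' Tp q0 /andP[l1 l2] /and3P[l3 l4 l5]].
have b0 : 0 <= d / T by rewrite divr_ge0// ltW.
have b1 : d / T <= 1.
  rewrite ler_pdivrMr// mul1r.
  (* As [q] is the squared ordinate, this says that [T - el] is the distance to the second focus. *)
  have m2 : (T - el (x0, T)) * (T - el (x0, T)) = q (x0, T) + t * t + (d - x0) * (d - x0).
    by rewrite /q /el /semi_focal /kf /=; field; rewrite gt_eqF.
  rewrite -[leRHS](subrKC (el (x0, T))).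
  apply: (@focal_distance_le _ s d x0) => //.
  - by apply: ltW; apply: lt_trans l1; rewrite divr_gt0.
  - exact: ltW.
  - by rewrite m2 lerDr addr_ge0// ltW.
have DI : is_interval D.
  move=> x z /and5P[_ _ x1 /andP[x2 x3] /and3P[x4 x5 x6]] /and5P[_ _ z1 /andP[z2 z3] /and3P[z4 z5 z6]].
  move=> y /andP[xy yz].
  have h1 : el (x, T) <= el (y, T) by rewrite !elE lerD2l ler_wpM2l.
  have h2 : el (y, T) <= el (z, T) by rewrite !elE lerD2l ler_wpM2l.
  apply/and5P; split => //=.
  - move: x1 z1; rewrite /q !elE /=; exact: quadratic_concave_gt0.
  - by rewrite (lt_le_trans x2 h1) (le_trans h2 z3).
  - apply/and3P; split => /=.
    + by apply: le_trans z4; rewrite ler_pM2l.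
    + by apply: le_trans z5 _; rewrite lerD2l lerN2.
    + by apply: le_trans x6; rewrite lerD2l lerN2.
have mD : measurable D by exact: is_interval_measurable.
have QE x : l0 + d / T * x = el (x, T) by rewrite elE.
have I := @elliptic_integral_le R l0 (d / T) s D N1 sig DI N1_gt0 sig_gt0 b0 b1.
pose g x := (Num.sqrt ((l0 + d / T * x) * (l0 + d / T * x) - s * s - x * x))^-1.
have hE x : h (x, T) = Nm * (\1_D x * g x).
  have e : ((x, T) \in G) = (x \in D) by apply/idP/idP; rewrite !inE.
  by rewrite /h !indicE e mulrCA /q elE /g opprD addrA.
have -> : \1_`[T0, T1] T = 1 :> R by rewrite indicE mem_set//= in_itv.
under eq_integral do rewrite hE.
have mg : measurable_fun setT g by exact: measurable_y.
rewrite ge0_integralZ_EFin ?(ltW Nm0)//; last 2 first.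
- by apply: measurable_funM => //; exact: measurable_indic.
- by move=> x; rewrite mulr_ge0// invr_ge0 sqrtr_ge0.
rewrite integral_indicM mul1r mulrC EFinM lee_wpmul2l ?lee_fin ?(ltW Nm0)//.
apply: I => x /and5P[/= _ _ q1 /andP[x1 x2] /and3P[x3 _ _]].
by rewrite -elE; split => //; move: q1; rewrite /q /= opprD addrA.
Qed.

Let upper : set plane := [set p | 0 < (p.2 : R)].

(** Slices at fixed [x] are bounded by integrals in [T]; Tonelli exchanges the order, and the bound
    at fixed [T] is integrated over [[T0, T1]]. *)
Let area_upper : (@mu2 R (ellipse_annulus `&` upper) <=
  (32 / sig * Nm * (T1 - T0))%:E)%E.
Proof.
have mu : measurable upper.
  rewrite -[upper]setTI; apply: (_ : measurable_fun setT (fun p : plane => (0 : R) < p.2)) => //.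
  apply: measurable_fun_ltr => //; exact: measurable_snd.
rewrite /mu2 /product_measure1.
apply: (@le_trans _ _ (\int[lam]_x \int[lam]_T (h (x, T))%:E)%E).
  apply: ge0_le_integral => //.
  - exact: (measurable_fun_xsection _ (measurableI _ _ measurable_ellipse_annulus mu)).
  - apply: (measurable_fun_fubini_tonelli_F (m2 := lam) (fun p => (h p)%:E)).
    + exact/measurable_EFinP.
    + by move=> p; rewrite lee_fin.
  - move=> x _; rewrite /= (_ : xsection _ _ = S x); first exact: slice_le.
    by apply/seteqP; split=> y; rewrite /xsection /= inE => -[].
rewrite (fubini_tonelli (fun p => (h p)%:E)); last 2 first.
- exact/measurable_EFinP.
- by move=> p; rewrite lee_fin.
apply: (@le_trans _ _ (\int[lam]_T (32 / sig * Nm * \1_`[T0, T1] T)%:E)%E).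
  apply: ge0_le_integral => //.
  - by move=> T _; apply: integral_ge0 => x _; rewrite lee_fin.
  - apply: (measurable_fun_fubini_tonelli_G (m1 := lam) (fun p => (h p)%:E)).
    + exact/measurable_EFinP.
    + by move=> p; rewrite lee_fin.
  - apply/measurable_EFinP; apply: measurable_funM => //; exact: measurable_indic.
  - by move=> T _; rewrite mulrC; exact: section_le.
have c0 : 0 <= 32 / sig * Nm by apply: mulr_ge0 (ltW Nm0); rewrite divr_ge0// ltW.
have mi : measurable_fun setT (\1_`[T0, T1] : R -> R) by exact: measurable_indic.
rewrite ge0_integralZ_EFin// integral_indic// setIT [X in (_ * X)%E]lebesgue_measure_itv/= lte_fin.
case: ltP => h01; first by rewrite -EFinD -EFinM.
by rewrite mule0 lee_fin mulr_ge0// subr_ge0.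
Qed.

(** Reflection in the first axis doubles the upper half, and the axis itself is null:
    [64 = 2 * 32]. *)
Lemma ellipse_annulus_le :
  (@mu2 R ellipse_annulus <= (64 / sig * Num.min N1 N2 * (T1 - T0))%:E)%E.
Proof.
pose neg (p : plane) : plane := (p.1, - (p.2 : R)).
have mneg : mpres (@mu2 R) (@mu2 R) neg.
  have mN : measurable_fun setT (fun y : measurableTypeR R => (- y : measurableTypeR R)).
    exact: measurableT_comp.
  apply: (@mpres_skew_snd _ _ _ _ R lam lam (fun _ y => - y)) => [|_].
    exact: (measurableT_comp mN measurable_snd).
  exact: mpres_lebesgueN.
have mU : measurable upper.
  rewrite -[upper]setTI; apply: (_ : measurable_fun setT (fun p : plane => (0 : R) < p.2)) => //.
  apply: measurable_fun_ltr => //; exact: measurable_snd.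
have mEU := measurableI _ _ measurable_ellipse_annulus mU.
have mnEU : measurable (neg @^-1` (ellipse_annulus `&` upper)).
  by rewrite -[X in measurable X]setTI; exact: mneg.1.
have m0 : measurable ([set: measurableTypeR R] `*` [set 0%R : measurableTypeR R]).
  exact: measurableX.
have m00 : (@mu2 R ([set: measurableTypeR R] `*` [set 0%R : measurableTypeR R]) = 0)%E.
  rewrite /mu2 product_measure1E//.
  by rewrite [X in (_ * X)%E]lebesgue_measure_set1 mule0.
apply: (@le_trans _ _ (@mu2 R ((ellipse_annulus `&` upper) `|`
    (neg @^-1` (ellipse_annulus `&` upper)) `|`
    ([set: measurableTypeR R] `*` [set 0%R : measurableTypeR R])))).
  apply: le_measure; rewrite ?inE; [exact: measurable_ellipse_annulus| |].
    by apply: measurableU => //; exact: measurableU.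
  move=> [x y] Exy; have [y0|y0|y0] := ltgtP y 0; last by right.
  - left; right; split; last by rewrite /upper /neg/= oppr_gt0.
    by move: Exy; rewrite /ellipse_annulus /r1 /r2/= mulrNN.
  - by left; left.
apply: (le_trans (measureU2 _ _ _)) => //; first exact: measurableU.
pose c := (32 / sig * Nm * (T1 - T0))%:E.
apply: (@le_trans _ _ (c + c + 0)%E); last first.
  by rewrite adde0 -EFinD lee_fin -mulrDl -mulrDl -mulrDl -natrD.
apply: leeD; last by rewrite le_eqVlt; apply/orP; left; apply/eqP; exact: m00.
apply: (le_trans (measureU2 _ _ _)) => //; apply: leeD; first exact: area_upper.
apply: le_trans area_upper.
by rewrite le_eqVlt; apply/orP; left; apply/eqP; exact: (mneg.2 _ mEU).
Qed.

End ellipse_area.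

(** * Rotations of space *)

Section rotations.
Context (R : realType).
Local Notation lam := (@lebesgue_measure R).
Local Notation line := (measurableTypeR R).
Local Notation plane := (measurableTypeR R * measurableTypeR R)%type.
Local Notation V := (vec3 R).

Lemma mpres_id d (T : measurableType d) (m : set T -> \bar R) : mpres m m id.
Proof. by split=> //; exact: measurable_id. Qed.

Lemma mpres_shear_fst (k : R) :
  mpres (@mu2 R) (@mu2 R) (fun p : plane => ((p.1 : R) + k * p.2, p.2) : plane).
Proof.
apply: (@mpres_skew_fst _ _ _ _ R lam lam (fun y x : line => (x : R) + k * y : line)).
  by apply: measurable_funD; [exact: measurable_fst|apply: measurable_funM => //; exact: measurable_snd].
by move=> y; exact: mpres_lebesgueD.
Qed.

Lemma mpres_shear_snd (k : R) :
  mpres (@mu2 R) (@mu2 R) (fun p : plane => (p.1, (p.2 : R) + k * p.1) : plane).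
Proof.
apply: (@mpres_skew_snd _ _ _ _ R lam lam (fun x y : line => (y : R) + k * x : line)).
  by apply: measurable_funD; [exact: measurable_snd|apply: measurable_funM => //; exact: measurable_fst].
by move=> x; exact: mpres_lebesgueD.
Qed.

Lemma mpres_shear23 (k : R) : mpres (@mu3 R) (@mu3 R)
  (fun v : V => ((v.1.1, (v.1.2 : R) + k * v.2), v.2) : V).
Proof.
apply: (@mpres_skew_fst _ _ _ _ R (@mu2 R) lam
    (fun (z : line) (p : plane) => (p.1, (p.2 : R) + k * z) : plane)).
  apply: measurable_fun_pair.
    exact: (measurableT_comp measurable_fst measurable_fst).
  apply: measurable_funD; first exact: (measurableT_comp measurable_snd measurable_fst).
  by apply: measurable_funM => //; exact: measurable_snd.
by move=> z; exact: (mpres_prod (mpres_id _) (mpres_lebesgueD _)).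
Qed.

Lemma mpres_shear32 (k : R) : mpres (@mu3 R) (@mu3 R)
  (fun v : V => (v.1, (v.2 : R) + k * v.1.2) : V).
Proof.
apply: (@mpres_skew_snd _ _ _ _ R (@mu2 R) lam
    (fun (p : plane) (z : line) => (z : R) + k * p.2 : line)).
  apply: measurable_funD; first exact: measurable_snd.
  by apply: measurable_funM => //; exact: (measurableT_comp measurable_snd measurable_fst).
by move=> z; exact: mpres_lebesgueD.
Qed.

(* A rotation is a product of three shears, which requires [c <> -1]. *)
Lemma rotation_shears (c s x y : R) : c * c + s * s = 1 -> 0 <= c ->
  let k := s / (1 + c) in
  let x1 := x + k * y in let y1 := y + (- s) * x1 in
  (x1 + k * y1 = c * x + s * y) * (y1 = c * y - s * x).
Proof.
move=> cs c0 k x1 y1.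
have c1 : 1 + c != 0 by rewrite gt_eqF//; lra.
have ks : k * s = 1 - c.
  by rewrite /k mulrAC (_ : s * s = (1 - c) * (1 + c)) ?mulfK//; move: cs; lra.
have kc : k * (1 + c) = s by rewrite /k divfK.
have e : y1 = c * y - s * x.
  rewrite /y1 /x1 (_ : _ + _ = (1 - k * s) * y - s * x); last by ring.
  by rewrite ks; ring.
split=> //; rewrite e /x1 (_ : _ + _ = (1 - k * s) * x + (k * (1 + c)) * y); last by ring.
by rewrite ks kc; ring.
Qed.

(** Invariance of the measure is part of the definition and is carried along compositions; for
    rotations it comes from their factorization into shears. *)
Definition isometry3 (f : V -> V) :=
  [/\ mpres (@mu3 R) (@mu3 R) f, (forall x y, f (x - y) = f x - f y) &
      forall x y, dot3 (f x) (f y) = dot3 x y].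

Lemma isometry3_comp f g : isometry3 f -> isometry3 g -> isometry3 (g \o f).
Proof.
move=> [f1 f2 f3] [g1 g2 g3]; split; first exact: mpres_comp f1 g1.
  by move=> x y /=; rewrite f2 g2.
by move=> x y /=; rewrite g3 f3.
Qed.

Definition rot12 (c s : R) (v : V) : V :=
  ((c * v.1.1 + s * v.1.2, c * v.1.2 - s * v.1.1), v.2).

Definition rot23 (c s : R) (v : V) : V :=
  ((v.1.1, c * v.1.2 + s * v.2), c * v.2 - s * v.1.2).

Lemma dot_rotation (c s x y x' y' : R) : c * c + s * s = 1 ->
  (c * x + s * y) * (c * x' + s * y') + (c * y - s * x) * (c * y' - s * x') = x * x' + y * y'.
Proof.
move=> cs; transitivity ((c * c + s * s) * (x * x' + y * y')); first by ring.
by rewrite cs mul1r.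
Qed.

Lemma isometry3_rot12 (c s : R) : c * c + s * s = 1 -> 0 <= c -> isometry3 (rot12 c s).
Proof.
move=> cs c0; split.
- pose k := s / (1 + c).
  have h := mpres_comp (mpres_comp (mpres_shear_fst k) (mpres_shear_snd (- s))) (mpres_shear_fst k).
  have := mpres_prod h (mpres_id lam).
  congr (mpres _ _ _); apply/funext => -[[x y] z]; rewrite /rot12 /=.
  by have [-> ->] := rotation_shears x y cs c0.
- by move=> [[x y] z] [[x' y'] z']; rewrite /rot12; congr (_, _, _) => /=; ring.
- move=> [[x y] z] [[x' y'] z']; rewrite /rot12 /dot3 /=; congr (_ + _).
  exact: dot_rotation.
Qed.

Lemma isometry3_rot23 (c s : R) : c * c + s * s = 1 -> 0 <= c -> isometry3 (rot23 c s).
Proof.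
move=> cs c0; split.
- pose k := s / (1 + c).
  have := mpres_comp (mpres_comp (mpres_shear23 k) (mpres_shear32 (- s))) (mpres_shear23 k).
  congr (mpres _ _ _); apply/funext => -[[x y] z]; rewrite /rot23 /=.
  by have [-> ->] := rotation_shears y z cs c0.
- by move=> [[x y] z] [[x' y'] z']; rewrite /rot23; congr (_, _, _) => /=; ring.
- move=> [[x y] z] [[x' y'] z']; rewrite /rot23 /dot3 /= -!addrA; congr (_ + _).
  exact: dot_rotation.
Qed.

Definition flip1 (v : V) : V := ((- (v.1.1 : R), v.1.2), v.2).

Lemma isometry3_flip1 : isometry3 flip1.
Proof.
split.
- have h : mpres (@mu2 R) (@mu2 R) (fun p : plane => (- (p.1 : R), p.2) : plane).
    exact: (mpres_prod (@mpres_lebesgueN R) (mpres_id lam)).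
  exact: (mpres_prod h (mpres_id lam)).
- by move=> [[x y] z] [[x' y'] z']; rewrite /flip1; congr (_, _, _) => /=; ring.
- by move=> [[x y] z] [[x' y'] z']; rewrite /flip1 /dot3 /= mulrNN.
Qed.

(** The unit vector along [(b, - a)], or its opposite when [b < 0]; the choice secures [0 <= c],
    which the factorization into shears relies on. *)
Lemma exists_rotation (a b : R) : exists c s : R,
  [/\ c * c + s * s = 1, 0 <= c & c * a + s * b = 0].
Proof.
pose r := Num.sqrt (a * a + b * b).
have sq (x : R) : 0 <= x * x by rewrite -expr2 sqr_ge0.
have rE : r * r = a * a + b * b by rewrite -expr2 sqr_sqrtr// addr_ge0.
have [r0|r0] := eqVneq r 0.
  exists 1, 0; move: rE; rewrite r0 mul0r => /esym/eqP.
  rewrite paddr_eq0// => /andP[/eqP a0 _]; split => //; first by ring.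
  by move: a0 => /eqP; rewrite mulf_eq0 orbb => /eqP ->; ring.
have rp : 0 <= r by exact: sqrtr_ge0.
have cs : (b / r) * (b / r) + (- a / r) * (- a / r) = 1.
  have -> : (b / r) * (b / r) + (- a / r) * (- a / r) = (a * a + b * b) / (r * r) by field.
  by rewrite rE divff// -rE mulf_neq0.
have o : (b / r) * a + (- a / r) * b = 0 by ring.
have [b0|b0] := leP 0 b.
  by exists (b / r), (- a / r); split => //; rewrite divr_ge0.
exists (- (b / r)), (- (- a / r)); split; first by rewrite !mulrNN.
  by rewrite -mulNr divr_ge0// oppr_ge0 ltW.
by move: o; move: (b / r) (- a / r) => u v o; rewrite !mulNr -opprD o oppr0.
Qed.

Lemma dot3ss_eq1 (w : V) : dot3 w w = 1 -> w.1.1 = 0 -> w.1.2 = 0 -> `|w.2 : R| = 1.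
Proof.
rewrite /dot3 => e e1 e2; move: e; rewrite e1 e2 !mulr0 !add0r => e.
by apply/eqP; rewrite -(@eqrXn2 _ 2)// expr1n real_normK ?num_real// expr2 e.
Qed.

(** Two rotations bring [w] to the third axis, up to the sign [e]. A third, about that axis, cancels
    the second coordinate of [x], and a reflection fixes the sign of its first: the planar estimate
    wants the second focus over the nonnegative first axis. *)
Lemma isometry3_normal_form (w x : V) : norm3 w = 1 -> exists f e,
  [/\ isometry3 f, `|e| = 1, (forall v, dot3 v w = (f v).2 * e),
     0 <= ((f x).1.1 : R) & (f x).1.2 = 0].
Proof.
move=> w1; have ww : dot3 w w = 1.
  rewrite -[RHS](expr1n _ 2) -w1 /norm3 sqr_sqrtr// /dot3.
  by rewrite -!expr2 !addr_ge0 ?sqr_ge0.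
have [c1 [s1 [cs1 c10 k1]]] := exists_rotation w.1.1 w.1.2.
have i1 := isometry3_rot12 cs1 c10; set f1 := rot12 c1 s1 in i1.
have [c2 [s2 [cs2 c20 k2]]] := exists_rotation (f1 w).1.2 (f1 w).2.
have i2 := isometry3_rot23 cs2 c20; set f2 := rot23 c2 s2 in i2.
have i12 := isometry3_comp i1 i2.
have [c3 [s3 [cs3 c30 k3]]] := exists_rotation (f2 (f1 x)).1.2 (- ((f2 (f1 x)).1.1 : R)).
have i3 := isometry3_rot12 cs3 c30; set f3 := rot12 c3 s3 in i3.
have i123 := isometry3_comp i12 i3.
have w11 : (f3 (f2 (f1 w))).1.1 = 0 by rewrite /= k1 k2 !mulr0 addr0.
have w12 : (f3 (f2 (f1 w))).1.2 = 0 by rewrite /= k1 k2 !mulr0 subr0.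
have x2 : (f3 (f2 (f1 x))).1.2 = 0.
  by rewrite -[RHS]k3 /=; ring.
have key f : isometry3 f -> (f w).1.1 = 0 -> (f w).1.2 = 0 -> 0 <= ((f x).1.1 : R) ->
    (f x).1.2 = 0 -> exists f e,
  [/\ isometry3 f, `|e| = 1, (forall v, dot3 v w = (f v).2 * e),
     0 <= ((f x).1.1 : R) & (f x).1.2 = 0].
  move=> fi fw1 fw2 fx1 fx2; exists f, (f w).2; have [_ _ fd] := fi; split => //.
    by apply: dot3ss_eq1 => //; rewrite fd.
  by move=> v; rewrite -fd /dot3 fw1 fw2 !mulr0 !add0r.
have [h|h] := leP 0 ((f3 (f2 (f1 x))).1.1 : R); first exact: (key (f3 \o (f2 \o f1))).
have i4 := isometry3_comp i123 isometry3_flip1.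
apply: (key _ i4) => //.
  by change (- ((f3 (f2 (f1 w))).1.1 : R) = 0); rewrite w11 oppr0.
by change (0 <= - ((f3 (f2 (f1 x))).1.1 : R)); rewrite oppr_ge0 ltW.
Qed.

End rotations.

Lemma product_measure_ysection d1 d2 (T1 : measurableType d1) (T2 : measurableType d2)
    (R : realType) (m1 : {sigma_finite_measure set T1 -> \bar R})
    (m2 : {sigma_finite_measure set T2 -> \bar R}) (A : set (T1 * T2)) :
  measurable A -> ((m1 \x m2) A = \int[m2]_y m1 (ysection A y))%E.
Proof.
move=> mA; rewrite -[RHS]/((m1 \x^ m2)%E A).
by apply: product_measure_unique => // C D mC mD; exact: product_measure2E.
Qed.

Lemma integral_le_indic d (T : measurableType d) (R : realType)
    (m : {measure set T -> \bar R}) (f : T -> \bar R) (S : set T) (k : R) :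
  measurable_fun setT f -> (forall x, (0 <= f x)%E) -> measurable S -> 0 <= k ->
  (forall x, S x -> (f x <= k%:E)%E) -> (forall x, ~ S x -> f x = 0%E) ->
  (\int[m]_x f x <= k%:E * m S)%E.
Proof.
move=> mf f0 mS k0 fS fN.
have mi : measurable_fun setT (\1_S : T -> R) by exact: measurable_indic.
rewrite -[S in leRHS]setIT -integral_indic// -ge0_integralZ_EFin//.
apply: ge0_le_integral => //.
  by apply/measurable_EFinP; exact: measurable_funM.
move=> x _; rewrite indicE; have [xS|xS] := pselect (S x).
  by rewrite mem_set// mulr1; exact: fS.
by rewrite memNset// mulr0 fN.
Qed.

(** * Ellipsoidal shells inside a slab *)

Section slab_annulus.
Context (R : realType).
Local Notation lam := (@lebesgue_measure R).
Local Notation V := (vec3 R).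

Lemma measurable_dot3 d (T : measurableType d) (f g : T -> V) :
  measurable_fun setT f -> measurable_fun setT g -> measurable_fun setT (fun x => dot3 (f x) (g x)).
Proof.
move=> mf mg; have f1 := measurableT_comp measurable_fst mf; have g1 := measurableT_comp measurable_fst mg.
apply: measurable_funD; last first.
  by apply: measurable_funM; [exact: (measurableT_comp measurable_snd mf)|exact: (measurableT_comp measurable_snd mg)].
apply: measurable_funD; apply: measurable_funM.
- exact: (measurableT_comp measurable_fst f1).
- exact: (measurableT_comp measurable_fst g1).
- exact: (measurableT_comp measurable_snd f1).
- exact: (measurableT_comp measurable_snd g1).
Qed.

Lemma measurable_norm3 d (T : measurableType d) (f : T -> V) :
  measurable_fun setT f -> measurable_fun setT (fun x => norm3 (f x)).
Proof.
move=> mf; apply: measurableT_comp (measurable_dot3 mf mf).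
by apply: continuous_measurable_fun; exact: sqrt_continuous.
Qed.

Lemma measurable_VrB d (T : measurableType d) (z : V) (f : T -> V) :
  measurable_fun setT f -> measurable_fun setT (fun x => z - f x : V).
Proof.
move=> mf; have f1 := measurableT_comp measurable_fst mf.
apply: (measurable_fun_pair (f := fun x => (z - f x).1)); last first.
  by apply: measurable_funB => //; exact: (measurableT_comp measurable_snd mf).
apply: (measurable_fun_pair (f := fun x => (z - f x).1.1)).
  by apply: measurable_funB => //; exact: (measurableT_comp measurable_fst f1).
by apply: measurable_funB => //; exact: (measurableT_comp measurable_snd f1).
Qed.

Variables (N1 N2 sig T0 T1 a b : R).
Hypotheses (N1_gt0 : 0 < N1) (N2_gt0 : 0 < N2) (sig_gt0 : 0 < sig) (T01 : T0 <= T1) (ab : a <= b).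

(** The linear form is kept as a parameter [p] so that the rotated region is again of this type. *)
Let region (z : V) (p : V -> R) : set V :=
  [set v | [&& N1 / 2 < norm3 v, norm3 v <= N1, norm3 (z - v) <= N2, sig * norm3 v <= `|p v|,
    T0 <= norm3 v + norm3 (z - v), norm3 v + norm3 (z - v) <= T1, a <= p v & p v <= b]].

Let measurable_region z p : measurable_fun setT p -> measurable (region z p).
Proof.
move=> mp; have c (x : R) : measurable_fun setT (fun _ : V => x) by exact: measurable_cst.
have m0 : measurable_fun setT (fun v : V => v) by exact: measurable_id.
have m1 : measurable_fun setT (fun v : V => norm3 v) by exact: measurable_norm3 m0.
have m2 : measurable_fun setT (fun v : V => norm3 (z - v)).
  exact: (measurable_norm3 (measurable_VrB z m0)).
have m3 : measurable_fun setT (fun v : V => sig * norm3 v) by exact: measurable_funM.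
have m4 : measurable_fun setT (fun v : V => norm3 v + norm3 (z - v)) by exact: measurable_funD.
have m5 : measurable_fun setT (fun v : V => `|p v|) by exact: measurableT_comp.
rewrite -[region z p]setTI; apply: (_ : measurable_fun setT (fun p => [&& _, _, _, _, _, _, _ & _])) => //.
repeat first [assumption|exact: c|apply: measurable_and|apply: measurable_fun_ler|apply: measurable_fun_ltr].
Qed.

Definition slab_annulus (w z : V) := region z (fun v => dot3 v w).

Lemma measurable_slab_annulus w z : measurable (slab_annulus w z).
Proof. by apply: measurable_region; apply: measurable_dot3 => //; exact: measurable_id. Qed.

Lemma slab_annulus_le (w z : V) : norm3 w = 1 ->
  (@mu3 R (slab_annulus w z) <= (64 / sig * Num.min N1 N2 * (T1 - T0) * (b - a))%:E)%E.
Proof.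
move=> w1; have [f [e [[fm fB fd] e1 fw z1 z2]]] := isometry3_normal_form z w1.
have fn v : norm3 (f v) = norm3 v by rewrite /norm3 fd.
pose p (v : V) := (v.2 : R) * e.
have mp : measurable_fun setT p by apply: measurable_funM => //; exact: measurable_snd.
have mW := measurable_region (f z) mp.
have -> : slab_annulus w z = f @^-1` (region (f z) p).
  by apply/seteqP; split=> v; rewrite /slab_annulus /region /= -fB !fn fw.
rewrite (fm.2 _ mW) [X in (X <= _)%E]product_measure_ysection//.
have k0 : 0 <= 64 / sig * Num.min N1 N2 * (T1 - T0).
  apply: mulr_ge0; last by rewrite subr_ge0.
  by apply: mulr_ge0; [exact: divr_ge0 (ler0n _ _) (ltW sig_gt0)|rewrite le_min !ltW].
(* Admissible third coordinates; for [e = -1] this is the reflected interval, of the same length. *)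
pose S : set R := [set x | a <= x * e <= b].
have lamS : lam S = (b - a)%:E.
  move/eqP: e1; rewrite eqr_norml ler01 andbT => /orP[|] /eqP eE.
    rewrite (_ : S = `[a, b]%classic); last first.
      by apply/seteqP; split=> x; rewrite /S /= in_itv/= eE mulr1.
    rewrite lebesgue_measure_itv/= lte_fin; case: ltP => // ba.
    by rewrite (_ : b = a) ?subrr//; apply/eqP; rewrite eq_le ab ba.
  rewrite (_ : S = `[- b, - a]%classic); last first.
    by apply/seteqP; split=> x; rewrite /S /= in_itv/= eE mulrN1 lerNr lerNl andbC.
  rewrite lebesgue_measure_itv/= lte_fin ltrN2; case: ltP => [_|ba].
    by rewrite -EFinD opprK addrC.
  have -> : b = a by apply/eqP; rewrite eq_le ab ba.
  by rewrite subrr.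
have mS : measurable S.
  rewrite -[S]setTI; apply: (_ : measurable_fun setT (fun x : R => (a <= x * e) && (x * e <= b))) => //.
  by apply: measurable_and; apply: measurable_fun_ler => //; exact: measurable_funM.
rewrite [X in (_ <= X)%E]EFinM -lamS; apply: integral_le_indic => //.
- exact: (measurable_fun_ysection (@mu2 R) mW).
- move=> x Sx; have := @ellipse_annulus_le R x ((f z).2 - x) (f z).1.1 N1 N2 sig T0 T1 N1_gt0 N2_gt0 sig_gt0 z1 T01.
  apply: le_trans; apply: le_measure; rewrite ?inE.
  + exact: measurable_ysection.
  + exact: measurable_ellipse_annulus.
  + move=> [y1 y2]; rewrite /ysection /= inE /region /ellipse_annulus /= => h.
    have e2 : norm3 ((y1, y2), x) = Num.sqrt (x * x + y1 * y1 + y2 * y2).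
      by rewrite /norm3 /dot3 /=; congr Num.sqrt; ring.
    have e3 : norm3 (f z - ((y1, y2), x)) = Num.sqrt (((f z).2 - x) * ((f z).2 - x) +
        ((f z).1.1 - y1) * ((f z).1.1 - y1) + y2 * y2).
      by rewrite /norm3 /dot3 /= z2; congr Num.sqrt; ring.
    move: h; rewrite /p /= normrM e1 mulr1 e2 e3.
    by move=> /and5P[-> -> -> -> /and4P[-> -> _ _]].
- move=> x Sx; rewrite (_ : ysection _ _ = set0) ?measure0//.
  apply/seteqP; split=> y //; rewrite /ysection /= inE /region /= => h; apply: Sx.
  by move: h => /and5P[_ _ _ _ /and4P[_ _ h1 h2]]; apply/andP; split.
Qed.

End slab_annulus.

Lemma minM_le (R : realType) (x y : R) : 0 < x -> 0 < y -> Num.min x y * (x + y) <= 2 * (x * y).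
Proof.
move=> x0 y0; rewrite minEle; case: ifPn => [xy|]; last rewrite -ltNge => yx.
  by have := ler_wpM2l (ltW x0) xy; lra.
by have := ler_wpM2l (ltW y0) (ltW yx); lra.
Qed.

(** Adding the two cone conditions, multiplied by the common sign [e], eliminates [tau]; this is
    where equal signs are used. Separately, they confine [tau] to intervals of lengths [2 * L1] and
    [2 * L2]. *)
Lemma sign_sum_bounds (R : realType) (e n1 n2 tau tz L1 L2 : R) : e = 1 \/ e = -1 ->
  `|- tau + e * n1| <= L1 -> `|- (tz - tau) + e * n2| <= L2 ->
  [/\ e * tz - (L1 + L2) <= n1 + n2, n1 + n2 <= e * tz + (L1 + L2),
      e * n1 - L1 <= tau <= e * n1 + L1 &
      tz - e * n2 - L2 <= tau <= tz - e * n2 + L2].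
Proof. by move=> [->|->]; rewrite !ler_norml => /andP[? ?] /andP[? ?]; split; lra. Qed.

(** * The overlap of two thickened cones *)

Section cone_interaction.
Context (R : realType).
Local Notation lam := (@lebesgue_measure R).
Local Notation X := (spacetime R).
Variables (s : bool) (N1 N2 L1 L2 sig a b : R) (w : vec3 R) (z : X).
Hypotheses (N1_gt0 : 0 < N1) (N2_gt0 : 0 < N2) (L1_gt0 : 0 < L1) (L2_gt0 : 0 < L2).
Hypotheses (sig_gt0 : 0 < sig) (ab : a <= b) (w1 : norm3 w = 1).

Definition cone_interaction : set X :=
  [set y | [/\ Kset s N1 L1 y, sig * norm3 y.2 <= `|dot3 y.2 w|, Kset s N2 L2 (z - y) &
     a <= dot3 y.2 w <= b]].

Lemma measurable_Kset_comp d (T : measurableType d) N L (f : T -> X) :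
  measurable_fun setT f -> measurable [set x | Kset s N L (f x)].
Proof.
move=> mf; have c (x : R) : measurable_fun setT (fun _ : T => x) by exact: measurable_cst.
have m2 : measurable_fun setT (fun x => (f x).2) by exact: (measurableT_comp measurable_snd mf).
have m1 : measurable_fun setT (fun x => (f x).1 : R) by exact: (measurableT_comp measurable_fst mf).
have mn : measurable_fun setT (fun x => norm3 (f x).2) by exact: measurable_norm3 m2.
have mg : measurable_fun setT (fun x => - (f x).1 + (-1) ^+ s * norm3 (f x).2).
  by apply: measurable_funD; [exact: measurableT_comp m1|exact: measurable_funM].
have mh : measurable_fun setT (fun x => `|- ((f x).1 : R) + (-1) ^+ s * norm3 (f x).2|).
  exact: measurableT_comp mg.
rewrite (_ : [set x | _] = setT `&` [set x | [&& N / 2 < norm3 (f x).2, norm3 (f x).2 <= N &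
     `|- ((f x).1 : R) + (-1) ^+ s * norm3 (f x).2| <= L]]); last first.
  rewrite setTI; apply/seteqP; split=> x; rewrite /Kset /=.
    by move=> [/andP[-> ->] ->].
  by move=> /and3P[-> -> ->].
apply: (_ : measurable_fun setT (fun p => [&& _, _ & _])) => //.
repeat first [assumption|exact: c|apply: measurable_and|apply: measurable_fun_ler|apply: measurable_fun_ltr].
Qed.

Lemma measurable_cone_interaction : measurable cone_interaction.
Proof.
have c (x : R) : measurable_fun setT (fun _ : X => x) by exact: measurable_cst.
have m2 : measurable_fun setT (fun y : X => y.2) by exact: measurable_snd.
have mn : measurable_fun setT (fun y : X => sig * norm3 y.2).
  by apply: measurable_funM => //; exact: measurable_norm3 m2.
have md : measurable_fun setT (fun y : X => dot3 y.2 w).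
  by apply: measurable_dot3 m2 _; exact: measurable_cst.
have mnd : measurable_fun setT (fun y : X => `|dot3 y.2 w|) by exact: measurableT_comp md.
have k1 : measurable [set y : X | Kset s N1 L1 y].
  by apply: (@measurable_Kset_comp _ X N1 L1 (fun y => y)); exact: measurable_id.
have k2 : measurable [set y : X | Kset s N2 L2 (z - y)].
  apply: (@measurable_Kset_comp _ X N2 L2 (fun y => z - y)).
  by apply: measurable_XB; [exact: measurable_cst|exact: measurable_id].
have k3 : measurable (setT `&` [set y : X | [&& sig * norm3 y.2 <= `|dot3 y.2 w|, a <= dot3 y.2 w & dot3 y.2 w <= b]]).
  apply: (_ : measurable_fun setT (fun p => [&& _, _ & _])) => //.
  repeat first [assumption|exact: c|apply: measurable_and|apply: measurable_fun_ler|apply: measurable_fun_ltr].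
have := measurableI _ _ (measurableI _ _ k1 k2) k3; congr (measurable _).
apply/seteqP; split=> y; rewrite /cone_interaction /=.
  by move=> [[? ?] [_ /and3P[? ? ?]]]; split => //; apply/andP.
by move=> [? h ? /andP[? ?]]; do 2!split => //; apply/and3P.
Qed.

Lemma signM (x : R) : (-1) ^+ s * ((-1) ^+ s * x) = x.
Proof. by rewrite mulrA -expr2 -signr_odd sqrr_sign mul1r. Qed.

(** The fibre in [tau] has length at most [2 * min L1 L2], over a shell of thickness
    [2 * (L1 + L2)]. With [min L1 L2 * (L1 + L2) <= 2 * L1 * L2] the constant is
    [2 * 64 * 2 * 2 = 512]. *)
Lemma mu4_cone_interaction_le :
  (@mu4 R cone_interaction <= (512 / sig * Num.min N1 N2 * (L1 * L2) * (b - a))%:E)%E.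
Proof.
pose eps : R := (-1) ^+ s.
have eps2 x : eps * (eps * x) = x by rewrite /eps signM.
pose T0 := eps * z.1 - (L1 + L2); pose T1 := eps * z.1 + (L1 + L2).
have T01 : T0 <= T1 by rewrite /T0 /T1; have := addr_gt0 L1_gt0 L2_gt0; lra.
have mI := measurable_cone_interaction.
rewrite [X in (X <= _)%E]product_measure_ysection//.
pose S := slab_annulus N1 N2 sig T0 T1 a b w z.2.
have k0 : 0 <= 2 * Num.min L1 L2 by rewrite mulr_ge0// le_min !ltW.
have epsE : eps = 1 \/ eps = -1.
  by rewrite /eps -signr_odd; case: (odd s); [right|left].
have P x y : cone_interaction (y, x) ->
    [/\ T0 <= norm3 x + norm3 (z.2 - x), norm3 x + norm3 (z.2 - x) <= T1,
      eps * norm3 x - L1 <= y <= eps * norm3 x + L1 &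
      z.1 - eps * norm3 (z.2 - x) - L2 <= y <= z.1 - eps * norm3 (z.2 - x) + L2].
  by move=> [[_ h1] _ [_ h2] _]; exact: sign_sum_bounds epsE h1 h2.
have SI x y : cone_interaction (y, x) -> S x.
  move=> Ixy; have [h1 h2 _ _] := P _ _ Ixy.
  move: Ixy => [[/andP[k1 k2] _] k3 [/andP[_ k4] _] /andP[k5 k6]].
  by rewrite /S /slab_annulus /=; apply/and5P; split => //; apply/and4P.
apply: (@le_trans _ _ ((2 * Num.min L1 L2)%:E * @mu3 R S)%E); last first.
  apply: (@le_trans _ _ ((2 * Num.min L1 L2)%:E * (64 / sig * Num.min N1 N2 * (T1 - T0) * (b - a))%:E)%E).
    by rewrite lee_wpmul2l ?lee_fin// slab_annulus_le.
  have hm : Num.min L1 L2 * (L1 + L2) <= 2 * (L1 * L2) by exact: minM_le.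
  rewrite -EFinM lee_fin /T1 /T0.
  have -> : 2 * Num.min L1 L2 * (64 / sig * Num.min N1 N2 *
      (eps * z.1 + (L1 + L2) - (eps * z.1 - (L1 + L2))) * (b - a)) =
    (256 / sig * Num.min N1 N2 * (b - a)) * (Num.min L1 L2 * (L1 + L2)).
    by move: (eps * z.1) (Num.min L1 L2) (Num.min N1 N2) => e m n; field; rewrite gt_eqF.
  have -> : 512 / sig * Num.min N1 N2 * (L1 * L2) * (b - a) =
      (256 / sig * Num.min N1 N2 * (b - a)) * (2 * (L1 * L2)).
    by move: (Num.min N1 N2) => n; field; rewrite gt_eqF.
  apply: ler_wpM2l hm; apply: mulr_ge0; last by rewrite subr_ge0.
  by apply: mulr_ge0; [exact: divr_ge0 (ler0n _ _) (ltW sig_gt0)|rewrite le_min !ltW].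
apply: integral_le_indic => //.
- exact: (measurable_fun_ysection lam mI).
- exact: measurable_slab_annulus.
- move=> x Sx.
  apply: (@le_trans _ _ (lam (`[eps * norm3 x - L1, eps * norm3 x + L1]%classic `&`
     `[z.1 - eps * norm3 (z.2 - x) - L2, z.1 - eps * norm3 (z.2 - x) + L2]%classic))).
    apply: le_measure; rewrite ?inE; [exact: measurable_ysection|exact: measurableI|].
    move=> y; rewrite /ysection /= inE => /P[_ _ h1 h2].
    by rewrite !in_itv.
  have h (c L : R) : 0 < L -> lam `[c - L, c + L]%classic = (2 * L)%:E.
    move=> L0; rewrite lebesgue_measure_itv/= lte_fin ifT; last by lra.
    by rewrite -EFinD; congr EFin; ring.
  rewrite minEle; case: ifP => _.
    rewrite -(h (eps * norm3 x) L1 L1_gt0); apply: le_measure; last exact: subIsetl.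
      by rewrite inE; exact: measurableI.
    by rewrite inE.
  rewrite -(h (z.1 - eps * norm3 (z.2 - x)) L2 L2_gt0); apply: le_measure; last exact: subIsetr.
    by rewrite inE; exact: measurableI.
  by rewrite inE.
- move=> x Sx; rewrite (_ : ysection _ _ = set0) ?measure0//.
  by apply/seteqP; split=> y //; rewrite /ysection /= inE => /SI /Sx.
Qed.
End cone_interaction.

(** * The angular condition *)

Section angles.
Context (R : realType).
Local Notation V := (vec3 R).

Lemma cos_ge_half (x : R) : 0 <= x -> x <= 2^-1 -> 2^-1 <= cos x.
Proof.
move=> x0 x1.
have [c] := @MVT_segment R (@cos R) (fun x => - sin x) 0 x x0
  (fun y _ => is_derive_cos y) (continuous_subspaceT (@continuous_cos R)).
rewrite in_itv/= => /andP[c0 cx]; rewrite cos0 subr0 => E.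
have : sin c * x <= 1 * x by rewrite ler_wpM2r// sin_le1.
by move: E; rewrite mulNr; move: (cos x) (sin c * x) => u v; lra.
Qed.

(** Mean value theorem, with the cosine at least 1/2 on [[0, 1/2]]; this range is the source of the
    value 1/2 for [eps0]. *)
Lemma sin_ge_half (x : R) : 0 <= x -> x <= 2^-1 -> x / 2 <= sin x.
Proof.
move=> x0 x1.
have [c] := @MVT_segment R (@sin R) (@cos R) 0 x x0
  (fun y _ => is_derive_sin y) (continuous_subspaceT (@continuous_sin R)).
rewrite in_itv/= => /andP[c0 cx]; rewrite sin0 !subr0 => ->.
by rewrite mulrC ler_wpM2r// cos_ge_half// (le_trans cx).
Qed.

Lemma dot3_ge0 (x : V) : 0 <= dot3 x x.
Proof. by rewrite /dot3 -!expr2 !addr_ge0 ?sqr_ge0. Qed.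

Lemma norm3_ge0 (x : V) : 0 <= norm3 x. Proof. exact: sqrtr_ge0. Qed.

Lemma norm3_sqr (x : V) : norm3 x ^+ 2 = dot3 x x.
Proof. by rewrite sqr_sqrtr// dot3_ge0. Qed.

Lemma dot3_CS (x y : V) : dot3 x y ^+ 2 <= dot3 x x * dot3 y y.
Proof.
have -> : dot3 x x * dot3 y y = dot3 x y ^+ 2 + (x.1.1 * y.1.2 - x.1.2 * y.1.1) ^+ 2 +
   (x.1.1 * y.2 - x.2 * y.1.1) ^+ 2 + (x.1.2 * y.2 - x.2 * y.1.2) ^+ 2.
  by rewrite /dot3; ring.
by rewrite -!addrA lerDl !addr_ge0 ?sqr_ge0.
Qed.

Lemma normr_dot3_le (x y : V) : `|dot3 x y| <= norm3 x * norm3 y.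
Proof.
rewrite -(@ler_pXn2r _ 2) ?nnegrE ?mulr_ge0 ?norm3_ge0//.
by rewrite real_normK ?num_real// exprMn !norm3_sqr dot3_CS.
Qed.

Lemma cosine_bounds (x y : V) : -1 <= dot3 x y / (norm3 x * norm3 y) <= 1.
Proof.
rewrite -ler_norml; have [h|h] := eqVneq (norm3 x * norm3 y) 0.
  by rewrite h invr0 mulr0 normr0.
have p : 0 < norm3 x * norm3 y by rewrite lt_def h mulr_ge0 ?norm3_ge0.
by rewrite normrM normfV (gtr0_norm p) ler_pdivrMr// mul1r normr_dot3_le.
Qed.

Lemma angle_perp_le (x w y : V) : y <> 0 -> dot3 y w = 0 -> angle_perp x w <= angle3 x y.
Proof.
move=> y0 yw; apply: inf_lbound; last by exists y.
by exists 0 => _ [v _ <-]; exact: acos_ge0 (cosine_bounds _ _).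
Qed.

(* The orthogonal projection of [x] onto the plane realizes the angle. *)
Lemma dot3_angle_ge (x w : V) (alpha : R) : norm3 w = 1 -> 0 < alpha -> alpha <= 2^-1 ->
  alpha <= angle_perp x w -> alpha / 2 * norm3 x <= `|dot3 x w|.
Proof.
move=> w1 a0 a1 ax; have ww : dot3 w w = 1 by rewrite -norm3_sqr w1 expr1n.
pose c := dot3 x w.
pose y : V := ((x.1.1 - c * w.1.1, x.1.2 - c * w.1.2), x.2 - c * w.2).
have yw : dot3 y w = 0.
  rewrite (_ : dot3 y w = dot3 x w - c * dot3 w w); last by rewrite /dot3 /y /=; ring.
  by rewrite ww mulr1 subrr.
have xy : dot3 x y = norm3 y ^+ 2.
  rewrite norm3_sqr (_ : dot3 y y = dot3 x y - c * dot3 y w); last by rewrite /dot3 /y /=; ring.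
  by rewrite yw mulr0 subr0.
have pyth : norm3 x ^+ 2 = norm3 y ^+ 2 + c ^+ 2.
  rewrite !norm3_sqr (_ : dot3 x x = dot3 y y + 2 * c * dot3 y w + c ^+ 2 * dot3 w w); last first.
    by rewrite /dot3 /y /=; ring.
  by rewrite yw ww mulr0 addr0 mulr1.
have x0 := norm3_ge0 x; have y0 := norm3_ge0 y.
(* By Pythagoras a lower bound on the component [c] is an upper bound on the projection [y]. *)
suff k : norm3 y ^+ 2 <= (1 - (alpha / 2) ^+ 2) * norm3 x ^+ 2.
  rewrite -(@ler_pXn2r _ 2) ?nnegrE//; last first.
    by rewrite mulr_ge0// divr_ge0// ltW.
  rewrite real_normK ?num_real// exprMn -/c.
  by move: k; rewrite pyth mulrBl mul1r; lra.
(* If the projection vanishes, [y] is not a direction with which an angle can be compared, but then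
   the claim is immediate. *)
have [yE|yE] := eqVneq (norm3 y) 0.
  rewrite yE expr0n /= mulr_ge0 ?sqr_ge0// subr_ge0 expr_le1//; lra.
have yn : y <> 0.
  by move=> e; move: yE; rewrite e /norm3 /dot3 /= !mulr0 !addr0 sqrtr0 eqxx.
have yp : 0 < norm3 y by rewrite lt_def yE.
have xp : 0 < norm3 x.
  rewrite lt_def x0 andbT; apply/eqP => xE; move: pyth; rewrite xE expr0n /=.
  by have := exprn_gt0 2 yp; have := sqr_ge0 c; lra.
pose t := norm3 y / norm3 x.
have tE : dot3 x y / (norm3 x * norm3 y) = t by rewrite xy /t; field; rewrite !gt_eqF.
have t0 : 0 <= t by rewrite divr_ge0.
have tb := cosine_bounds x y; rewrite tE in tb.
have ath : alpha <= acos t by rewrite -tE; exact: le_trans ax (angle_perp_le _ yn yw).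
have tc : t <= cos alpha.
  have [/andP[h1 h2] h3] := acos_def tb.
  have ap : alpha <= pi := le_trans ath h2.
  rewrite leNgt -[ltRHS]h3 ltr_cos ?in_itv/= ?h1 ?(ltW a0) ?ap//.
  by rewrite -leNgt.
have ca : t ^+ 2 <= 1 - (alpha / 2) ^+ 2.
  have c0 : 0 <= cos alpha by exact: le_trans t0 tc.
  have h1 : t ^+ 2 <= cos alpha ^+ 2 by rewrite ler_pXn2r ?nnegrE.
  have h2 : (alpha / 2) ^+ 2 <= sin alpha ^+ 2.
    have h := sin_ge_half (ltW a0) a1.
    have h' : 0 <= alpha / 2 by rewrite divr_ge0// ltW.
    by rewrite ler_pXn2r ?nnegrE// (le_trans h').
  by have := cos2Dsin2 alpha; move: h1 h2; lra.
have -> : norm3 y ^+ 2 = t ^+ 2 * norm3 x ^+ 2 by rewrite -exprMn divfK// gt_eqF.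
by rewrite ler_wpM2r ?sqr_ge0.
Qed.

End angles.

(** * The bilinear estimate *)

Lemma ip_eq0_ae d (T : measurableType d) (R : realType) (mu : {measure set T -> \bar R})
    (f : T -> R) : L2 mu f -> ip mu f f = 0 -> {ae mu, forall x, f x = 0}.
Proof.
move=> [mf f2] f0; have E : (\int[mu]_x (f x ^+ 2)%:E = 0)%E by rewrite L1_EFin// -[RHS]/(0%:E) -f0.
have m2 : measurable_fun setT (fun x => (f x ^+ 2)%:E).
  by apply/measurable_EFinP; exact: measurable_funX.
have [h _] := @ae_eq_integral_abs _ _ R mu setT measurableT _ m2.
have : ae_eq mu setT (fun x => (f x ^+ 2)%:E) (cst 0%E).
  apply: h; rewrite -[RHS]E; apply: eq_integral => x _.
  by rewrite gee0_abs// lee_fin sqr_ge0.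
apply: filterS => x /(_ I) /= [] /eqP.
by rewrite sqrf_eq0 => /eqP.
Qed.

Lemma polarization_eq0 (R : realType) (a b c d e f k : R) :
  a + b = k -> c + d = k -> e + f = k -> (a - 2 * c + e) + (b - 2 * d + f) = 0.
Proof. by move=> *; lra. Qed.

(** * Representatives of the transform and their supports *)

Section fourier_support.
Context (R : realType).
Local Notation X := (spacetime R).
Local Notation mu := (@mu4 R).
Implicit Types (u v w : X -> R[i]) (f g : X -> R).

Lemma ae_mpres phi (P : X -> Prop) : mpres mu mu phi -> {ae mu, forall x, P x} ->
  {ae mu, forall x, P (phi x)}.
Proof.
move=> [mphi phiE] [N [mN N0 PN]]; exists (phi @^-1` N); split.
- by rewrite -[X in measurable X]setTI; exact: mphi.
- by rewrite (phiE N mN).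
- by move=> x /= nP; apply: PN.
Qed.

(** By Parseval [|v|^2], [<v, v'>] and [|v'|^2] all equal the same multiple of [|u|^2], so
    [|v - v'|^2 = 0]. *)
Lemma fourierL2_unique u v v' : is_fourierL2 u v -> is_fourierL2 u v' ->
  {ae mu, forall x, v x = v' x}.
Proof.
move=> F F'; have /fourierL2P[u2 v2 _] := F; have /fourierL2P[_ v2' _] := F'.
have e1 := parseval_fourierL2 F F; have e2 := parseval_fourierL2 F F'.
have e3 := parseval_fourierL2 F' F'.
have Lr := L2B v2.1 v2'.1; have Li := L2B v2.2 v2'.2.
have r0 := ip_ge0 mu (fun x => re v x - re v' x).
have i0 := ip_ge0 mu (fun x => im v x - im v' x).
have er := ipBB v2.1 v2'.1; have ei := ipBB v2.2 v2'.2.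
have s0 : ip mu (fun x => re v x - re v' x) (fun x => re v x - re v' x) +
    ip mu (fun x => im v x - im v' x) (fun x => im v x - im v' x) = 0.
  by rewrite er ei; exact: polarization_eq0 e1 e2 e3.
move/eqP: s0; rewrite paddr_eq0// => /andP[/eqP /(ip_eq0_ae Lr) hr /eqP /(ip_eq0_ae Li) hi].
apply: (filterS2 _ _ hr hi) => x; rewrite /re /im.
by case: (v x) (v' x) => a b [c e] /= /eqP; rewrite subr_eq0 => /eqP -> /eqP; rewrite subr_eq0 => /eqP ->.
Qed.

(** Each support condition comes with its own representative of the transform; uniqueness merges the
    two exceptional null sets. *)
Lemma fourier_supp2 u (A B : set X) : fourier_supp u A -> fourier_supp u B ->
  exists2 v, is_fourierL2 u v & {ae mu, forall zeta, ~ (A zeta /\ B zeta) -> v zeta = 0}.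
Proof.
move=> [v Fv vA] [v' Fv' vB]; exists v => //.
have vv' := fourierL2_unique Fv Fv'.
have vAB : {ae mu, forall z, (~ A z -> v z = 0) /\ (~ B z -> v' z = 0)}.
  by apply: (filterS2 _ _ vA vB).
apply: (filterS2 _ _ vAB vv') => z [h1 h2] h3 nAB.
have [Az|/h1 //] := pselect (A z).
have [Bz|nB] := pselect (B z); last by rewrite h3; exact: h2.
by exfalso; apply: nAB.
Qed.

Lemma L2_indic_normc (A : set X) v : measurable A -> cL2 v ->
  L2 mu (fun z => \1_A z * Normc.normc (v z)) /\
  ip mu (fun z => \1_A z * Normc.normc (v z)) (fun z => \1_A z * Normc.normc (v z)) <= cip v v.
Proof.
move=> mA v2; have Ln := L2_normc v2; have LA := L2_indicM mA Ln; split => //.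
rewrite -ip_normc//; apply: le_Rintegral => //; [exact: (L2_L1 LA LA)|exact: (L2_L1 Ln Ln)|].
move=> z _; rewrite indicE; case: (z \in A); rewrite ?mul1r// !mul0r.
by rewrite mulr_ge0// normcE sqrtr_ge0.
Qed.

(** Equality holds at every [z], because for fixed [z] the exceptional integration points form a
    null set: [x -> z - x] preserves the measure. *)
Lemma nconv_indic (A B : set X) v v' z : measurable A -> measurable B -> cL2 v -> cL2 v' ->
  {ae mu, forall x, ~ A x -> v x = 0} -> {ae mu, forall x, ~ B x -> v' x = 0} ->
  nconv v v' z =
  conv (fun x => \1_A x * Normc.normc (v x)) (fun x => \1_B x * Normc.normc (v' x)) z.
Proof.
move=> mA mB v2 v2' vA vB'; have [LA _] := L2_indic_normc mA v2; have [LB _] := L2_indic_normc mB v2'.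
have vB := ae_mpres (mpres_mu4rB z) vB'.
congr fine; apply: ae_eq_integral => //.
- apply/measurable_EFinP; exact: L1_measurable (L1_conv z (L2_normc v2) (L2_normc v2')).
- apply/measurable_EFinP; exact: L1_measurable (L1_conv z LA LB).
- apply: (filterS2 _ _ vA vB) => y h1 h2 _; congr EFin.
  have n0 : Normc.normc (0 : R[i]) = 0 by rewrite normcE /= expr0n addr0 sqrtr0.
  rewrite !indicE; case: (boolP (y \in A)) => [_|/negP yA]; last first.
    by rewrite h1 ?n0 ?mul0r ?mulr0// => ?; apply: yA; rewrite inE.
  case: (boolP (z - y \in B)) => [_|/negP yB]; rewrite ?mul1r//.
  by rewrite h2 ?n0 ?mul0r ?mulr0// => ?; apply: yB; rewrite inE.
Qed.

End fourier_support.

(** * The convolution of two cone pieces *)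

Section cone_convolution.
Context (R : realType).
Local Notation X := (spacetime R).
Local Notation mu := (@mu4 R).

Lemma normr_coord_le_norm3 (x : vec3 R) :
  [/\ `|x.1.1 : R| <= norm3 x, `|x.1.2 : R| <= norm3 x & `|x.2 : R| <= norm3 x].
Proof.
have h (t : R) : t ^+ 2 <= dot3 x x -> `|t| <= norm3 x.
  by move=> tx; rewrite -sqrtr_sqr ler_wsqrtr.
split; apply: h; rewrite /dot3 -!expr2; have := sqr_ge0 (x.1.1 : R);
  have := sqr_ge0 (x.1.2 : R); have := sqr_ge0 (x.2 : R);
  move: ((x.1.1 : R) ^+ 2) ((x.1.2 : R) ^+ 2) ((x.2 : R) ^+ 2) => u v t *; lra.
Qed.

Lemma Kset_cube s (N L : R) (y : X) : Kset s N L y -> cube (N + L) y.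
Proof.
move=> [/andP[_ h1] h2]; have [c1 c2 c3] := normr_coord_le_norm3 y.2.
have L0 : 0 <= L by apply: le_trans h2.
apply/cubeP; split.
- have := ler_normD (- (- (y.1 : R) + (-1) ^+ s * norm3 y.2)) ((-1) ^+ s * norm3 y.2).
  rewrite normrN opprD opprK subrK normrM normrX normrN1 expr1n mul1r.
  rewrite (ger0_norm (norm3_ge0 y.2)) => h3; apply: (le_trans h3).
  by rewrite addrC lerD.
- by apply: (le_trans c1); apply: (le_trans h1); rewrite lerDl.
- by apply: (le_trans c2); apply: (le_trans h1); rewrite lerDl.
- by apply: (le_trans c3); apply: (le_trans h1); rewrite lerDl.
Qed.

(** Reflection through the origin swaps the two cones, turning opposite signs into equal ones at the
    cost of replacing [f2] by [refl f2]. *)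
Lemma Kset_opp s (N L : R) (y : X) : Kset s N L (- y) -> Kset (~~ s) N L y.
Proof.
rewrite /Kset /= => -[h1 h2].
have e : norm3 (- y.2 : vec3 R) = norm3 y.2.
  by rewrite /norm3 /dot3 /= !mulrNN.
rewrite e in h1 h2; split => //.
by rewrite -normrN; move: h2; case: s => /=; rewrite !expr0 !expr1 !mulN1r !mul1r !opprD !opprK.
Qed.

Lemma conv_eq0 (f g : X -> R) (r : R) z : (forall x, f x != 0 -> cube r x) -> (forall x, g x != 0 -> cube r x) ->
  ~ cube (r + r) z -> conv f g z = 0.
Proof.
move=> fr gr zr; rewrite /conv /Rintegral integral0_eq// => y _; congr EFin.
apply/eqP; rewrite -[_ == 0]negbK; apply/negP.
rewrite mulf_eq0 negb_or => /andP[/fr/cubeP[h0 h1 h2 h3] /gr/cubeP[k0 k1 k2 k3]]; apply: zr; apply/cubeP.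
have tri (u v : R) : `|u| <= r -> `|v - u| <= r -> `|v| <= r + r.
  by move=> h k; rewrite -[v](subrK u) (le_trans (ler_normD _ _))// lerD.
by split; [exact: tri h0 k0|exact: tri h1 k1|exact: tri h2 k2|exact: tri h3 k3].
Qed.

Variables (N1 N2 La Lb sig a b l : R) (s1 s2 : bool) (w : vec3 R) (v1 v2 : X -> R[i]).
Hypotheses (N1_gt0 : 0 < N1) (N2_gt0 : 0 < N2) (La_gt0 : 0 < La) (Lb_gt0 : 0 < Lb).
Hypotheses (sig_gt0 : 0 < sig) (l_gt0 : 0 < l) (abl : b - a <= l) (w1 : norm3 w = 1).
Hypotheses (v1_L2 : cL2 v1) (v2_L2 : cL2 v2).

Definition cone_sector : set X :=
  [set y | Kset s1 N1 La y /\ sig * norm3 y.2 <= `|dot3 y.2 w|].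

Lemma measurable_Kset s N L : measurable (Kset s N L : set X).
Proof. by apply: (@measurable_Kset_comp R s _ X N L (fun y => y)); exact: measurable_id. Qed.

Lemma measurable_cone_sector : measurable cone_sector.
Proof.
have m2 : measurable_fun setT (fun y : X => y.2) by exact: measurable_snd.
have mn : measurable_fun setT (fun y : X => sig * norm3 y.2).
  by apply: measurable_funM => //; exact: measurable_norm3 m2.
have md : measurable_fun setT (fun y : X => `|dot3 y.2 w|).
  by apply: measurableT_comp => //; apply: measurable_dot3 m2 _; exact: measurable_cst.
have k3 : measurable (setT `&` [set y : X | sig * norm3 y.2 <= `|dot3 y.2 w|]).
  apply: (_ : measurable_fun setT (fun y : X => sig * norm3 y.2 <= `|dot3 y.2 w|)) => //.
  exact: measurable_fun_ler.
have := measurableI _ _ (measurable_Kset s1 N1 La) k3; congr (measurable _).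
by rewrite setTI.
Qed.

Let f1 : X -> R := fun x => \1_cone_sector x * Normc.normc (v1 x).
Let f2 : X -> R := fun x => \1_(Kset s2 N2 Lb) x * Normc.normc (v2 x).
Let M : R := 512 / sig * Num.min N1 N2 * (La * Lb) * l.

Let f1P x : f1 x != 0 -> cone_sector x.
Proof.
rewrite /f1 indicE mulf_eq0 negb_or => /andP[+ _].
by case: (boolP (x \in cone_sector)) => [|_]; rewrite ?inE ?eqxx.
Qed.

Let f2P x : f2 x != 0 -> Kset s2 N2 Lb x.
Proof.
rewrite /f2 indicE mulf_eq0 negb_or => /andP[+ _].
by case: (boolP (x \in Kset s2 N2 Lb)) => [|_]; rewrite ?inE ?eqxx.
Qed.

Let p (x : X) : R := dot3 x.2 w.

Lemma cone_conv_slab : exists S, [/\ L2 mu S,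
  ip mu S S <= 2 * M * (cip v1 v1 * cip v2 v2) &
  forall z, slab w a b z -> conv f1 f2 z = S z].
Proof.
have [Lf1 f1n] := L2_indic_normc measurable_cone_sector v1_L2.
have [Lf2 f2n] := L2_indic_normc (measurable_Kset s2 N2 Lb) v2_L2.
have M0 : 0 < M.
  have n0 : 0 < Num.min N1 N2 by rewrite lt_min N1_gt0.
  have c0 : 0 < 512 :> R by rewrite ltr0n.
  exact: (mulr_gt0 (mulr_gt0 (mulr_gt0 (divr_gt0 c0 sig_gt0) n0) (mulr_gt0 La_gt0 Lb_gt0)) l_gt0).
have pos (A : set X) (v : X -> R[i]) x : 0 <= \1_A x * Normc.normc (v x).
  by rewrite mulr_ge0 ?indicE// normcE sqrtr_ge0.
have mp : measurable_fun setT p.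
  apply: measurable_dot3; [exact: measurable_snd|exact: measurable_cst].
have pB x y : p (x - y) = p x - p y by rewrite /p /dot3 /=; ring.
have fB x : f1 x != 0 -> `|p x| <= N1.
  move=> /f1P[[/andP[_ h] _] _]; apply: (le_trans (normr_dot3_le _ _)).
  by rewrite w1 mulr1.
have mt t : measurable_fun setT (tiled p f1 l t).
  apply: measurable_funM; last exact: L2_measurable Lf1.
  apply: measurable_indic; rewrite -[tile _ _ _]setTI.
  apply: (_ : measurable_fun setT (fun p => _ && _)) => //.
  by apply: measurable_and; [apply: measurable_fun_ler|apply: measurable_fun_ltr].
(* In the tile at [t] the component along [w] lies in [[t, t + l]], which plays the part of [[a, b]]
   in the interaction bound. *)
have cone t z (g : X -> R) : measurable_fun setT g -> (forall x, g x != 0 -> Kset s1 N2 Lb x) ->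
    (mu (overlap (tiled p f1 l t) g z) <= M%:E)%E.
  move=> mg gK; have tl : t <= t + l by rewrite lerDl ltW.
  have h := mu4_cone_interaction_le s1 z N1_gt0 N2_gt0 La_gt0 Lb_gt0 sig_gt0 tl w1.
  have tlt : t + l - t = l by rewrite addrC addrA addNr add0r.
  rewrite tlt in h; apply: (le_trans _ h).
  apply: le_measure; rewrite ?inE.
  - exact: measurable_overlap.
  - exact: measurable_cone_interaction.
  move=> y [+ /gK ky]; rewrite /tiled mulf_eq0 negb_or indicE => /andP[yt /f1P[k1 k2]].
  split => //; move: yt; case: (boolP (y \in tile p l t)) => [|_]; rewrite ?eqxx// inE /tile /= => /andP[h1 h2] _.
  by rewrite h1 ltW.
have H : (forall t z, (mu (overlap (tiled p f1 l t) f2 z) <= M%:E)%E) \/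
    (forall t z, (mu (overlap (tiled p f1 l t) (refl f2) z) <= M%:E)%E).
  have [s12|s12] := eqVneq s2 s1; [left|right] => t' z; apply: cone.
  - exact: L2_measurable Lf2.
  - by move=> x /f2P; rewrite s12.
  - exact: L2_measurable (L2_refl Lf2).
  - move=> x /f2P/Kset_opp; rewrite (_ : ~~ s2 = s1)//.
    by move: s12; case: (s1) (s2) => -[].
have [S [LS S1 S2]] := conv_slab mp pB Lf1 Lf2 (pos _ _) (pos _ _) fB l_gt0 abl M0 H.
exists S; split => //; apply: (le_trans S1); apply: ler_wpM2l.
  by rewrite mulr_ge0// ltW.
by apply: ler_pM => //; exact: ip_ge0.
Qed.

Lemma cone_conv_cube z : ~ cube (N1 + La + (N2 + Lb) + (N1 + La + (N2 + Lb))) z -> conv f1 f2 z = 0.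
Proof.
apply: conv_eq0 => x.
  by move=> /f1P[/Kset_cube h _]; apply: cubeS h; rewrite lerDl addr_ge0// ltW.
by move=> /f2P/Kset_cube h; apply: cubeS h; rewrite lerDr addr_ge0// ltW.
Qed.

End cone_convolution.

(** * The symbol of the multiplier *)

Section multiplier.
Context (R : realType).
Local Notation X := (spacetime R).
Local Notation mu := (@mu4 R).
Local Notation c := (fourier_mass R).

Lemma measurable_slab (w : vec3 R) a b : measurable (slab w a b).
Proof.
have m : measurable_fun setT (fun z : X => dot3 z.2 w).
  by apply: measurable_dot3; [exact: measurable_snd|exact: measurable_cst].
rewrite -[slab w a b]setTI.
apply: (_ : measurable_fun setT (fun z : X => (a <= dot3 z.2 w) && (dot3 z.2 w <= b))) => //.
by apply: measurable_and; apply: measurable_fun_ler.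
Qed.

Lemma re_im_indicM (A : set X) (F : X -> R[i]) z :
  (re (fun z => (\1_A z : R)%:C * F z) z = \1_A z * re F z) *
  (im (fun z => (\1_A z : R)%:C * F z) z = \1_A z * im F z).
Proof. by rewrite /re /im; case: (F z) => x y /=; split; ring. Qed.

Lemma normr_re_im_le (x : R[i]) :
  `|complex.Re x| <= Normc.normc x /\ `|complex.Im x| <= Normc.normc x.
Proof.
by rewrite normcE -!sqrtr_sqr; split; apply: ler_wsqrtr; rewrite ?lerDl ?lerDr sqr_ge0.
Qed.

Variables (N1 N2 La Lb a b l alpha : R) (s1 s2 : bool) (w : vec3 R) (u1 u2 : X -> R[i]).
Hypotheses (N1_gt0 : 0 < N1) (N2_gt0 : 0 < N2) (La_gt0 : 0 < La) (Lb_gt0 : 0 < Lb).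
Hypotheses (l_gt0 : 0 < l) (abl : b - a <= l) (w1 : norm3 w = 1).
Hypotheses (alpha_gt0 : 0 < alpha) (alpha_le : alpha <= 2^-1).
Hypotheses (K1 : fourier_supp u1 (Kset s1 N1 La)) (K2 : fourier_supp u2 (Kset s2 N2 Lb))
  (ang : fourier_supp u1 (angular_region w alpha)).

Let F : X -> R[i] := fourierL1 (fun z => u1 z * u2 z).
Let h : X -> R[i] := fun z => (\1_(slab w a b) z : R)%:C * F z.

(** The symbol is dominated by [q], a multiple of [S] cut to a bounded part of the slab, which puts
    [h] in L^1 and L^2 as [fourierL2_inv] requires. The constant is [(2 / c) ^ 2 * 2 * (512 * 2) * c
    ^ 2 = 8192]: the factor beside 512 comes from [sig = alpha / 2], and [c ^ 2] from Plancherel for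
    [u1] and [u2]. *)
Lemma multiplier_symbol_le : cL12 h /\
  cip h h <= 8192 / alpha * Num.min N1 N2 * (La * Lb) * l * (cip u1 u1 * cip u2 u2).
Proof.
have c0 := fourier_mass_gt0 R.
have [v1 F1 v1K] := fourier_supp2 K1 ang; have [v2 F2 v2K] := K2.
have /fourierL2P[u1_2 v1_2 _] := F1; have /fourierL2P[u2_2 v2_2 _] := F2.
have sig0 : 0 < alpha / 2 by rewrite divr_gt0.
pose sector := cone_sector N1 La (alpha / 2) s1 w.
have v1S : {ae mu, forall z, ~ sector z -> v1 z = 0}.
  apply: filterS v1K => z hz nz; apply: hz => -[k1 [_ k2]]; apply: nz; split => //.
  exact: dot3_angle_ge.
have mS := measurable_cone_sector N1 La (alpha / 2) s1 w.
have [S [LS S1 S2]] := cone_conv_slab s1 s2 N1_gt0 N2_gt0 La_gt0 Lb_gt0 sig0 l_gt0 abl w1 v1_2 v2_2.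
pose f1 : X -> R := fun x => \1_sector x * Normc.normc (v1 x).
pose f2 : X -> R := fun x => \1_(Kset s2 N2 Lb) x * Normc.normc (v2 x).
(* Both supports lie in [cube r], so the convolution vanishes off [cube (r + r)]. *)
pose r := N1 + La + (N2 + Lb); pose D := slab w a b `&` cube (r + r).
have mD : measurable D by apply: measurableI; [exact: measurable_slab|exact: measurable_cube].
have Doo : (mu D < +oo)%E.
  have le : (mu D <= mu (cube (r + r)))%E.
    by apply: le_measure; rewrite ?inE; [exact: mD|exact: measurable_cube|exact: subIsetr].
  apply: (le_lt_trans le); rewrite [X in (X < _)%E]mu4_cube ?ltry//.
  by rewrite /r !addr_ge0// ltW.
pose q z := \1_D z * (2 / c * S z).
have q12 : L12 q by apply: L12_indicM => //; exact: L2Z.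
have Fle z : slab w a b z -> Normc.normc (F z) <= 2 / c * conv f1 f2 z.
  move=> _; have := normc_fourierL1_mul z F1 F2.
  by rewrite (nconv_indic z mS (measurable_Kset s2 N2 Lb) v1_2 v2_2 v1S v2K).
have nh z : Normc.normc (h z) = \1_(slab w a b) z * Normc.normc (F z).
  have [e1 e2] := re_im_indicM (slab w a b) F z.
  rewrite normcE -/(re h z) -/(im h z) e1 e2 indicE; case: (z \in _).
    by rewrite !mul1r -normcE.
  by rewrite !mul0r expr0n addr0 sqrtr0.
have hq z : Normc.normc (h z) <= `|q z|.
  rewrite nh indicE; case: (boolP (z \in slab w a b)) => [|_]; last by rewrite mul0r.
  rewrite inE mul1r => zA; have Fz := Fle z zA.
  have [zc|zc] := pselect (cube (r + r) z).
    rewrite /q indicE mem_set//= mul1r; apply: (le_trans Fz).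
    by rewrite S2// ler_norm.
  move: Fz; rewrite cone_conv_cube ?mulr0// => Fz.
  exact: le_trans Fz _.
have [mF1 mF2] : measurable_fun setT (re F) /\ measurable_fun setT (im F).
  have [i1 i2] := cL1_mul u1_2 u2_2; exact: measurable_fourierL1.
have mi : measurable_fun setT (\1_(slab w a b) : X -> R).
  by apply: measurable_indic; exact: measurable_slab.
have mr : measurable_fun setT (re h).
  apply: (eq_measurable_fun (fun z => \1_(slab w a b) z * re F z)); last exact: measurable_funM.
  by move=> z _; rewrite (re_im_indicM _ F z).1.
have mi' : measurable_fun setT (im h).
  apply: (eq_measurable_fun (fun z => \1_(slab w a b) z * im F z)); last exact: measurable_funM.
  by move=> z _; rewrite (re_im_indicM _ F z).2.
have h12 : cL12 h.
  split; apply: L12_le q12 => // z; apply: le_trans (hq z).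
    exact: (normr_re_im_le (h z)).1.
  exact: (normr_re_im_le (h z)).2.
split; first exact: h12.
have h2 := cL12_cL2 h12; rewrite -ip_normc//.
have n2 := L2_normc h2.
have Lq : L2 mu q by exact: q12.2.
have LS' : L2 mu (fun z => 2 / c * S z) by exact: L2Z.
apply: (@le_trans _ _ (ip mu q q)).
  apply: le_Rintegral => //; [exact: (L2_L1 n2 n2)|exact: (L2_L1 Lq Lq)|].
  move=> z _; rewrite -!expr2 -[leRHS](real_normK (num_real _)).
  by rewrite lerXn2r// nnegrE normcE sqrtr_ge0.
apply: (@le_trans _ _ (ip mu (fun z => 2 / c * S z) (fun z => 2 / c * S z))).
  apply: le_Rintegral => //; [exact: (L2_L1 Lq Lq)|exact: (L2_L1 LS' LS')|].
  move=> z _; rewrite /q indicE; case: (z \in D); rewrite ?mul1r// !mul0r.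
  by rewrite -expr2 sqr_ge0.
rewrite ipZZ//; apply: (@le_trans _ _ ((2 / c) ^+ 2 *
  (2 * (512 / (alpha / 2) * Num.min N1 N2 * (La * Lb) * l) * (cip v1 v1 * cip v2 v2)))).
  by apply: ler_wpM2l => //; exact: sqr_ge0.
rewrite (cip_fourierL2 F1) (cip_fourierL2 F2).
move: (Num.min N1 N2) (cip u1 u1) (cip u2 u2) => n x y.
rewrite le_eqVlt; apply/orP; left; apply/eqP; field.
by rewrite !gt_eqF.
Qed.

End multiplier.

(** Evaluate at [l = d + e / (k + 1)], which is positive even for [d = 0] and costs at most [e]. *)
Lemma le_affine_limit (R : realType) (x k d : R) : 0 <= k -> 0 <= d ->
  (forall l, 0 < l -> d <= l -> x <= k * l) -> x <= k * d.
Proof.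
move=> k0 d0 h; apply/ler_addgt0Pr => e e0.
have l0 : 0 < e / (k + 1) by rewrite divr_gt0// ltr_wpDl.
apply: (le_trans (h (d + e / (k + 1)) _ _)).
- by rewrite ltr_wpDl.
- by rewrite lerDl ltW.
- rewrite mulrDr lerD2l mulrCA ler_piMr// ?(ltW e0)//.
  by rewrite ler_pdivrMr ?mul1r ?lerDl// ltr_wpDl.
Qed.

(** The argument yields the factor [sqrt (8192 / c)]; [1 + 8192 / c] dominates it and is visibly at
    least 1. *)
Lemma sqrt_factor_le (R : realType) (c W X U V : R) : 0 < c -> 0 <= X -> 0 <= U -> 0 <= V ->
  c * W <= 8192 * X * (U * V) ->
  Num.sqrt W <= (1 + 8192 / c) * Num.sqrt X * Num.sqrt U * Num.sqrt V.
Proof.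
move=> c0 X0 U0 V0 h; pose k := 8192 / c.
have k0 : 0 <= k by exact: divr_ge0 (ler0n _ _) (ltW c0).
have XUV : 0 <= X * U * V by rewrite !mulr_ge0.
have W1 : W <= k * (X * U * V).
  rewrite -(ler_pM2l c0); apply: (le_trans h); rewrite le_eqVlt; apply/orP; left; apply/eqP.
  by rewrite /k; field; rewrite gt_eqF.
have k1 : k <= (1 + k) ^+ 2.
  by apply: (@le_trans _ _ (1 + k)); rewrite ?lerDr// ler_eXnr// lerDl.
apply: (@le_trans _ _ (Num.sqrt ((1 + k) ^+ 2 * (X * U * V)))).
  by apply: ler_wsqrtr; apply: (le_trans W1); exact: ler_wpM2r.
rewrite sqrtrM ?sqr_ge0// sqrtr_sqr ger0_norm ?addr_ge0// !sqrtrM ?mulr_ge0//.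
by rewrite !mulrA.
Qed.

Theorem theorem2p1 (R : realType) :
  exists eps0 C : R, [/\ 0 < eps0, eps0 < 1, 1 <= C &
    forall (N1 N2 L1 L2 : R) (s1 s2 : bool) (omega : vec3 R) (a b alpha : R)
           (u1 u2 : spacetime R -> R[i]),
      0 < N1 -> 0 < N2 -> 0 < L1 -> 0 < L2 ->
      norm3 omega = 1 ->
      a <= b ->
      0 < alpha -> alpha <= eps0 ->
      in_L2 u1 -> in_L2 u2 ->
      fourier_supp u1 (Kset s1 N1 L1) ->
      fourier_supp u2 (Kset s2 N2 L2) ->
      fourier_supp u1 (angular_region omega alpha) ->
      let A := slab omega a b in
      let u12 := fun z => u1 z * u2 z in
      (exists w, is_multiplier A u12 w) /\
      forall w, is_multiplier A u12 w ->
        (L2norm w <=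
         (C * Num.sqrt ((b - a) * Num.min N1 N2 * (L1 * L2) / alpha))%:E
           * L2norm u1 * L2norm u2)%E].
Proof.
have c0 := fourier_mass_gt0 R.
exists 2^-1, (1 + 8192 / fourier_mass R); split.
- by rewrite invr_gt0.
- by rewrite invf_lt1// ltr1n.
- by rewrite lerDl; exact: divr_ge0 (ler0n _ _) (ltW c0).
move=> N1 N2 L1 L2 s1 s2 omega a b alpha u1 u2 N1_gt0 N2_gt0 L1_gt0 L2_gt0 w1 ab alpha0 alpha1
  /in_L2P u1_2 /in_L2P u2_2 K1 K2 ang A u12.
pose h := fun z => (\1_A z : R)%:C * fourierL1 u12 z.
have key l := @multiplier_symbol_le R N1 N2 L1 L2 a b l alpha s1 s2 omega u1 u2
  N1_gt0 N2_gt0 L1_gt0 L2_gt0.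
(* The width [b - a + 1] is one admissible choice of [l]; membership of [h] does not depend on
   it. *)
have h12 : cL12 h.
  have l0 : 0 < b - a + 1 by rewrite ltr_wpDl// subr_ge0.
  have l1 : b - a <= b - a + 1 by rewrite lerDl.
  exact: (key _ l0 l1 w1 alpha0 alpha1 K1 K2 ang).1.
split; first by exists (fourier_inv h); exact: fourierL2_inv.
move=> w wh; have /fourierL2P[w2 _ _] := wh.
pose k := 8192 / alpha * Num.min N1 N2 * (L1 * L2) * (cip u1 u1 * cip u2 u2).
have n0 : 0 <= Num.min N1 N2 by rewrite le_min !ltW.
have k0 : 0 <= k.
  apply: mulr_ge0; last by apply: mulr_ge0; exact: cip_ge0.
  by apply: mulr_ge0; [exact: mulr_ge0 (divr_ge0 (ler0n _ _) (ltW alpha0)) n0|exact: mulr_ge0 (ltW L1_gt0) (ltW L2_gt0)].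
have hk : cip h h <= k * (b - a).
  apply: le_affine_limit => //; first by rewrite subr_ge0.
  move=> l l0 bal; have [_ e] := key _ l0 bal w1 alpha0 alpha1 K1 K2 ang.
  by rewrite mulrAC.
(* Plancherel for [w] puts [fourier_mass] on the left, whence its inverse in the final constant. *)
have wE := cip_fourierL2 wh.
rewrite !L2normE// -!EFinM lee_fin.
apply: sqrt_factor_le c0 _ (cip_ge0 u1) (cip_ge0 u2) _.
  apply: mulr_ge0; last by rewrite invr_ge0 ltW.
  by apply: mulr_ge0; [apply: mulr_ge0 => //; rewrite subr_ge0|rewrite mulr_ge0// ltW].
rewrite -wE; apply: (le_trans hk); rewrite /k.
move: (Num.min N1 N2) (cip u1 u1 * cip u2 u2) => n x.
by rewrite le_eqVlt; apply/orP; left; apply/eqP; ring.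
Qed.
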